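(* Let $s\ge 2$ and let $\mathbf{k}=(k_1,\dots,k_s)\in\mathbb{N}^s$ with $k_1\ge\dots\ge k_s$ and $k_c\ge3$ for all $c$, and suppose $\mathbf{k}$ has the extension property. Then for every $\delta>0$ there exist $n_0\in\mathbb{N}$ and $\varepsilon>0$ such that the following holds. If $G$ is a graph on $n\ge n_0$ vertices with $\log F(G;\mathbf{k})/\binom{n}{2}\ge Q(\mathbf{k})-\varepsilon$, then for at least $(1-2^{-\varepsilon n^2})F(G;\mathbf{k})$ of the $\mathbf{k}$-valid colourings $\chi:E(G)\to[s]$ there exist $(r^*,\phi^*,\boldsymbol{\alpha}^* )\in\mathop{\textsc{opt}}^*(\mathbf{k})$ and a partition $Y_1\cup\dots\cup Y_{r^*}$ of $V(G)$ (both possibly depending on $\chi$) such that: (i) for all $i\in[r^*]$, $\big||Y_i|-\alpha^*_i n\big|<1$; (ii) for all $ij\in\binom{[r^*]}{2}$ and all $c\in\phi^*(ij)$, the bipartite graph of edges of colour $c$ between $Y_i$ and $Y_j$ is $(\delta,|\phi^*(ij)|^{-1})$-regular; in particular $e_G(Y_i,Y_j)\ge(1-s\delta)|Y_i||Y_j|$; (iii) if $\sum_{i\in[r^*]}e(G[Y_i])>\delta n^2$, then $\mathbf{k}$ does not have the strong extension property, all but at most $\delta n^2$ edges of $\bigcup_{i\in[r^*]}G[Y_i]$ receive colour $1$ under $\chi$, and moreover if $\boldsymbol{\ell}=(\ell_1,\dots,\ell_{r^*})\in\mathbb{N}^{r^*}$ is such that $G[Y_i]$ is $\delta$-far from being $K_{\ell_i}$-free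 for every $i\in[r^*]$, then $\|\boldsymbol{\ell}\|_1\le k_1-1$.
   Context: Logs are base 2; $\mathbb{N}=\{1,2,\dots\}$. An $s$-edge-colouring $\chi:E(G)\to[s]$ (not necessarily proper) is $\mathbf{k}$-valid if for each $c\in[s]$ the subgraph of colour-$c$ edges contains no $K_{k_c}$; $F(G;\mathbf{k})$ is the number of $\mathbf{k}$-valid colourings of $G$. For disjoint $A,B\subseteq V(H)$, $d_H(A,B)=e_H(A,B)/(|A||B|)$, and $H[A,B]$ is $(\delta,d)$-regular if $d_H(A,B)\in(d-\delta,d+\delta)$ and $|d_H(X,Y)-d_H(A,B)|<\delta$ for all $X\subseteq A$, $Y\subseteq B$ with $|X|\ge\delta|A|$, $|Y|\ge\delta|B|$. A graph $G$ is $\delta$-far from being $H$-free if it has edit distance at least $\delta|V(G)|^2$ from every $H$-free graph on the same number of vertices. $\Phi_t(r;\mathbf{k})$ ($t\in\{0,1,2\}$) is the set of $\phi:\binom{[r]}{2}\to2^{[s]}$ such that each graph $([r],\phi^{-1}(c))$, $\phi^{-1}(c)=\{ij:c\in\phi(ij)\}$, is $K_{k_c}$-free and $|\phi(ij)|\ge t$ for all pairs. $\Delta^r$: nonnegative vectors in $\mathbb{R}^r$ summing to $1$. $q(\phi,\boldsymbol{\alpha})=2\sum_{i<j,\ \phi(ij)\neq\emptyset}\alpha_i\alpha_j\log|\phi(ij)|$. $\mathop{\textsc{feas}}_t(\mathbf{k})$: triples $(r,\phi,\boldsymbol{\alpha})$ with $\phi\in\Phi_t(r;\mathbf{k})$,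 $\boldsymbol{\alpha}\in\Delta^r$. $Q(\mathbf{k})=\max q$ over $\mathop{\textsc{feas}}_2(\mathbf{k})$ (known to equal the maxima over $\mathop{\textsc{feas}}_1,\mathop{\textsc{feas}}_0$). $\mathop{\textsc{opt}}^*(\mathbf{k})$: triples in $\mathop{\textsc{feas}}_2(\mathbf{k})$ with $q=Q(\mathbf{k})$ and all $\alpha_i>0$. For $\phi\in\Phi_0(r;\mathbf{k})$, $i$ is a clone of $j\ne i$ if $\phi(ik)=\phi(jk)$ for all $k\ne i,j$ and $|\phi(ij)|\le1$; a strong clone if also $\phi(ij)=\emptyset$. For $\phi\in\Phi_0(r+1;\mathbf{k})$, $\boldsymbol{\alpha}\in\Delta^r$: $\mathrm{ext}(\phi,\boldsymbol{\alpha})=\sum_{i\in[r]:\phi(\{i,r+1\})\ne\emptyset}\alpha_i\log|\phi(\{i,r+1\})|$. $\mathbf{k}$ has the (strong) extension property if for every $(r^*,\phi^*,\boldsymbol{\alpha}^* )\in\mathop{\textsc{opt}}^*(\mathbf{k})$ and every $\phi\in\Phi_0(r^*+1;\mathbf{k})$ extending $\phi^*$ with $\mathrm{ext}(\phi,\boldsymbol{\alpha}^* )=Q(\mathbf{k})$, the vertex $r^*+1$ is a (strong) clone under $\phi$ of some $j\in[r^*]$. *)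

(* Defs.v *)
From mathcomp Require Import all_boot all_order all_algebra.
From mathcomp Require Import all_classical all_reals all_analysis.
From mathcomp Require Import finset.

Set Implicit Arguments.
Unset Strict Implicit.
Unset Printing Implicit Defensive.

Import Order.TTheory GRing.Theory Num.Theory.

Local Open Scope ring_scope.

(* log2 0 = 0 here, by the convention on ln. *)
Definition log2 (R : realType) (x : R) : R := ln x / ln 2.

(* A graph with vertex set V is given by its edge set. *)
Definition simple_graph (V : finType) (G : {set {set V}}) : bool :=
  [forall e in G, #|e| == 2].

Definition contains_clique (V : finType) (l : nat) (G : {set {set V}}) : bool :=
  [exists A : {set V}, (#|A| == l) &&
    [forall x in A, forall y in A, (x != y) ==> ([set x; y] \in G)]].

Definition clique_free (V : finType) (l : nat) (G : {set {set V}}) : bool :=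
  ~~ contains_clique l G.

Definition induced_subgraph (V : finType) (G : {set {set V}}) (A : {set V}) :
    {set {set {x : V | x \in A}}} :=
  [set e : {set {x : V | x \in A}} | [set val x | x in e] \in G].

(* e_G(A, B), meant for disjoint A and B *)
Definition edges_between (V : finType) (G : {set {set V}}) (A B : {set V}) : nat :=
  #|[set p in setX A B | [set p.1; p.2] \in G]|.

(* 0 if A or B is empty *)
Definition density (R : realType) (V : finType) (G : {set {set V}})
    (A B : {set V}) : R :=
  (edges_between G A B)%:R / (#|A|%:R * #|B|%:R).

Definition regular_pair (R : realType) (V : finType) (delta d : R)
    (G : {set {set V}}) (A B : {set V}) : Prop :=
  d - delta < density R G A B < d + delta /\
  forall X Y : {set V}, X \subset A -> Y \subset B ->
    delta * #|A|%:R <= #|X|%:R -> delta * #|B|%:R <= #|Y|%:R ->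
    `|density R G X Y - density R G A B| < delta.

Definition edit_distance (V : finType) (G G' : {set {set V}}) : nat :=
  #|(G :\: G') :|: (G' :\: G)|.

(* Being K_l-free is invariant under isomorphism, so it is enough to range over
   the K_l-free graphs on the vertex set of G itself. *)
Definition far_from_clique_free (R : realType) (V : finType) (delta : R)
    (l : nat) (G : {set {set V}}) : Prop :=
  forall G' : {set {set V}}, simple_graph G' -> clique_free l G' ->
    delta * #|V|%:R ^+ 2 <= (edit_distance G G')%:R.

Notation colouring s G := {ffun {e : {set _} | e \in G} -> 'I_s} (only parsing).

Definition colour_class (V : finType) (s : nat) (G : {set {set V}})
    (chi : colouring s G) (c : 'I_s) : {set {set V}} :=
  [set val e | e : {e : {set V} | e \in G} & chi e == c].

Definition valid_colouring (V : finType) (s : nat) (k : 'I_s -> nat)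
    (G : {set {set V}}) (chi : colouring s G) : bool :=
  [forall c, clique_free (k c) (colour_class chi c)].

Definition num_valid (V : finType) (s : nat) (k : 'I_s -> nat)
    (G : {set {set V}}) : nat :=
  #|[set chi : colouring s G | valid_colouring k chi]|.

(* A map phi from pairs of elements of [r] to subsets of [s] is encoded as a
   function on all subsets of [r]; only its values on 2-element sets are ever
   used, and two maps are identified when they agree there. *)
Definition pattern (r s : nat) : Type := {set 'I_r} -> {set 'I_s}.

Definition pattern_graph (r s : nat) (phi : pattern r s) (c : 'I_s) :
    {set {set 'I_r}} :=
  [set e : {set 'I_r} | (#|e| == 2) && (c \in phi e)].

Definition Phi (t s : nat) (k : 'I_s -> nat) (r : nat) (phi : pattern r s) : Prop :=
  (forall c, clique_free (k c) (pattern_graph phi c)) /\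
  (forall i j : 'I_r, i != j -> (t <= #|phi [set i; j]|)%N).

Definition simplex (R : realType) (r : nat) (alpha : 'rV[R]_r) : Prop :=
  (forall i, 0 <= alpha 0 i) /\ \sum_(i < r) alpha 0 i = 1.

Definition q (R : realType) (s r : nat) (phi : pattern r s) (alpha : 'rV[R]_r) : R :=
  2 * \sum_(i < r) \sum_(j < r | (i < j)%N && (phi [set i; j] != set0))
        alpha 0 i * alpha 0 j * log2 #|phi [set i; j]|%:R.

Definition feas (R : realType) (t s : nat) (k : 'I_s -> nat) (r : nat)
    (phi : pattern r s) (alpha : 'rV[R]_r) : Prop :=
  Phi t k phi /\ simplex alpha.

(* When k_c >= 2 for all c, feas_2 is nonempty and, r being bounded by Ramsey's
   theorem, this supremum is a maximum. *)
Definition Q (R : realType) (s : nat) (k : 'I_s -> nat) : R :=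
  sup [set x : R | exists (r : nat) (phi : pattern r s) (alpha : 'rV[R]_r),
         feas 2 k phi alpha /\ x = q phi alpha]%classic.

Definition opt_star (R : realType) (s : nat) (k : 'I_s -> nat) (r : nat)
    (phi : pattern r s) (alpha : 'rV[R]_r) : Prop :=
  [/\ feas 2 k phi alpha, q phi alpha = Q R k & forall i, 0 < alpha 0 i].

Definition clone (s r : nat) (phi : pattern r s) (i j : 'I_r) : Prop :=
  [/\ j != i,
      (forall k : 'I_r, k != i -> k != j -> phi [set i; k] = phi [set j; k])
    & (#|phi [set i; j]| <= 1)%N].

Definition strong_clone (s r : nat) (phi : pattern r s) (i j : 'I_r) : Prop :=
  clone phi i j /\ phi [set i; j] = set0.

(* In 'I_r.+1 the new vertex r + 1 is ord_max, and i : 'I_r becomes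
   widen_ord (leqnSn r) i, which has the same value. *)
Definition old_vertex (r : nat) (i : 'I_r) : 'I_r.+1 := widen_ord (leqnSn r) i.

Definition extends (s r : nat) (phi : pattern r.+1 s) (phi' : pattern r s) : Prop :=
  forall i j : 'I_r, i != j ->
    phi [set old_vertex i; old_vertex j] = phi' [set i; j].

Definition ext (R : realType) (s r : nat) (phi : pattern r.+1 s)
    (alpha : 'rV[R]_r) : R :=
  \sum_(i < r | phi [set old_vertex i; ord_max] != set0)
     alpha 0 i * log2 #|phi [set old_vertex i; ord_max]|%:R.

Definition extension_property (R : realType) (s : nat) (k : 'I_s -> nat) : Prop :=
  forall (r : nat) (phi' : pattern r s) (alpha : 'rV[R]_r),
    opt_star k phi' alpha ->
    forall phi : pattern r.+1 s,
      Phi 0 k phi -> extends phi phi' -> ext phi alpha = Q R k ->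
      exists j : 'I_r, clone phi ord_max (old_vertex j).

Definition strong_extension_property (R : realType) (s : nat)
    (k : 'I_s -> nat) : Prop :=
  forall (r : nat) (phi' : pattern r s) (alpha : 'rV[R]_r),
    opt_star k phi' alpha ->
    forall phi : pattern r.+1 s,
      Phi 0 k phi -> extends phi phi' -> ext phi alpha = Q R k ->
      exists j : 'I_r, strong_clone phi ord_max (old_vertex j).

(* Parts may be empty. *)
Definition vertex_partition (V : finType) (r : nat) (Y : 'I_r -> {set V}) : Prop :=
  (forall i j, i != j -> [disjoint Y i & Y j]) /\ \bigcup_(i < r) Y i = [set: V].

(* c1 stands for colour 1. *)
Definition stable_structure (R : realType) (V : finType) (s : nat)
    (k : 'I_s -> nat) (c1 : 'I_s) (delta : R) (G : {set {set V}})
    (chi : colouring s G) (r : nat) (phi : pattern r s) (alpha : 'rV[R]_r)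
    (Y : 'I_r -> {set V}) : Prop :=
  [/\ forall i, `|#|Y i|%:R - alpha 0 i * #|V|%:R| < 1,
      forall i j : 'I_r, i != j ->
        (forall c, c \in phi [set i; j] ->
           regular_pair delta (#|phi [set i; j]|%:R^-1)
             (colour_class chi c) (Y i) (Y j)) /\
        (1 - s%:R * delta) * (#|Y i|%:R * #|Y j|%:R)
          <= (edges_between G (Y i) (Y j))%:R
    & delta * #|V|%:R ^+ 2 < (\sum_(i < r) #|induced_subgraph G (Y i)|)%N%:R ->
      [/\ ~ strong_extension_property R k,
          #|[set e : {e : {set V} | e \in G} |
              [exists i, val e \subset Y i] && (chi e != c1)]|%:R
            <= delta * #|V|%:R ^+ 2
        & forall l : 'I_r -> nat, (forall i, (0 < l i)%N) ->
            (forall i, far_from_clique_free delta (l i) (induced_subgraph G (Y i))) ->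
            (\sum_(i < r) l i <= k c1 - 1)%N]].

(* Main.v *)
(* Colourings are grouped by containers. The colour classes of a valid colouring
   lie, up to o(n^2) edges, in a template tau that assigns a set of colours to
   each pair of vertices, is described by O(n) bits, and is such that almost all
   tuples of vertices of bounded size induce an admissible pattern. Averaging over
   random tuples bounds the sum of log |tau(x, y)| by (Q + o(1)) n^2, and a
   template far below this bound contains a negligible part of the colourings.

   If tau is near the bound, a random sample of vertices induces a nearly optimal
   pattern, and by compactness some of its vertices induce the pattern of an
   optimal triple. Almost every other vertex extends this triple with value nearly
   Q, so by the extension property it is a clone of a vertex of the triple. This
   partitions the vertices; comparing pairs of vertices shows that tau is given
   by phi* between different parts, up to o(n^2) pairs, and is empty inside the
   parts unless the strong extension property fails. In the latter case the clone
   has a single colour, which optimality forces to be colour 1 and to occur in all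
   phi*(ij), and inside the parts tau is contained in that colour.

   The colourings following tau are counted by product weights in which colours
   outside tau have small weight. Under these weights, an irregular pair has
   probability exp(-c n^2) by Chernoff's bound. If the numbers l_i sum to more than
   k_1 - 1, there are linearly many disjoint cliques of colour 1 of suitable sizes
   in each part. Taking the clique number a + ib modulo p in part i, with p
   coprime to all differences of indices, yields p^2 families without common pairs
   across the parts; none of them may be joined up in colour 1, which again has
   probability exp(-c n^2). *)

Require Import Defs.
From mathcomp Require Import all_boot all_order all_algebra.
From mathcomp Require Import all_classical all_reals all_analysis.
From mathcomp Require Import ring lra zify.
From mathcomp Require Import finset.

Set Implicit Arguments.
Unset Strict Implicit.
Unset Printing Implicit Defensive.

Import Order.TTheory GRing.Theory Num.Theory.
Local Open Scope ring_scope.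

(** * Patterns *)

(** All constants have to be chosen before the graph is known. This is possible because Ramsey's
    theorem bounds the number of vertices of a pattern in $\Phi_2$, so that there are finitely many
    patterns, and because under the extension property an optimal pattern has only one maximising
    weight vector; weights with nearly optimal value are then close to it by compactness. A sample
    of bounded size takes the place of a regularity partition. The value of the sampled pattern does
    not control the other vertices: the average value with which they extend the optimal triple is a
    weighted mean of the degrees of its vertices in the template. The sample therefore has to avoid
    vertices of low degree, and these are shown to be few by applying the averaging bound to
    non-uniform weights. The families of disjoint cliques have to be guessed in a union bound with
    exp(O(n log n)) terms. Linearly many independent events would not outweigh it, which is why
    quadratically many selections without common pairs are needed. *)

Lemma contains_cliqueP (V : finType) (l : nat) (G : {set {set V}}) :
  (forall x, [set x; x] \notin G) ->
  reflect (exists g : {ffun 'I_l -> V}, forall a b : 'I_l, (a < b)%N -> [set g a; g b] \in G)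
    (contains_clique l G).
Proof.
move=> G2; apply: (iffP existsP) => [[A /andP[/eqP Al /forall_inP AG]]|[g gG]].
  have := enum_val_inj (A := mem A).
  move: (@enum_val _ (mem A)) (@enum_valP _ (mem A)); rewrite Al => f fA f_inj.
  exists (finfun f) => a b ab; rewrite !ffunE.
  have /forall_inP/(_ _ (fA b))/implyP := AG _ (fA a); apply.
  by apply: contraTneq ab => /f_inj ->; rewrite ltnn.
have gneq a b : a != b -> [set g a; g b] \in G.
  rewrite neq_ltn => /orP[|] ab; first exact: gG.
  by rewrite setUC; exact: gG.
have g_inj : injective g.
  move=> a b gab; apply/eqP; apply: contraT => /gneq; rewrite gab => H.
  by have := G2 (g b); rewrite H.
exists (g @: setT); rewrite card_imset // cardsT card_ord eqxx /=.
apply/forall_inP => _ /imsetP[a _ ->]; apply/forall_inP => _ /imsetP[b _ ->].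
by apply/implyP => ab; apply: gneq; apply: contraNneq ab => ->.
Qed.

Section Forms.
Variables (R : realType) (s : nat) (k : 'I_s -> nat).

Definition weight (A : {set 'I_s}) : R := log2 #|A|%:R.

Lemma ln2_gt0 : 0 < ln 2 :> R.
Proof. by apply: ln_gt0; rewrite ltr1n. Qed.

Lemma log2_le (x y : R) : 0 < x -> x <= y -> log2 x <= log2 y.
Proof.
move=> x0 xy; rewrite /log2 ler_pM2r ?invr_gt0 ?ln2_gt0 // ler_ln ?posrE //.
exact: lt_le_trans xy.
Qed.

Lemma log2_nat_ge0 (m : nat) : 0 <= log2 (m%:R : R).
Proof.
case: m => [|m]; first by rewrite /log2 ln0 ?mul0r.
by rewrite /log2 divr_ge0 ?ln_ge0 ?ler1n // ltW // ln2_gt0.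
Qed.

Lemma log2_nat_le (m n : nat) : (m <= n)%N -> log2 (m%:R : R) <= log2 n%:R.
Proof.
case: m => [|m] mn; first by rewrite {1}/log2 ln0 ?mul0r ?log2_nat_ge0.
by apply: log2_le; rewrite ?ltr0n ?ler_nat.
Qed.

Lemma log2_nat_lt (m n : nat) : (1 < n)%N -> (m < n)%N -> log2 (m%:R : R) < log2 n%:R.
Proof.
move=> n1 mn; rewrite /log2 ltr_pM2r ?invr_gt0 ?ln2_gt0 //.
case: m mn => [|m] mn; first by rewrite ln0 // ln_gt0 // ltr1n.
by rewrite ltr_ln ?posrE ?ltr_nat ?ltr0n // (ltn_trans _ mn).
Qed.

Lemma weight_ge0 (A : {set 'I_s}) : 0 <= weight A. Proof. exact: log2_nat_ge0. Qed.

Lemma weight_le (A : {set 'I_s}) : weight A <= log2 s%:R.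
Proof. by apply: log2_nat_le; rewrite -[leqRHS]card_ord max_card. Qed.

Lemma weight_small (A : {set 'I_s}) : (#|A| <= 1)%N -> weight A = 0.
Proof.
by rewrite /weight /log2; case: #|A| => [|[|m]] // _; [rewrite ln0 ?mul0r | rewrite ln1 mul0r].
Qed.

Lemma weight_lt (A B : {set 'I_s}) : (1 < #|B|)%N -> (#|A| < #|B|)%N -> weight A < weight B.
Proof. exact: log2_nat_lt. Qed.

(* Patterns are represented by symmetric functions that are empty on the diagonal. *)
Definition pairing (J : finType) (p : J -> J -> {set 'I_s}) : Prop :=
  (forall x y, p x y = p y x) /\ (forall x, p x x = set0).

(* As [p x x] is empty, tuples [g] with repeated entries may be included. *)
Definition valid (J : finType) (p : J -> J -> {set 'I_s}) : bool :=
  [forall c, forall g : {ffun 'I_(k c) -> J}, exists a : 'I_(k c), exists b : 'I_(k c),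
     (a < b)%N && (c \notin p (g a) (g b))].

Lemma validP (J : finType) (p : J -> J -> {set 'I_s}) :
  reflect (forall c (g : 'I_(k c) -> J), exists a b : 'I_(k c), (a < b)%N /\ c \notin p (g a) (g b))
    (valid p).
Proof.
apply: (iffP forallP) => [H c g|H c].
  have /forallP/(_ (finfun g))/existsP[a /existsP[b /andP[ab cp]]] := H c.
  by exists a, b; rewrite !ffunE in cp.
by apply/forallP => g; have [a [b [ab cp]]] := H c g;
   apply/existsP; exists a; apply/existsP; exists b; rewrite ab cp.
Qed.

(** The map [h] may identify vertices: since tuples with repetitions are included, validity is
    stable under blow-ups, and cloning a vertex is the case of a non-injective [h]. *)
Lemma valid_comp (J J' : finType) (p : J -> J -> {set 'I_s}) (h : J' -> J) :
  valid p -> valid (fun x y => p (h x) (h y)).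
Proof. by move=> /validP H; apply/validP => c g; exact: (H c (h \o g)). Qed.

Lemma valid_eq (J : finType) (p p' : J -> J -> {set 'I_s}) :
  (forall x y, p x y = p' x y) -> valid p = valid p'.
Proof.
move=> pp'; apply/validP/validP => H c g; have [a [b [ab cp]]] := H c g;
  by exists a, b; rewrite ?pp' // -pp'.
Qed.

Definition form (J : finType) (p : J -> J -> {set 'I_s}) (al : J -> R) : R :=
  \sum_x \sum_y al x * al y * weight (p x y).

Definition pcol (r : nat) (phi : pattern r s) (i j : 'I_r) : {set 'I_s} :=
  if i == j then set0 else phi [set i; j].

Lemma pcol_pairing r (phi : pattern r s) : pairing (pcol phi).
Proof.
by split=> [x y|x]; rewrite /pcol ?eqxx // eq_sym setUC.
Qed.

Lemma valid_pcol r (phi : pattern r s) :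
  reflect (forall c, clique_free (k c) (pattern_graph phi c)) (valid (pcol phi)).
Proof.
have G2 c x : [set x; x] \notin pattern_graph phi c.
  by rewrite inE setUid cards1.
apply: (iffP (validP _)) => [H c|H c g].
  apply/negP => /(contains_cliqueP _ (G2 c))[g gG].
  have [a [b [ab]]] := H c g; have := gG _ _ ab; rewrite inE /pcol => /andP[c2 cp].
  by case: eqVneq => [e|_]; [move: c2; rewrite e setUid cards1 | rewrite cp].
have /negP := H c; apply: contra_notP => Hg.
apply/(contains_cliqueP _ (G2 c)); exists (finfun g) => a b ab; rewrite !ffunE.
apply: contra_notT Hg => Hab; exists a, b; split=> //; rewrite /pcol.
case: eqVneq => [|gab]; first by rewrite inE.
by apply: contraNN Hab; rewrite inE cards2 gab.
Qed.

Lemma PhiP t r (phi : pattern r s) :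
  Phi t k phi <-> valid (pcol phi) /\ forall i j, i != j -> (t <= #|pcol phi i j|)%N.
Proof.
split=> [[H1 H2]|[H1 H2]]; split; first exact/valid_pcol.
- by move=> i j ij; rewrite /pcol (negPf ij); exact: H2.
- exact/valid_pcol.
- by move=> i j ij; have := H2 _ _ ij; rewrite /pcol (negPf ij).
Qed.

(** The sum over ordered pairs absorbs the factor 2, and the convention that [log2] vanishes at 0
    removes the restriction to non-empty colour sets. *)
Lemma q_form r (phi : pattern r s) (al : 'rV[R]_r) : q phi al = form (pcol phi) (al 0).
Proof.
rewrite /q /form.
pose F i j := al 0 i * al 0 j * weight (pcol phi i j).
have FC i j : F i j = F j i by rewrite /F (pcol_pairing phi).1 [al 0 i * _]mulrC.
have E : \sum_(i < r) \sum_(j < r | (i < j)%N && (phi [set i; j] != set0))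
     al 0 i * al 0 j * log2 #|phi [set i; j]|%:R = \sum_(i < r) \sum_(j < r | (i < j)%N) F i j.
  apply: eq_bigr => i _; rewrite [RHS](bigID (fun j => phi [set i; j] != set0)) /=.
  rewrite [X in _ = _ + X]big1 ?addr0 => [|j /andP[ij /negPn/eqP e]]; last first.
    rewrite /F /pcol e if_same weight_small ?mulr0 // cards0 //.
  apply: eq_bigr => j /andP[ij _]; rewrite /F /pcol ifN //.
  by apply: contraTneq ij => ->; rewrite ltnn.
rewrite E {E}.
have E : \sum_i \sum_j F i j = \sum_(i < r) \sum_(j < r | (i < j)%N) F i j +
   \sum_(i < r) \sum_(j < r | (j < i)%N) F i j.
  rewrite -big_split; apply: eq_bigr => i _ /=.
  rewrite (bigID (fun j : 'I_r => (i < j)%N)) /=; congr (_ + _).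
  rewrite (bigID (fun j : 'I_r => (j < i)%N)) /=.
  rewrite [X in _ + X]big1 ?addr0 => [|j]; last first.
    rewrite -!leqNgt => ij; have /val_inj <- : i = j :> nat by apply/eqP; rewrite eqn_leq andbC.
    by rewrite /F (pcol_pairing phi).2 weight_small ?cards0 ?mulr0.
  by apply: eq_bigl => j; rewrite -leqNgt; case: ltngtP.
rewrite [RHS]E.
rewrite [X in _ = _ + X](exchange_big_dep xpredT) //=.
rewrite [X in _ = _ + X](_ : _ = \sum_(i < r) \sum_(j < r | (i < j)%N) F i j); first by ring.
by apply: eq_bigr => i _; apply: eq_bigr => j _; exact: FC.
Qed.

End Forms.

(** * Symmetrisation and the bound of all forms by the optimum *)

Section Zykov.
Variables (R : realType) (s : nat) (k : 'I_s -> nat).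
Local Notation weight := (@weight R s).
Local Notation L := (log2 (s%:R : R)).
Local Notation form := (@form R s).

Definition deg (J : finType) (p : J -> J -> {set 'I_s}) (al : J -> R) (x : J) : R :=
  \sum_y al y * weight (p x y).

Lemma form_deg (J : finType) (p : J -> J -> {set 'I_s}) (al : J -> R) : form p al = \sum_x al x * deg p al x.
Proof.
apply: eq_bigr => x _; rewrite /deg big_distrr /=.
by apply: eq_bigr => y _; rewrite mulrA.
Qed.

Lemma eq_form (J : finType) (p p' : J -> J -> {set 'I_s}) (al be : J -> R) :
  (forall x y, p x y = p' x y) -> al =1 be -> form p al = form p' be.
Proof.
move=> pp' ab; apply: eq_bigr => x _; apply: eq_bigr => y _.
by rewrite pp' !ab.
Qed.

Lemma deg_ge0 (J : finType) (p : J -> J -> {set 'I_s}) (al : J -> R) x : (forall x, 0 <= al x) -> 0 <= deg p al x.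
Proof. by move=> al0; apply: sumr_ge0 => y _; rewrite mulr_ge0 ?weight_ge0. Qed.

Lemma deg_le (J : finType) (p : J -> J -> {set 'I_s}) (al : J -> R) x :
  (forall x, 0 <= al x) -> deg p al x <= L * \sum_y al y.
Proof.
move=> al0; rewrite /deg mulrC big_distrl /=; apply: ler_sum => y _.
by rewrite ler_wpM2l ?weight_le.
Qed.

Lemma form_ge0 (J : finType) (p : J -> J -> {set 'I_s}) (al : J -> R) : (forall x, 0 <= al x) -> 0 <= form p al.
Proof.
by move=> al0; rewrite form_deg; apply: sumr_ge0 => y _; rewrite mulr_ge0 ?deg_ge0.
Qed.

Lemma form_le (J : finType) (p : J -> J -> {set 'I_s}) (al : J -> R) :
  (forall x, 0 <= al x) -> form p al <= L * (\sum_y al y) ^+ 2.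
Proof.
move=> al0; rewrite form_deg expr2 mulrA mulrC big_distrl /=; apply: ler_sum => y _.
by rewrite ler_wpM2l ?deg_le.
Qed.

Lemma form_scale (J : finType) (p : J -> J -> {set 'I_s}) (al : J -> R) c :
  form p (fun x => c * al x) = c ^+ 2 * form p al.
Proof.
rewrite /form big_distrr /=; apply: eq_bigr => x _; rewrite big_distrr /=.
by apply: eq_bigr => y _; ring.
Qed.

Lemma degD (J : finType) (p : J -> J -> {set 'I_s}) (al be : J -> R) x :
  deg p (fun x => al x + be x) x = deg p al x + deg p be x.
Proof.
by rewrite /deg -big_split; apply: eq_bigr => y _ /=; rewrite mulrDl.
Qed.

Lemma deg_sym (J : finType) (p : J -> J -> {set 'I_s}) (al be : J -> R) : pairing p ->
  \sum_x be x * deg p al x = \sum_x al x * deg p be x.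
Proof.
move=> [psym _]; rewrite /deg; under eq_bigr do rewrite big_distrr /=.
rewrite exchange_big /=; apply: eq_bigr => x _; rewrite big_distrr /=.
by apply: eq_bigr => y _; rewrite psym; ring.
Qed.

Lemma formD (J : finType) (p : J -> J -> {set 'I_s}) (al be : J -> R) : pairing p ->
  form p (fun x => al x + be x) = form p al + 2 * \sum_x be x * deg p al x + form p be.
Proof.
move=> pp; rewrite !form_deg mulrDl mul1r {2}(deg_sym al be pp) -!big_split /=.
by apply: eq_bigr => x _; rewrite degD; ring.
Qed.

Lemma sum_delta (J : finType) (F : J -> R) (x : J) : \sum_z (z == x)%:R * F z = F x.
Proof.
rewrite (bigD1 x) //= eqxx mul1r big1 ?addr0 // => z /negPf ->.
by rewrite mul0r.
Qed.

(** Symmetrisation: if the pair of two support vertices carries at most one colour, moving all the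
    weight of the one with smaller degree to the other does not decrease the form and shrinks the
    support. *)
Lemma zykov (J : finType) (p : J -> J -> {set 'I_s}) (al : J -> R) : pairing p ->
  (forall x, 0 <= al x) -> exists be : J -> R,
  [/\ (forall x, 0 <= be x), \sum_x be x = \sum_x al x,
      (forall x, al x = 0 -> be x = 0), form p al <= form p be
    & forall x y, x != y -> be x != 0 -> be y != 0 -> (1 < #|p x y|)%N].
Proof.
move=> pp; have [n] := ubnP #|[set x | al x != 0]|; elim: n al => // n IHn al.
rewrite ltnS => aln al0.
have [|H] := pselect (exists x y, [/\ x != y, al x != 0, al y != 0 & (#|p x y| <= 1)%N]);
  last first.
  exists al; split=> // x y xy ax ay; rewrite ltnNge; apply: contra_notN H => pxy.
  by exists x, y.
move=> [x [y [xy ax ay pxy]]].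
wlog dxy : x y xy ax ay pxy / deg p al x <= deg p al y.
  move=> W; have /orP[|] := le_total (deg p al x) (deg p al y); first exact: W.
  by apply: W; rewrite // 1?eq_sym // pp.1.
(* The displacement. The form is linear along it ([fbe]), because the pair $xy$ and both loops have
   weight 0; the gain is [2 * al x] times the difference of the degrees. *)
pose be z := al x * (z == y)%:R - al x * (z == x)%:R.
have sumbe F : \sum_z be z * F z = al x * (F y - F x).
  rewrite mulrBr -(sum_delta F y) -(sum_delta F x) !big_distrr -sumrB /=.
  by apply: eq_bigr => z _; rewrite /be; ring.
have fbe : form p be = 0.
  have degbe z : deg p be z = al x * (weight (p z y) - weight (p z x)) by exact: sumbe.
  rewrite form_deg sumbe !degbe !pp.2 (pp.1 y x) (weight_small _ pxy) weight_small ?cards0 //.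
  by ring.
have albex : al x + be x = 0 by rewrite /be eqxx (negPf xy) mulr0 mulr1; ring.
have albey : al y + be y = al x + al y by rewrite /be eqxx (eq_sym y x) (negPf xy) mulr0 mulr1 subr0 addrC.
have albez z : z != x -> z != y -> al z + be z = al z.
  by move=> /negPf zx /negPf zy; rewrite /be zx zy; ring.
have [|z|ga [ga0 gas gaz gaf ga2]] := IHn (fun z => al z + be z).
- apply: leq_trans aln; apply: proper_card; apply/properP; split.
    apply/fintype.subsetP => z; rewrite !inE; apply: contraNN => /eqP az.
    have [->|zx] := eqVneq z x; first by rewrite albex.
    have [zy|zy] := eqVneq z y; first by rewrite -zy az eqxx in ay.
    by rewrite albez // az.
  by exists x; rewrite !inE ?albex ?eqxx.
- have [->|zx] := eqVneq z x; first by rewrite albex.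
  have [->|zy] := eqVneq z y; first by rewrite albey addr_ge0.
  by rewrite albez.
exists ga; split=> //.
- rewrite gas big_split /= -[RHS]addr0; congr (_ + _).
  by have := sumbe (fun=> 1); rewrite subrr mulr0 => {2}<-; apply: eq_bigr => z _; rewrite mulr1.
- move=> z az; apply: gaz.
  have [->|zx] := eqVneq z x; first exact: albex.
  have [zy|zy] := eqVneq z y; first by rewrite -zy az eqxx in ay.
  by rewrite albez.
- apply: le_trans gaf; rewrite formD // fbe sumbe addr0 lerDl mulr_ge0 // mulr_ge0 //.
  by rewrite subr_ge0.
Qed.

Lemma sum_inj (J J' : finType) (e : J' -> J) (F : J -> R) : injective e ->
  (forall x, F x != 0 -> exists i, x = e i) -> \sum_x F x = \sum_i F (e i).
Proof.
move=> e_inj Fe; rewrite (bigID (mem (e @: setT))) /= [X in _ + X]big1 ?addr0.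
  rewrite big_imset /=; last by move=> x y _ _; exact: e_inj.
  by apply: eq_bigl => i; rewrite inE.
move=> x; apply: contraNeq => /Fe[i ->]; exact: imset_f.
Qed.

Lemma form_inj (J J' : finType) (e : J' -> J) p (al : J -> R) : injective e ->
  (forall x, al x != 0 -> exists i, x = e i) ->
  form p al = form (fun i j => p (e i) (e j)) (al \o e).
Proof.
move=> e_inj ale; rewrite /form (sum_inj e_inj) => [|x nz]; last first.
  apply: ale; apply: contra_neq nz => ->; rewrite big1 // => y _.
  by rewrite !mul0r.
apply: eq_bigr => i _; rewrite (sum_inj e_inj) // => y nz.
by apply: ale; apply: contra_neq nz => ->; rewrite mulr0 mul0r.
Qed.

(** A function of two ordered arguments has to become one of an unordered set; the union over all
    choices does this for a pairing, since the empty loops add nothing. *)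
Definition pattern_of r (p : 'I_r -> 'I_r -> {set 'I_s}) : pattern r s :=
  fun E => \bigcup_(i in E) \bigcup_(j in E) p i j.

Lemma pcol_pattern_of r (p : 'I_r -> 'I_r -> {set 'I_s}) : pairing p ->
  forall i j, pcol (pattern_of p) i j = p i j.
Proof.
move=> pp i j; rewrite /pcol; case: eqVneq => [->|ij]; first by rewrite pp.2.
by rewrite /pattern_of !(finset.bigcup_setU, big_set1) !pp.2 set0U setU0 (pp.1 j i) setUid.
Qed.

(** Numbering the support by ['I_r] turns an abstract weighted pairing into a feasible triple with
    positive weights; [e] remembers which vertices are meant. *)
Lemma support_pattern (t : nat) (J : finType) (p : J -> J -> {set 'I_s}) (al : J -> R) : pairing p ->
  valid k p -> (forall x, 0 <= al x) -> \sum_x al x = 1 ->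
  (forall x y, x != y -> al x != 0 -> al y != 0 -> (t <= #|p x y|)%N) ->
  exists (r : nat) (e : 'I_r -> J) (phi : pattern r s) (be : 'rV[R]_r),
  [/\ injective e /\ (forall x, al x != 0 -> exists i, x = e i),
      forall i, be 0 i = al (e i) /\ 0 < be 0 i,
      forall i j, pcol phi i j = p (e i) (e j), feas t k phi be &
      q phi be = form p al].
Proof.
move=> pp vp al0 al1 alt; pose S := [set x | al x != 0].
exists #|S|, (fun i : 'I_#|S| => enum_val i : J).
set e := fun i => enum_val i.
have e_inj : injective e by exact: enum_val_inj.
have pe : pairing (fun i j => p (e i) (e j)).
  by split=> [i j|i]; [exact: pp.1 | exact: pp.2].
have ale i : al (e i) != 0 by have := enum_valP i; rewrite inE.
have eal x : al x != 0 -> exists i, x = e i.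
  move=> ax; have xS : x \in S by rewrite inE.
  by exists (enum_rank_in xS x); rewrite /e enum_rankK_in.
exists (pattern_of (fun i j => p (e i) (e j))), (\row_i al (e i)).
split=> //.
- by move=> i; rewrite mxE; split=> //; rewrite lt_def ale al0.
- by move=> i j; rewrite pcol_pattern_of.
- split.
    apply/PhiP; split; first by rewrite (valid_eq _ (pcol_pattern_of pe)); exact: (valid_comp e).
    by move=> i j ij; rewrite pcol_pattern_of // alt // (inj_eq e_inj).
  split=> [i|]; first by rewrite mxE.
  by rewrite -[RHS]al1 (sum_inj e_inj) //; apply: eq_bigr => i _; rewrite mxE.
rewrite q_form (form_inj _ e_inj) //; apply: eq_form => [x y|i /=].
  exact: pcol_pattern_of.
by rewrite mxE.
Qed.

Lemma feas_le_Q r (phi : pattern r s) (al : 'rV[R]_r) : feas 2 k phi al -> q phi al <= Q R k.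
Proof.
move=> fe; rewrite /Q; apply: ub_le_sup; last by exists r, phi, al.
exists L => _ [r' [phi' [al' [[_ [a0 a1]] ->]]]].
by rewrite q_form; apply: (le_trans (form_le _ a0)); rewrite a1 expr1n mulr1.
Qed.

Lemma Q_ge0 : (forall c, 2 <= k c)%N -> 0 <= Q R k.
Proof.
move=> k2; pose p (i j : 'I_1) : {set 'I_s} := set0.
have pp : pairing p by [].
have vp : valid k p.
  apply/validP => c g; exists (Ordinal (ltnW (k2 c))), (Ordinal (k2 c)).
  by rewrite inE.
have [x|||r [e [phi [be [_ _ _ fe qe]]]]] := @support_pattern 2 'I_1 p (fun=> 1) pp vp.
- exact: ler01.
- by rewrite sumr_const card_ord.
- by move=> x y; rewrite !ord1.
by apply: (le_trans _ (feas_le_Q fe)); rewrite qe; apply: form_ge0 => x; exact: ler01.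
Qed.

(** Symmetrisation reduces to a support all of whose pairs have at least two colours, so the optimum
    over $\Phi_2$ also bounds patterns with empty or single-colour pairs. Scaling gives the
    homogeneous version for arbitrary total weight. *)
Lemma form_le_Q (J : finType) (p : J -> J -> {set 'I_s}) (al : J -> R) : pairing p -> valid k p ->
  (forall x, 0 <= al x) -> form p al <= Q R k * (\sum_x al x) ^+ 2.
Proof.
move=> pp vp al0; have [be [be0 <- _ albe be2]] := zykov pp al0.
apply: (le_trans albe) => {al al0 albe}.
have [b0|b0] := eqVneq (\sum_x be x) 0.
  by apply: (le_trans (form_le _ be0)); rewrite b0 expr0n !mulr0.
have bpos : 0 < \sum_x be x by rewrite lt_def b0 sumr_ge0.
set S := \sum_x be x in b0 bpos *.
have [x|||r [e [phi [ga [_ _ _ /feas_le_Q fe qe]]]]] :=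
  @support_pattern 2 J p (fun x => S^-1 * be x) pp vp.
- by rewrite mulr_ge0 // invr_ge0 ltW.
- by rewrite -big_distrr /= mulVf.
- by move=> x y xy; rewrite !mulf_eq0 invr_eq0 (negPf b0) /=; exact: be2.
rewrite qe form_scale exprVn mulrC ler_pdivrMr ?exprn_gt0 // in fe.
Qed.

End Zykov.

Section FiniteUniform.
Variable (R : realType).


Lemma finite_uniform (F : finType) (P : F -> R -> Prop) :
  (forall f (x y : R), 0 < y -> y <= x -> P f x -> P f y) ->
  (forall f, exists2 x : R, 0 < x & P f x) -> exists2 x : R, 0 < x & forall f, P f x.
Proof.
move=> Pmono Pex.
suff [x x0 Px] : exists2 x : R, 0 < x & forall f, f \in enum F -> P f x.
  by exists x => // f; apply: Px; rewrite mem_enum.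
elim: (enum F) => [|f l [x x0 IHx]]; first by exists 1; rewrite ?ltr01.
have [y y0 Py] := Pex f; exists (Num.min x y); first by rewrite lt_min x0.
have m0 : 0 < Num.min x y by rewrite lt_min x0.
move=> g; rewrite inE => /orP[/eqP ->|/IHx Pg].
  by apply: (Pmono f y) => //; rewrite ge_min lexx orbT.
by apply: (Pmono g x) => //; rewrite ge_min lexx.
Qed.

End FiniteUniform.

(** The multicolour Ramsey theorem, by induction on the sum of the clique sizes. A pair may carry
    several colours, so the neighbourhoods [Nb c] of a vertex cover the others but need not be
    disjoint. *)
Lemma ramsey (s : nat) (c0 : 'I_s) (N : nat) : forall kk : 'I_s -> nat, (\sum_c kk c <= N)%N ->
  exists n0 : nat, forall (J : finType) (p : J -> J -> {set 'I_s}) (A : {set J}),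
    pairing p -> (n0 <= #|A|)%N ->
    (forall x y, x \in A -> y \in A -> x != y -> p x y != set0) ->
  exists c (B : {set J}), [/\ B \subset A, #|B| = kk c &
    forall x y, x \in B -> y \in B -> x != y -> c \in p x y].
Proof.
elim: N => [|N IHN] kk kkN.
  exists 0%N => J p A pp _ _; exists c0, set0; rewrite sub0set cards0; split=> //.
    by move: kkN; rewrite leqn0 sum_nat_eq0 => /forallP/(_ c0)/eqP.
  by move=> x y; rewrite inE.
have [[c kc0]|kk0] := pselect (exists c, kk c = 0%N).
  exists 0%N => J p A pp _ _; exists c, set0; rewrite sub0set cards0; split=> //.
  by move=> x y; rewrite inE.
have kkpos c : (0 < kk c)%N by rewrite lt0n; apply: contra_notN kk0 => /eqP; exists c.
pose kk' c d := if d == c then (kk c).-1 else kk d.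
have /choice[n0 n0P] : forall c, exists n0 : nat,
    forall (J : finType) (p : J -> J -> {set 'I_s}) (A : {set J}),
    pairing p -> (n0 <= #|A|)%N ->
    (forall x y, x \in A -> y \in A -> x != y -> p x y != set0) ->
  exists d (B : {set J}), [/\ B \subset A, #|B| = kk' c d &
    forall x y, x \in B -> y \in B -> x != y -> d \in p x y].
  move=> c; apply: IHN; move: kkN; rewrite (bigD1 c) //= [X in _ -> (X <= _)%N](bigD1 c) //=.
  rewrite {1}/kk' eqxx [X in _ -> (_ + X <= _)%N](eq_bigr kk) => [|d /negPf]; last first.
    by rewrite /kk' => ->.
  by have := kkpos c; lia.
exists (\sum_c n0 c).+2 => J p A pp An pA.
have /card_gt0P[v vA] : (0 < #|A|)%N by apply: leq_trans An.
pose Nb c := [set x in A | (x != v) && (c \in p v x)].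
have [c Nbc] : exists c, (n0 c <= #|Nb c|)%N.
  apply: contrapT => H.
  have Nbc c : (#|Nb c| <= n0 c)%N.
    by rewrite leqNgt; apply: contra_notN H => /ltnW; exists c.
  have AN : A :\ v \subset \bigcup_c Nb c.
    apply/fintype.subsetP => x; rewrite !inE => /andP[xv xA].
    have /set0Pn[c cp] := pA _ _ vA xA (contra_neq esym xv).
    by apply/finset.bigcupP; exists c => //; rewrite !inE xA xv.
  have : (#|A :\ v| <= \sum_c n0 c)%N.
    apply: leq_trans (subset_leq_card AN) _.
    elim/big_ind2: _ => [|B1 n1 B2 n2 le1 le2|c _]; rewrite ?cards0 ?Nbc //.
    by apply: leq_trans (leq_card_setU _ _) _; rewrite leq_add.
  by rewrite -ltnS; move: An; rewrite (cardsD1 v) vA; lia.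
have NbA : Nb c \subset A by apply/fintype.subsetP => x; rewrite inE => /andP[].
have [|d [B [BN Bk Bp]]] := n0P c J p (Nb c) pp Nbc.
  by move=> x y /(fintype.subsetP NbA) xA /(fintype.subsetP NbA) yA; exact: pA.
move: Bk Bp; rewrite /kk'; case: eqVneq => [-> |_] Bk Bp; last first.
  by exists d, B; split=> //; apply: fintype.subset_trans NbA.
have vB : v \notin B.
  by apply: contraT => /negPn /(fintype.subsetP BN); rewrite !inE eqxx andbF.
exists c, (v |: B); split.
- rewrite subUset sub1set vA /=; exact: fintype.subset_trans NbA.
- by rewrite cardsU1 vB Bk add1n prednK.
have vp x : x \in B -> c \in p v x.
  by move=> /(fintype.subsetP BN); rewrite inE => /and3P[].
move=> x y; rewrite !inE => /orP[/eqP ->|xB] /orP[/eqP ->|yB]; rewrite ?eqxx // => xy.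
- exact: vp.
- by rewrite pp.1; exact: vp.
- exact: Bp.
Qed.

(** * Maximisation over the simplex *)

Section Compactness.
Import numFieldNormedType.Exports.
Local Open Scope classical_set_scope.
Variables (R : realType) (r : nat).

Lemma continuous_sum (T : topologicalType) (I : finType) (f : I -> T -> R) :
  (forall i, continuous (f i)) -> continuous (fun x => \sum_i f i x).
Proof.
move=> cf; have -> : (fun x => \sum_i f i x) = \sum_i f i.
  by apply/funext => x; rewrite fct_sumE.
elim/big_ind: _ => [x|f1 f2 c1 c2 x|i _]; last exact: cf.
- exact: cst_continuous.
- by apply: continuousD; [exact: c1 | exact: c2].
Qed.

Lemma quadratic_continuous (w : 'I_r -> 'I_r -> R) :
  continuous (fun v : 'rV[R]_r => \sum_i \sum_j v 0 i * v 0 j * w i j).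
Proof.
apply: continuous_sum => i; apply: continuous_sum => j.
have c1 : continuous (fun v : 'rV[R]_r => v 0 i * v 0 j).
  move=> v; apply: (@continuousM _ _ (fun v : 'rV[R]_r => v 0 i) (fun v => v 0 j)).
    exact: coord_continuous.
  exact: coord_continuous.
move=> v; apply: (@continuousM _ _ (fun v : 'rV[R]_r => v 0 i * v 0 j) (fun=> w i j)).
  exact: c1.
exact: cst_continuous.
Qed.

Lemma closed_coord_le (f : 'rV[R]_r -> R) (c : R) :
  continuous f -> closed [set v | c <= f v].
Proof.
move=> cf; apply: (@preimage_closed _ _ f [set y | c <= y]); last exact: closed_ge.
by move=> v _; exact: cf.
Qed.

Lemma closed_coord_far i (a eps : R) : closed [set v : 'rV[R]_r | eps <= `|v 0 i - a|].
Proof.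
apply: closed_coord_le => v.
apply: (@continuous_comp _ _ _ (fun v : 'rV[R]_r => v 0 i) (fun y => `|y - a|)).
  exact: coord_continuous.
by apply: cvg_norm; apply: cvgB; [exact: cvg_id | exact: cvg_cst].
Qed.

Lemma simplex_max (f : 'rV[R]_r -> R) (B : set 'rV[R]_r) :
  continuous f -> closed B -> (exists2 v, simplex v & B v) ->
  exists v, [/\ simplex v, B v & forall u, simplex u -> B u -> f u <= f v].
Proof.
move=> cf cB [v0 sv0 Bv0]; pose A := [set v : 'rV[R]_r | simplex v] `&` B.
have cA : compact A.
  apply: (@subclosed_compact _ _ [set v : 'rV[R]_r | forall i, `[0, 1]%classic (v ord0 i)]).
  - apply: closedI => //.
    have -> : [set v : 'rV[R]_r | simplex v] =
        (\bigcap_(i in [set: 'I_r]%classic) [set v : 'rV[R]_r | 0 <= v 0 i]) `&`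
        [set v : 'rV[R]_r | \sum_i v 0 i = 1].
      by apply/seteqP; split=> v [h1 h2]; split=> // i; [move=> _|]; apply: h1.
    apply: closedI.
      by apply: closed_bigI => i _; apply: closed_coord_le; exact: coord_continuous.
    apply: (@preimage_closed _ _ (fun v : 'rV[R]_r => \sum_i v 0 i) [set y | y = 1]); last exact: closed_eq.
    by move=> v _; apply: continuous_sum => i; exact: coord_continuous.
  - exact: (rV_compact (fun=> @segment_compact R 0 1)).
  move=> v [[v0' v1] _] i /=; rewrite in_itv /= v0' /= -v1 (bigD1 i) //= lerDl.
  by apply: sumr_ge0 => j _.
have [||v /set_mem[sv Bv] vmax] := @EVT_max_rV R r f A _ cA.
- by exists v0.
- exact: continuous_subspaceT.
by exists v; split=> // u su Bu; apply: vmax; apply/mem_set.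
Qed.

End Compactness.

(** * Optimal patterns *)

Section Optima.
Import numFieldNormedType.Exports.
Variables (R : realType) (s : nat) (k : 'I_s -> nat).
Hypothesis (k2 : forall c, (2 <= k c)%N).
Variable (c0 : 'I_s).
Local Notation weight := (@weight R s).
Local Notation Q := (Q R k).

Lemma rank_bound : exists r0 : nat, forall (J : finType) (p : J -> J -> {set 'I_s}),
  pairing p -> valid k p -> (forall x y, x != y -> p x y != set0) -> (#|J| <= r0)%N.
Proof.
have [n0 n0P] := ramsey c0 (leqnn (\sum_c k c)).
exists n0 => J p pp /validP vp p0; rewrite leqNgt; apply/negP => /ltnW Jn.
have [|x y _ _|c [B [_ Bk Bp]]] := n0P J p setT pp; rewrite ?cardsT //; first exact: p0.
have := enum_val_inj (A := mem B).
move: (@enum_val _ (mem B)) (@enum_valP _ (mem B)); rewrite Bk => f fB f_inj.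
have [a [b [ab /negP]]] := vp c f; apply; apply: Bp => //.
by apply: contraTneq ab => /f_inj ->; rewrite ltnn.
Qed.

(** By Ramsey's theorem there are finitely many feasible patterns, so a constant that exists for
    each of them and may be decreased can be chosen uniformly. *)
Lemma pattern_uniform (P : forall r, pattern r s -> R -> Prop) :
  (forall r (phi : pattern r s) x y, 0 < y -> y <= x -> P r phi x -> P r phi y) ->
  (forall r (phi : pattern r s), exists2 x : R, 0 < x & P r phi x) ->
  exists2 x : R, 0 < x & forall r (phi : pattern r s), Phi 2 k phi -> P r phi x.
Proof.
move=> Pmono Pex; have [r0 r0P] := rank_bound.
(* All patterns on at most [r0] vertices, as one finite type. *)
pose F : finType := {i : 'I_r0.+1 & {ffun {set 'I_i} -> {set 'I_s}}}.
pose P' (f : F) x := P _ (tagged f : pattern (tag f) s) x.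
have [x x0 Px] : exists2 x : R, 0 < x & forall f, P' f x.
  by apply: finite_uniform => [f|f]; [exact: Pmono | exact: Pex].
exists x => // r phi /PhiP[vphi phi2].
have rr0 : (r < r0.+1)%N.
  rewrite ltnS -[r]card_ord; apply: r0P vphi _; first exact: pcol_pairing.
  by move=> i j ij; rewrite -card_gt0; apply: leq_trans (phi2 i j ij).
have := Px (Tagged _ (finfun phi : {ffun {set 'I_(Ordinal rr0)} -> {set 'I_s}})).
rewrite /P' /=; congr P; apply/funext => E; exact: ffunE.
Qed.

Lemma q_continuous r (phi : pattern r s) : continuous (@q R s r phi).
Proof.
have -> : @q R s r phi = fun v : 'rV[R]_r => \sum_i \sum_j v 0 i * v 0 j * weight (pcol phi i j).
  by apply/funext => v; rewrite q_form.
exact: quadratic_continuous.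
Qed.

(** A pattern whose maximum lies below [Q] stays below it by a positive amount, and there are
    finitely many patterns. *)
Lemma gap_max : exists2 x : R, 0 < x & forall r (phi : pattern r s) (al : 'rV[R]_r),
  feas 2 k phi al -> Q - x < q phi al -> exists2 be, simplex be & q phi be = Q.
Proof.
have [x|r phi|x x0 Px] := @pattern_uniform (fun r phi x => forall al : 'rV[R]_r,
  feas 2 k phi al -> Q - x < q phi al -> exists2 be, simplex be & q phi be = Q); last first.
- by exists x => // r phi al fal; apply: Px => //; case: fal.
- have [[al fal]|nf] := pselect (exists al : 'rV[R]_r, feas 2 k phi al); last first.
    by exists 1 => // al fal; case: nf; exists al.
  have [|v [sv _ vmax]] := @simplex_max R r _ [set: 'rV[R]_r]%classic (@q_continuous r phi) closedT.
    by exists al => //; case: fal.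
  have [vQ|vQ] := eqVneq (q phi v) Q; first by exists 1 => // al' _ _; exists v.
  have ltvQ : q phi v < Q by rewrite lt_neqAle vQ feas_le_Q //; case: fal.
  exists (Q - q phi v); rewrite ?subr_gt0 // => al' [_ sal'].
  by rewrite subKr ltNge vmax.
- move=> phi y z z0 zy H al fal lt; apply: (H al fal); apply: le_lt_trans lt.
  by rewrite lerD2l lerN2.
Qed.

(** Symmetrise, replace the weights by a maximiser for the resulting pattern, which attains [Q] by
    the gap, and pass to its support. The weights [be] need not be close to [al]; only the vertices
    are taken from the support of [al]. *)
Lemma near_opt : exists2 x : R, 0 < x & forall (J : finType) (p : J -> J -> {set 'I_s}) (al : J -> R),
  pairing p -> valid k p -> (forall x, 0 <= al x) -> \sum_x al x = 1 -> Q - x < form p al ->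
  exists r (e : 'I_r -> J) (phi : pattern r s) (be : 'rV[R]_r),
  [/\ injective e, opt_star k phi be, forall i, al (e i) != 0 &
      forall i j, pcol phi i j = p (e i) (e j)].
Proof.
have [x x0 Px] := gap_max; exists x => // J p al pp vp al0 al1 alQ.
have [ga [ga0 ga1 gaal gaQ ga2]] := zykov pp al0; rewrite al1 in ga1.
have [r [e [phi [be [[e_inj _] bee phip fe qe]]]]] := support_pattern pp vp ga0 ga1 ga2.
have [|v [v0 v1] vQ] := Px _ _ _ fe; first by rewrite qe (lt_le_trans alQ).
have [/PhiP[vphi phi2] _] := fe.
have [r' [e' [phi' [be' [[e'_inj _] be'e phi'p fe' qe']]]]] :=
  support_pattern (pcol_pairing phi) vphi v0 v1 (fun i j ij _ _ => phi2 i j ij).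
exists r', (e \o e'), phi', be'; split.
- exact: inj_comp.
- by split=> // [|i]; [rewrite qe' -vQ q_form | case: (be'e i)].
- move=> i; apply/eqP => /gaal H; have := (bee (e' i)).2.
  by rewrite (bee (e' i)).1 H ltxx.
- by move=> i j; rewrite phi'p phip.
Qed.

(* [None] is the new vertex, and [p] gives the colours of its pairs. *)
Definition extp r (phi : pattern r s) (p : 'I_r -> {set 'I_s}) (a b : option 'I_r) : {set 'I_s} :=
  match a, b with
  | Some i, Some j => pcol phi i j
  | Some i, None | None, Some i => p i
  | None, None => set0
  end.

Lemma extp_pairing r (phi : pattern r s) p : pairing (extp phi p).
Proof.
have [h1 h2] := pcol_pairing phi.
by split=> [[i|] [j|]|[i|]] /=.
Qed.

Lemma sum_option (T : finType) (F : option T -> R) :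
  \sum_x F x = F None + \sum_x F (Some x).
Proof.
rewrite (bigD1 None) //=; congr (_ + _).
by rewrite (reindex_omap Some id) //= => [|[]//]; apply: eq_bigl => i; rewrite eqxx.
Qed.

(** Give the new vertex a small weight $t$: with $e$ the value of the extension, [form_le_Q] becomes
    $2te+Q\le Q(1+t)^2$, and comparing linear terms yields $e\le Q$. *)
Lemma ext_le_Q r (phi : pattern r s) (al : 'rV[R]_r) p : simplex al -> q phi al = Q ->
  valid k (extp phi p) -> \sum_i al 0 i * weight (p i) <= Q.
Proof.
move=> [al0 al1] qal ve; set e := \sum_i _.
apply/ler_addgt0Pr => eps eps0.
have Q0 : 0 <= Q by exact: Q_ge0.
(* With this choice $tQ\le2\varepsilon$, which absorbs the quadratic term. *)
pose t := 2 * eps / (Q + 1).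
have Q1 : 0 < Q + 1 by rewrite ltr_wpDl.
have t0 : 0 < t by rewrite divr_gt0 // mulr_gt0.
pose al' x := if x is Some i then al 0 i else t.
have al'0 x : 0 <= al' x by case: x => [i|] /=; rewrite ?al0 // ltW.
have := form_le_Q (extp_pairing phi p) ve al'0.
rewrite form_deg !sum_option /= al1 /deg.
rewrite sum_option /= weight_small ?cards0 // mulr0 add0r -/e.
have -> : \sum_x al 0 x * \sum_y al' y * weight (extp phi p (Some x) y) = t * e + Q.
  rewrite -qal q_form form_deg /e big_distrr -big_split; apply: eq_bigr => i _ /=.
  by rewrite sum_option /= mulrDr; congr (_ + _); ring.
move=> H; have : 2 * t * e <= 2 * t * (Q + eps).
  apply: (@le_trans _ _ (Q * (t + 1) ^+ 2 - Q)); first by lra.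
  have -> : Q * (t + 1) ^+ 2 - Q = 2 * t * Q + t * (t * Q) by ring.
  have : t * (t * Q) <= t * (2 * eps).
    rewrite ler_pM2l // /t mulrAC ler_pdivrMr // ler_pM2l ?mulr_gt0 //; lra.
  lra.
by rewrite ler_pM2l // mulr_gt0.
Qed.

(** The degree of [j] is the value of the extension by a twin of [j] that has no colour to [j]. *)
Lemma deg_opt_le r (phi : pattern r s) (al : 'rV[R]_r) j : feas 2 k phi al ->
  q phi al = Q -> deg (pcol phi) (al 0) j <= Q.
Proof.
move=> [/PhiP[vphi _] sal] qal; apply: (ext_le_Q sal qal).
rewrite (@valid_eq _ _ _ _ (fun a b => pcol phi (odflt j a) (odflt j b))).
  exact: (@valid_comp _ _ _ _ _ (odflt j)).
have [h1 h2] := pcol_pairing phi.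
by move=> [a|] [b|] //=; rewrite ?h2.
Qed.

Lemma weighted_sum_eq (I : finType) (al F : I -> R) (m : R) : (forall i, 0 < al i) ->
  (forall i, F i <= m) -> \sum_i al i = 1 -> \sum_i al i * F i = m -> forall i, F i = m.
Proof.
move=> al0 Fm al1 alF i; apply/eqP; rewrite eq_sym -subr_eq0.
have : \sum_i al i * (m - F i) == 0.
  under eq_bigr do rewrite mulrBr; rewrite sumrB alF -big_distrl /= al1 mul1r subrr //.
rewrite psumr_eq0 => [/allP/(_ i (mem_index_enum _))|j _].
  by rewrite /= mulf_eq0 gt_eqF ?al0.
by rewrite mulr_ge0 ?subr_ge0 // ltW.
Qed.

(** All degrees are at most [Q], and their mean with positive weights equals [Q]. *)
Lemma lagrange r (phi : pattern r s) (al : 'rV[R]_r) : opt_star k phi al ->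
  forall j, deg (pcol phi) (al 0) j = Q.
Proof.
move=> [fe qQ al0]; apply: (weighted_sum_eq al0).
- by move=> j; exact: deg_opt_le.
- by case: fe => _ [].
- by rewrite -form_deg -q_form.
Qed.

(** Translation between the new vertex [None] and the vertex [ord_max] of the extension property. *)
Lemma ext_pattern r (phi : pattern r s) (al : 'rV[R]_r) p : valid k (extp phi p) ->
  exists phi' : pattern r.+1 s, [/\ Phi 0 k phi', extends phi' phi,
    ext phi' al = \sum_i al 0 i * weight (p i) &
    forall j, phi' [set ord_max; old_vertex j] = p j /\
      (clone phi' ord_max (old_vertex j) ->
       (forall i, i != j -> p i = pcol phi j i) /\ (#|p j| <= 1)%N)].
Proof.
move=> ve; pose o : 'I_r.+1 -> option 'I_r := unlift ord_max.
have oold i : o (old_vertex i) = Some i.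
  have -> : old_vertex i = lift ord_max i by apply/val_inj; rewrite /= /bump leqNgt ltn_ord.
  by rewrite /o liftK.
have omax : o ord_max = None by rewrite /o unlift_none.
have oldmax (i : 'I_r) : old_vertex i == ord_max = false.
  by apply/eqP => e; have := oold i; rewrite e omax.
have old_inj : injective (@old_vertex r).
  by move=> i j ij; have := oold i; rewrite ij oold => -[].
have pe : pairing (fun a b => extp phi p (o a) (o b)).
  have [h1 h2] := extp_pairing phi p.
  by split=> [a b|a]; [exact: h1 | exact: h2].
pose phi' := pattern_of (fun a b => extp phi p (o a) (o b)).
have phi'E a b : a != b -> phi' [set a; b] = extp phi p (o a) (o b).
  by move=> ab; rewrite -(pcol_pattern_of pe) /pcol (negPf ab).
have phi'max j : phi' [set ord_max; old_vertex j] = p j.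
  by rewrite phi'E ?oold ?omax // eq_sym oldmax.
exists phi'; split.
- apply/PhiP; split=> //; rewrite (valid_eq _ (pcol_pattern_of pe)).
  exact: (valid_comp o).
- move=> i j ij; rewrite phi'E ?(inj_eq old_inj) // !oold /= /pcol (negPf ij) //.
- rewrite /ext [RHS](bigID (fun i => p i != set0)) /= [X in _ = _ + X]big1 ?addr0.
    by apply: eq_big => [i|i _]; rewrite setUC phi'max.
  by move=> i /negPn/eqP ->; rewrite weight_small ?cards0 ?mulr0.
move=> j; split=> // -[_ cl1 cl2]; split; last by rewrite phi'max in cl2.
move=> i ij; have := cl1 (old_vertex i) (negbT (oldmax i)).
rewrite (inj_eq old_inj) => /(_ ij).
by rewrite phi'max phi'E ?(inj_eq old_inj) 1?eq_sym // !oold.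
Qed.

Hypothesis hext : extension_property R k.

Lemma ext_clone r (phi : pattern r s) (al : 'rV[R]_r) p : opt_star k phi al ->
  valid k (extp phi p) -> \sum_i al 0 i * weight (p i) = Q ->
  exists j, (forall i, i != j -> p i = pcol phi j i) /\ (#|p j| <= 1)%N.
Proof.
move=> oal ve eQ; have [phi' [P0 ex eE cl]] := ext_pattern al ve.
by have := hext oal P0 ex; rewrite eE => /(_ eQ)[j /(proj2 (cl j))]; exists j.
Qed.

(** If [be] vanished at [i], then [i] would extend the optimal triple on the support of [be] with
    value [Q], hence be a clone of one of its vertices; but the pairs of [phi] have at least two
    colours. *)
Lemma max_full_support r (phi : pattern r s) (al be : 'rV[R]_r) : opt_star k phi al ->
  simplex be -> q phi be = Q -> forall i, 0 < be 0 i.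
Proof.
move=> oal sbe qbe i; have [fe qQ al0] := oal; have [Ph [_ al1]] := fe.
have [be0 be1] := sbe; have /PhiP[vphi phi2] := Ph.
have pp := pcol_pairing phi.
rewrite lt_def be0 andbT; apply/eqP => bei.
(* The mean with weights [al] of the degrees under [be] is [Q], by symmetry and [lagrange]; as none
   exceeds [Q], all are equal to it, also the one at [i]. *)
have degbe : deg (pcol phi) (be 0) i = Q.
  apply: (weighted_sum_eq al0) => //; first by move=> j; apply: deg_opt_le.
  rewrite deg_sym //; under eq_bigr do rewrite (lagrange oal).
  by rewrite -big_distrl /= be1 mul1r.
have [|r' [e [phi' [be' [[e_inj eal] be'e phi'p fe' qe']]]]] :=
  @support_pattern R s k 2 _ (pcol phi) (be 0) pp vphi be0 be1.
  by move=> x y xy _ _; exact: phi2.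
have obe' : opt_star k phi' be'.
  by split=> //; [rewrite qe' -q_form | move=> j; case: (be'e j)].
have [||j [_]] := @ext_clone _ phi' be' (fun j => pcol phi i (e j)) obe'.
- rewrite (@valid_eq _ _ _ _ (fun a b => pcol phi (oapp e i a) (oapp e i b))).
    exact: (@valid_comp _ _ _ _ _ (oapp e i)).
  by move=> [a|] [b|] //=; rewrite ?phi'p ?pp.2 // pp.1.
- rewrite -degbe /deg (sum_inj e_inj); last first.
    by move=> x; rewrite mulf_eq0 negb_or => /andP[/eal].
  by apply: eq_bigr => j _; case: (be'e j) => ->.
apply/negP; rewrite -ltnNge; apply: phi2.
by apply/eqP => ij; have := (be'e j).2; rewrite (be'e j).1 -ij bei ltxx.
Qed.

(** By [lagrange] the linear term vanishes, so [q] is constant on the line through two maximisers.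
    Following it from [al] until a coordinate reaches 0 yields a maximiser without full support. *)
Lemma opt_unique r (phi : pattern r s) (al be : 'rV[R]_r) : opt_star k phi al ->
  simplex be -> q phi be = Q -> forall i, be 0 i = al 0 i.
Proof.
move=> oal sbe qbe; apply: contrapT => /existsNP[i0 /eqP bai].
have [fe qQ al0] := oal; have [Ph [al0' al1]] := fe.
have [be0 be1] := sbe; have pp := pcol_pairing phi.
have [i1 lt1] : exists i, be 0 i < al 0 i.
  apply: contrapT => /forallNP H.
  have : \sum_i (be 0 i - al 0 i) == 0 by rewrite sumrB be1 al1 subrr.
  rewrite psumr_eq0 => [/allP/(_ i0 (mem_index_enum _))|i _]; first by rewrite /= subr_eq0 (negPf bai).
  by rewrite subr_ge0 leNgt; apply/negP; exact: H.
(* The time at which coordinate [i] vanishes; its minimum over the decreasing coordinates is the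
   time [t] at which the line leaves the simplex. *)
pose F i := al 0 i / (al 0 i - be 0 i).
have [i lti Fmin] := @arg_minP _ _ _ i1 (fun i => be 0 i < al 0 i) F lt1.
pose t := F i; pose ga : 'rV[R]_r := \row_j (al 0 j + t * (be 0 j - al 0 j)).
have t0 : 0 <= t by rewrite divr_ge0 // subr_ge0 ltW.
have sga : simplex ga.
  split=> [j|].
    rewrite mxE; have [ltj|gej] := ltP (be 0 j) (al 0 j).
      have := Fmin j ltj; rewrite -/t /F ler_pdivlMr ?subr_gt0 // => H; lra.
    by rewrite addr_ge0 // mulr_ge0 // subr_ge0.
  under eq_bigr do rewrite mxE.
  by rewrite big_split -big_distrr /= sumrB al1 be1 subrr mulr0 addr0.
have zero_deg c : \sum_j c * (be 0 j - al 0 j) * deg (pcol phi) (al 0) j = 0.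
  under eq_bigr do rewrite (lagrange oal).
  by rewrite -big_distrl -big_distrr /= sumrB al1 be1 subrr mulr0 mul0r.
have qga : q phi ga = Q.
  rewrite q_form (@eq_form _ _ _ _ (pcol phi) _ (fun j => al 0 j + t * (be 0 j - al 0 j))) //;
    last by move=> j; rewrite mxE.
  rewrite formD // zero_deg form_scale -q_form qQ.
  have := formD (al 0) (fun j => 1 * (be 0 j - al 0 j)) pp.
  rewrite zero_deg form_scale -q_form qQ.
  rewrite (@eq_form _ _ _ _ (pcol phi) _ (be 0)) => [|//|j]; last by rewrite mul1r addrC subrK.
  rewrite -q_form qbe => H; have -> : form (pcol phi) (fun x => be 0 x - al 0 x) = 0 by lra.
  by ring.
have := max_full_support oal sga qga i; rewrite mxE /t /F.
suff -> : al 0 i + al 0 i / (al 0 i - be 0 i) * (be 0 i - al 0 i) = 0 by rewrite ltxx.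
have : al 0 i - be 0 i != 0 by rewrite subr_eq0 gt_eqF.
by move=> nz; field.
Qed.

(** By [opt_unique] each pattern has one optimal weight vector, so the constants depend on the
    pattern only: the first is a minimum of positive weights, the second a gap between finitely many
    values, and the third comes from compactness. *)
Lemma opt_constants (eps : R) : 0 < eps -> exists2 x : R, 0 < x &
  forall r (phi : pattern r s) (al : 'rV[R]_r), opt_star k phi al ->
  [/\ forall i, x <= al 0 i,
      forall p, valid k (extp phi p) -> Q - x < \sum_i al 0 i * weight (p i) ->
        \sum_i al 0 i * weight (p i) = Q &
      forall be, simplex be -> Q - x < q phi be -> forall i, `|be 0 i - al 0 i| < eps].
Proof.
move=> eps0.
pose P r (phi : pattern r s) x := forall al : 'rV[R]_r, opt_star k phi al ->
  [/\ forall i, x <= al 0 i,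
      forall p, valid k (extp phi p) -> Q - x < \sum_i al 0 i * weight (p i) ->
        \sum_i al 0 i * weight (p i) = Q &
      forall be, simplex be -> Q - x < q phi be -> forall i, `|be 0 i - al 0 i| < eps].
have [r phi x y y0 yx H al oal|r phi|x x0 Px] := @pattern_uniform P; last first.
- by exists x => // r phi al oal; apply: Px => //; case: oal => -[].
- have [[al oal]|nal] := pselect (exists al : 'rV[R]_r, opt_star k phi al); last first.
    by exists 1 => // al oal; case: nal; exists al.
  have [fe qQ al0] := oal; have [Ph sal] := fe.
  have [x1 x10 H1] : exists2 x : R, 0 < x & forall i, x <= al 0 i.
    apply: finite_uniform => [i x y _ yx|i]; first exact: le_trans.
    by exists (al 0 i).
  have [x2 x20 H2] : exists2 x : R, 0 < x & forall p : {ffun 'I_r -> {set 'I_s}},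
      valid k (extp phi p) -> Q - x < \sum_i al 0 i * weight (p i) ->
      \sum_i al 0 i * weight (p i) = Q.
    apply: finite_uniform => [p x y _ yx H vp lt|p].
      by apply: H => //; apply: le_lt_trans lt; rewrite lerD2l lerN2.
    have [vp|nvp] := pselect (valid k (extp phi p)); last by exists 1.
    have [eQ|neQ] := eqVneq (\sum_i al 0 i * weight (p i)) Q; first by exists 1.
    exists (Q - \sum_i al 0 i * weight (p i)); last by rewrite subKr ltxx.
    by rewrite subr_gt0 lt_neqAle neQ (ext_le_Q sal qQ vp).
  have [x3 x30 H3] : exists2 x : R, 0 < x & forall i be, simplex be -> Q - x < q phi be ->
      `|be 0 i - al 0 i| < eps.
    apply: finite_uniform => [i x y _ yx H be sbe lt|i].
      by apply: H => //; apply: le_lt_trans lt; rewrite lerD2l lerN2.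
    have [[u su uB]|nB] := pselect (exists2 u, simplex u & eps <= `|u 0 i - al 0 i|); last first.
      exists 1 => // be sbe _; rewrite ltNge; apply/negP => H; apply: nB.
      by exists be.
    have cB : closed [set v : 'rV[R]_r | eps <= `|v 0 i - al 0 i|]%classic.
      exact: closed_coord_far.
    have [|v [sv vB vmax]] := simplex_max (@q_continuous r phi) cB; first by exists u.
    have vQ : q phi v < Q.
      rewrite lt_neqAle feas_le_Q // andbT; apply/eqP => vQ.
      by move: vB => /=; rewrite (opt_unique oal sv vQ) subrr normr0 leNgt eps0.
    exists (Q - q phi v); first by rewrite subr_gt0.
    by move=> be sbe; rewrite subKr => lt; rewrite ltNge; apply/negP => /vmax; rewrite leNgt lt => /(_ sbe).
  exists (Num.min x1 (Num.min x2 x3)); first by rewrite !lt_min x10 x20.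
  move=> al' oal'; have E i : al' 0 i = al 0 i.
    by apply: (opt_unique oal); case: oal' => -[].
  split=> [i|p vp|be sbe lt i].
  - by rewrite E; apply: le_trans (H1 i); rewrite ge_min lexx.
  - under eq_bigr do rewrite E; move=> lt.
    have := H2 (finfun p); rewrite (_ : fun_of_fin _ = p); last by apply/funext => i; rewrite ffunE.
    apply=> //; apply: le_lt_trans lt; rewrite lerD2l lerN2.
    by rewrite !ge_min lexx orbT.
  - rewrite E; apply: H3 => //; apply: le_lt_trans lt; rewrite lerD2l lerN2.
    by rewrite !ge_min lexx !orbT.
have [H1 H2 H3] := H al oal; split=> [i|p vp lt|be sbe lt i].
- exact: le_trans (H1 i).
- by apply: H2 => //; apply: le_lt_trans lt; rewrite lerD2l lerN2.
- by apply: H3 => //; apply: le_lt_trans lt; rewrite lerD2l lerN2.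
Qed.

End Optima.

(** * Clones that are not strong *)

Section WeakClones.
Variables (R : realType) (s : nat) (k : 'I_s -> nat).
Hypothesis (k2 : forall c, (2 <= k c)%N).
Variable (c1 : 'I_s).
Hypothesis (kmax : forall c, (k c <= k c1)%N).
Local Notation weight := (@weight R s).
Local Notation Q := (Q R k).

Lemma validN (J : finType) (p : J -> J -> {set 'I_s}) : pairing p -> ~~ valid k p ->
  exists c (g : 'I_(k c) -> J), forall a b, a != b -> c \in p (g a) (g b).
Proof.
move=> pp /validP /existsNP[c /existsNP[g Hg]]; exists c, g => a b.
have H (x y : 'I_(k c)) : (x < y)%N -> c \in p (g x) (g y).
  by move=> xy; apply: contra_notT Hg => cp; exists x, y.
by rewrite neq_ltn => /orP[/H //|/H]; rewrite pp.1.
Qed.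

Lemma valid_not_mono (J : finType) (p : J -> J -> {set 'I_s}) c (g : 'I_(k c) -> J) :
  valid k p -> ~ forall a b, a != b -> c \in p (g a) (g b).
Proof.
move=> /validP /(_ c g)[a [b [ab cp]]] /(_ a b); rewrite (negPf cp) neq_ltn ab.
by move=> /(_ isT).
Qed.

Lemma sum_lt (I : finType) (F G : I -> R) i0 :
  (forall i, F i <= G i) -> F i0 < G i0 -> \sum_i F i < \sum_i G i.
Proof.
move=> FG lt0; rewrite (bigD1 i0) //= [X in _ < X](bigD1 i0) //=.
by apply: ltr_leD => //; apply: ler_sum.
Qed.

Lemma weight_setU1 c (A : {set 'I_s}) : (0 < #|A|)%N -> c \notin A ->
  weight A < weight (c |: A).
Proof. by move=> A0 cA; apply: weight_lt; rewrite cardsU1 cA. Qed.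

Variables (r : nat) (phi : pattern r s) (al : 'rV[R]_r) (j : 'I_r) (p : 'I_r -> {set 'I_s}).
Hypotheses (oal : opt_star k phi al) (vp : valid k (extp phi p)).
Hypotheses (pclone : forall i, i != j -> p i = pcol phi j i) (pj1 : (#|p j| <= 1)%N).

Lemma clone_sum : \sum_i al 0 i * weight (p i) = Q.
Proof.
rewrite -(lagrange k2 oal j); apply: eq_bigr => i _; congr (_ * _).
have [->|/pclone -> //] := eqVneq i j.
by rewrite (pcol_pairing phi).2 !weight_small ?cards0.
Qed.

Lemma opt_card i i' : i != i' -> (2 <= #|pcol phi i i'|)%N.
Proof. by case: oal => -[/PhiP[_ H] _] _ _; exact: H. Qed.

(** The value of [p] is already [Q], so a strict gain at one vertex would contradict [ext_le_Q]. *)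
Lemma sum_ext_contra (p' : 'I_r -> {set 'I_s}) h : (forall i, p i \subset p' i) ->
  weight (p h) < weight (p' h) -> valid k (extp phi p') -> False.
Proof.
move=> pp' lth vp'; have [[_ sal] qQ al0] := oal.
have := ext_le_Q k2 sal qQ vp'; rewrite leNgt -{1}clone_sum => /negP; apply.
apply: (@sum_lt _ _ _ h) => [i|]; last by rewrite ltr_pM2l.
by rewrite ler_pM2l // log2_nat_le // subset_leq_card.
Qed.

Variable c : 'I_s.
Hypothesis pjc : p j = [set c].

(* Otherwise [c] could be added to the colours between the new vertex and [h]:
   in a new clique, [h] may be replaced by [j]. *)
Lemma clone_colour_column h : c \in p h.
Proof.
have [->|hj] := eqVneq h j; first by rewrite pjc inE.
apply: contraT => cph; exfalso.
have cjh : c \notin pcol phi j h by rewrite -pclone.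
pose p' i := if i == h then c |: p h else p i.
have [psym p0] := pcol_pairing phi.
apply: (@sum_ext_contra p' h).
- by move=> i; rewrite /p'; case: eqVneq => [->|//]; exact: subsetUr.
- rewrite /p' eqxx weight_setU1 // pclone //.
  by apply: leq_trans (opt_card _); rewrite // eq_sym.
apply: contraT => /(validN (extp_pairing phi p'))[d [g Hg]].
have [dc|dc] := eqVneq d c; last first.
  exfalso; apply: (valid_not_mono (g := g) vp) => a b /Hg.
  case: (g a) (g b) => [i|] [i'|] //=; rewrite /p'; case: eqVneq => // ->.
    by rewrite !inE (negPf dc).
  by rewrite !inE (negPf dc).
subst d; have [[a0 ga0]|nN] := pselect (exists a, g a = None); last first.
  exfalso; apply: (@valid_not_mono _ _ _ g vp) => a b /Hg.
  case ga: (g a) => [i|]; last by case: nN; exists a.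
  by case gb: (g b) => [i'|] //; case: nN; exists b.
have Hp' a i : g a = Some i -> c \in p' i.
  by move=> ga; have := Hg a0 a; rewrite ga0 ga; apply; apply: contra_eq_neq ga0 => ->; rewrite ga.
pose si (x : option 'I_r) := if x == Some h then Some j else x.
exfalso; apply: (@valid_not_mono _ _ c (si \o g) vp) => a b /Hg /=.
have hi i : Some i == Some h = (i == h) by [].
case ga: (g a) => [i|]; case gb: (g b) => [i'|] //; rewrite /si ?hi /=.
- have ci := Hp' _ _ ga; have ci' := Hp' _ _ gb; move: ci ci'; rewrite /p'.
  case: (eqVneq i h) => [->|ih]; case: (eqVneq i' h) => [->|i'h] ci ci' //=.
  + by rewrite p0 inE.
  + have [->|i'j] := eqVneq i' j; first by rewrite psym (negPf cjh).
    by rewrite -pclone.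
  + have [->|ij] := eqVneq i j; first by rewrite (negPf cjh).
    by rewrite (psym i j) -pclone.
- by rewrite /p'; case: eqVneq => //= _ _; rewrite pjc inE.
- by rewrite /p'; case: eqVneq => //= _ _; rewrite pjc inE.
Qed.

(* The new vertex sees all of [phi] in colour [c], so it may replace [h] in any
   [c]-clique created by adding [c] between [g] and [h]. *)
Lemma clone_colour_complete g h : g != h -> c \in pcol phi g h.
Proof.
move=> gh; apply: contraT => cgh; exfalso.
have [psym p0] := pcol_pairing phi; have [[_ [al0' al1]] qQ al0] := oal.
pose p' x y := if (x == g) && (y == h) || (x == h) && (y == g) then c |: pcol phi x y else pcol phi x y.
have pp' : pairing p'.
  split=> [x y|x]; rewrite /p'; first by rewrite psym orbC andbC [X in _ || X]andbC.
  rewrite ifN ?p0 //; apply/negP => /orP[] /andP[/eqP -> /eqP e]; first by rewrite e eqxx in gh.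
  by rewrite e eqxx in gh.
have sub x y : pcol phi x y \subset p' x y by rewrite /p'; case: ifP => // _; exact: subsetUr.
have vp' : valid k p'.
  apply: contraT => /(validN pp')[d [f Hf]]; exfalso.
  have [dc|dc] := eqVneq d c; last first.
    apply: (@valid_not_mono _ _ _ (Some \o f) vp) => a b /Hf /=.
    by rewrite /p'; case: ifP => // _; rewrite !inE (negPf dc).
  subst d; pose si x := if x == h then None else Some x.
  apply: (@valid_not_mono _ _ c (si \o f) vp) => a b /Hf /=; rewrite /si.
  case: (eqVneq (f a) h) => [->|fah]; case: (eqVneq (f b) h) => [->|fbh] /=; rewrite ?clone_colour_column //.
    by rewrite pp'.2 inE.
  by rewrite /p' (negPf fah) (negPf fbh) andbF.
have := form_le_Q pp' vp' al0'; rewrite al1 expr1n mulr1 leNgt -[X in X < _]qQ q_form !form_deg => /negP; apply.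
have degle x : deg (pcol phi) (al 0) x <= deg p' (al 0) x.
  by apply: ler_sum => y _; rewrite ler_pM2l // log2_nat_le // subset_leq_card.
apply: (@sum_lt _ _ _ g) => [x|]; first by rewrite ler_pM2l.
rewrite ltr_pM2l //; apply: (@sum_lt _ _ _ h) => [y|].
  by rewrite ler_pM2l // log2_nat_le // subset_leq_card.
rewrite ltr_pM2l // /p' !eqxx /= weight_setU1 //.
by apply: leq_trans (opt_card gh).
Qed.

(** Otherwise colour 1 could be added between the new vertex and [j]. A clique of size [k c1]
    arising from this has at least [k c] vertices, and [c] already occurs on all pairs of distinct
    vertices, against the validity of [p]. *)
Lemma clone_colour_max : c = c1.
Proof.
apply/eqP/negPn/negP => cc1.
pose p' i := if i == j then [set c; c1] else p i.
apply: (@sum_ext_contra p' j).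
- move=> i; rewrite /p'; case: eqVneq => [->|//].
  by rewrite pjc sub1set !inE eqxx.
- by rewrite /p' eqxx pjc; apply: weight_lt; rewrite ?cards1 cards2 cc1.
apply: contraT => /(validN (extp_pairing phi p'))[d [g Hg]]; exfalso.
have [dc|dc] := eqVneq d c1; last first.
  apply: (@valid_not_mono _ _ _ g vp) => a b /Hg.
  case: (g a) (g b) => [i|] [i'|] //=; rewrite /p'; case: eqVneq => // ->;
    by rewrite pjc !inE (negPf dc) orbF.
subst d; apply: (@valid_not_mono _ _ c (g \o widen_ord (kmax c)) vp) => a b ab /=.
have : widen_ord (kmax c) a != widen_ord (kmax c) b by [].
move=> /Hg.
case: (g _) (g _) => [i|] [i'|] //=; rewrite ?clone_colour_column //; last by rewrite inE.
have [->|ii' _] := eqVneq i i'; first by rewrite (pcol_pairing phi).2 inE.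
by apply: clone_colour_complete; rewrite eq_sym.
Qed.

(** The new vertex has a colour to every old vertex: [c] to [j], and at least two colours to each of
    the others. *)
Lemma clone_not_strong : ~ strong_extension_property R k.
Proof.
move=> hstr; have [phi' [P0 ex eE cl]] := ext_pattern al vp.
have := hstr _ _ _ oal _ P0 ex; rewrite eE clone_sum => /(_ erefl)[j' [_]].
rewrite (cl j').1; apply/eqP; have [->|j'j] := eqVneq j' j.
  by rewrite pjc -card_gt0 cards1.
by rewrite pclone // -card_gt0; apply: ltnW; apply: opt_card; rewrite eq_sym.
Qed.

End WeakClones.

Lemma weak_clone (R : realType) (s : nat) (k : 'I_s -> nat) (k2 : forall c, (2 <= k c)%N)
    (c1 : 'I_s) (kmax : forall c, (k c <= k c1)%N) r (phi : pattern r s) (al : 'rV[R]_r)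
    (j : 'I_r) (p : 'I_r -> {set 'I_s}) :
  opt_star k phi al -> valid k (extp phi p) -> (forall i, i != j -> p i = pcol phi j i) ->
  (#|p j| <= 1)%N -> p j != set0 ->
  [/\ ~ strong_extension_property R k, p j = [set c1] & forall g h, g != h -> c1 \in pcol phi g h].
Proof.
move=> oal vp pc pj1 pj0.
have /cards1P[c pjc] : #|p j| == 1%N by rewrite eqn_leq pj1 card_gt0.
have cc1 := clone_colour_max k2 kmax oal vp pc pj1 pjc.
split; first exact: (clone_not_strong k2 oal vp pc pj1 pjc).
  by rewrite pjc cc1.
by move=> g h gh; rewrite -cc1; exact: (clone_colour_complete k2 oal vp pc pj1 pjc gh).
Qed.

(** * Containers *)

Section Greedy.
Variables (R : realType).

Definition rect (V : finType) (P : {set V} * {set V}) : {set V * V} :=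
  setX P.1 P.2 :|: setX P.2 P.1.

Definition uncovered (V : finType) (l : seq ({set V} * {set V})) : {set V * V} :=
  ~: \bigcup_(P <- l) rect P.

Lemma uncovered_cons (V : finType) P (l : seq ({set V} * {set V})) :
  uncovered (P :: l) = uncovered l :\: rect P.
Proof. by rewrite /uncovered big_cons setCU finset.setDE setIC. Qed.

Lemma in_uncovered (V : finType) (l : seq ({set V} * {set V})) x :
  (x \in uncovered l) = all (fun P => x \notin rect P) l.
Proof.
elim: l => [|P l IHl]; first by rewrite /uncovered big_nil !inE.
by rewrite uncovered_cons in_setD IHl.
Qed.

Lemma uncovered_sym (V : finType) (l : seq ({set V} * {set V})) x y :
  ((x, y) \in uncovered l) = ((y, x) \in uncovered l).
Proof.
elim: l => [|P l IHl]; first by rewrite /uncovered big_nil !inE.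
rewrite uncovered_cons !in_setD IHl; congr (~~ _ && _).
by rewrite !inE /= orbC; congr (_ || _); exact: andbC.
Qed.

Definition swap (V : Type) (p : V * V) : V * V := (p.2, p.1).

Lemma card_swap (V : finType) (W : {set V * V}) (A B : {set V}) :
  (forall x y, ((x, y) \in W) = ((y, x) \in W)) ->
  #|W :&: setX B A| = #|W :&: setX A B|.
Proof.
move=> Wsym; have swapK : involutive (@swap V) by case.
rewrite -(card_imset _ (inv_inj swapK)); apply: eq_card => -[x y].
rewrite -[(x, y)]swapK mem_imset; last exact: inv_inj.
by rewrite /swap !inE /= Wsym [X in _ && X]andbC.
Qed.

(* Rectangles violating the last inequality are removed as long as there are any:
   each contains at least [eps n^2] pairs of the current template, few of them in [W]. *)
Lemma greedy_container (gam eps : R) : 0 < gam -> gam <= 1 -> 0 < eps ->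
  exists K : nat, forall (V : finType) (W : {set V * V}),
  (0 < #|V|)%N -> (forall x y, ((x, y) \in W) = ((y, x) \in W)) ->
  exists f : {ffun 'I_K -> {set V} * {set V}},
    let T := uncovered (codom f) in
    #|W :\: T|%:R <= 2 * gam * #|V|%:R ^+ 2 /\
    forall A B : {set V}, gam * #|T :&: setX A B|%:R <= #|W :&: setX A B|%:R + eps * #|V|%:R ^+ 2.
Proof.
move=> gam0 gam1 eps0; exists (Num.truncn eps^-1).+1 => V W V0 Wsym.
set n2 := #|V|%:R ^+ 2; have n20 : 0 < n2 :> R by rewrite exprn_gt0 // ltr0n.
have cardn2 (D : {set V * V}) : #|D|%:R <= n2.
  by rewrite /n2 -natrX ler_nat -mulnn -card_prod max_card.
suff [l [l1 l2 l3]] : exists l,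
    [/\ #|W :\: uncovered l|%:R <= 2 * gam * #|~: uncovered l|%:R :> R,
        eps * n2 * (size l)%:R <= #|~: uncovered l|%:R :> R &
        forall A B, gam * #|uncovered l :&: setX A B|%:R <= #|W :&: setX A B|%:R + eps * n2].
  have sl : (size l <= (Num.truncn eps^-1).+1)%N.
    rewrite -(ler_nat R); apply: ltW; apply: le_lt_trans (truncnS_gt _).
    rewrite -[leRHS]mul1r ler_pdivlMr // mulrC -(ler_pM2r n20) mul1r mulrAC.
    exact: le_trans l2 (cardn2 _).
  (* The list is padded with empty rectangles to the fixed length [K]. *)
  exists [ffun i => nth (set0, set0) l (val i)]; rewrite (_ : uncovered (codom _) = uncovered l).
    split=> //; apply: (le_trans l1); rewrite ler_pM2l ?mulr_gt0 //; exact: cardn2.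
  apply/setP => x; rewrite !in_uncovered; apply/allP/allP => H P; last first.
    move=> /codomP[i ->]; rewrite ffunE; have [il|li] := ltnP i (size l).
      by apply: H; exact: mem_nth.
    by rewrite nth_default // !inE.
  move=> Pl; apply: H; apply/codomP.
  have Pi : (index P l < (Num.truncn eps^-1).+1)%N by apply: leq_trans sl; rewrite index_mem.
  by exists (Ordinal Pi); rewrite ffunE nth_index.
have [m] := ubnP #|uncovered ([::] : seq ({set V} * {set V}))|.
have : [/\ #|W :\: uncovered [::]|%:R <= 2 * gam * #|~: uncovered ([::] : seq ({set V} * {set V}))|%:R :> R &
        eps * n2 * (size ([::] : seq ({set V} * {set V})))%:R <= #|~: uncovered ([::] : seq ({set V} * {set V}))|%:R :> R].
  by rewrite /uncovered big_nil setC0 finset.setDT cards0 setCT cards0 !mulr0.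
elim: m [::] => // m IHm l [l1 l2]; rewrite ltnS => lm.
have [H|/existsNP[A /existsNP[B /negP]]] := pselect (forall A B,
  gam * #|uncovered l :&: setX A B|%:R <= #|W :&: setX A B|%:R + eps * n2); first by exists l.
rewrite -ltNge; set t := #|uncovered l :&: _|; set w := #|W :&: _| => wt.
have uE : uncovered ((A, B) :: l) = uncovered l :\: rect (A, B) := uncovered_cons _ _.
pose D := uncovered l :&: rect (A, B).
have tD : (t <= #|D|)%N by apply: subset_leq_card; apply: setIS; exact: finset.subsetUl.
have CE : ~: uncovered ((A, B) :: l) = ~: uncovered l :|: D.
  apply/setP => x; rewrite uE !(in_setC, in_setU, in_setD, in_setI).
  by do !case: (_ \in _).
have CD : #|~: uncovered ((A, B) :: l)| = (#|~: uncovered l| + #|D|)%N.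
  rewrite CE cardsU (_ : _ :&: D = set0) ?cards0 ?subn0 //.
  by apply/setP => x; rewrite !inE andbA andNb.
have eps_t : eps * n2 < t%:R.
  apply: (@lt_le_trans _ _ (gam * t%:R)); last by rewrite ler_piMl.
  by apply: le_lt_trans wt; rewrite lerDr.
apply: (IHm ((A, B) :: l)).
  split; last first.
    rewrite CD /= -addn1 !natrD mulrDr mulr1 lerD //; apply: ltW; apply: (lt_le_trans eps_t).
    by rewrite ler_nat.
  (* A symmetrised rectangle loses at most [w] pairs of [W] in each orientation; this is the origin
     of the factor 2. *)
  have lost : (#|W :\: uncovered ((A, B) :: l)| <= #|W :\: uncovered l| + (w + w))%N.
    rewrite {2}/w -(card_swap A B Wsym) uE.
    apply: leq_trans (leq_add (leqnn _) (leq_card_setU _ _)).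
    apply: leq_trans (leq_card_setU _ _); apply: subset_leq_card; apply/fintype.subsetP => -[x y].
    rewrite !inE negb_and negbK => /andP[/orP[/orP[]/andP[/= -> ->]|-> ] ->] //=; rewrite ?orbT //.
  apply: (@le_trans _ _ (#|W :\: uncovered l|%:R + 2 * w%:R)).
    by rewrite -natrM -natrD ler_nat mul2n -addnn.
  rewrite CD natrD mulrDr lerD // -mulrA ler_pM2l //.
  apply: (@le_trans _ _ (gam * t%:R)); last by rewrite ler_pM2l // ler_nat.
  apply: ltW; apply: le_lt_trans wt; rewrite lerDl mulr_ge0 // ltW //.
apply: leq_trans lm; apply: proper_card; rewrite uE; apply/properP; split; first exact: subsetDl.
have /card_gt0P[x] : (0 < t)%N by rewrite -(ltr_nat R); apply: le_lt_trans eps_t; rewrite mulr_ge0 // ltW.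
by rewrite in_setI => /andP[xu xr]; exists x => //; rewrite in_setD negb_and negbK /rect in_setU xr.
Qed.

Definition upd (I V : finType) (f : {ffun I -> V}) (i : I) (x : V) : {ffun I -> V} :=
  [ffun l => if l == i then x else f l].

(** Exchanging the value at [i] with a fresh [x] is an involution on the pairs [(f, x)], so a
    resampled uniform tuple is again uniform. *)
Lemma resample (I V : finType) (i : I) (F : {ffun I -> V} -> R) :
  \sum_f \sum_x F (upd f i x) = #|V|%:R * \sum_f F f.
Proof.
pose h (u : {ffun I -> V} * V) := (upd u.1 i u.2, u.1 i).
have hK : involutive h.
  move=> [f x]; rewrite /h /= ffunE eqxx; congr pair; apply/ffunP => l.
  by rewrite !ffunE; case: eqP => [->|].
have -> : \sum_f \sum_x F (upd f i x) = \sum_u F (h u).1.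
  by rewrite (pair_bigA _ (fun f x => F (upd f i x))).
transitivity (\sum_(u : {ffun I -> V} * V) F u.1).
  by rewrite [RHS](reindex_inj (inv_inj hK)).
rewrite -(pair_bigA _ (fun f (x : V) => F f)) /= big_distrr /=.
by apply: eq_bigr => f _; rewrite sumr_const mulr_natl.
Qed.

Lemma resample2 (I V : finType) (i j : I) (F : {ffun I -> V} -> R) :
  \sum_f \sum_x \sum_y F (upd (upd f i x) j y) = #|V|%:R ^+ 2 * \sum_f F f.
Proof.
rewrite (resample i (fun f => \sum_y F (upd f j y))) (resample j).
by rewrite mulrA expr2.
Qed.

Section Hybrid.
Variables (V I : finType) (gam eps : R) (T W : {set V * V}).
Hypotheses (gam0 : 0 < gam) (gam1 : gam <= 1) (eps0 : 0 <= eps).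
Hypothesis TW : forall A B : {set V},
  gam * #|T :&: setX A B|%:R <= #|W :&: setX A B|%:R + eps * #|V|%:R ^+ 2.
Local Notation n := #|V|.

Definition holds (X : {set V * V}) (L : seq (I * I)) (f : {ffun I -> V}) : bool :=
  all (fun p => (f p.1, f p.2) \in X) L.

(* Replacing a constraint in [T] by one in [W] costs a factor [gam], up to
   [eps n^#|I|]; once all are replaced, no tuple is left. *)
Definition hybrid (L1 L2 : seq (I * I)) : R := \sum_f (holds T L1 f && holds W L2 f)%:R.

Definition touches (i : I) (p : I * I) : bool := (p.1 == i) || (p.2 == i).

Lemma holds_split X L i j f x y : i != j -> (forall p, p \in L -> ~~ (touches i p && touches j p)) ->
  holds X L (upd (upd f i x) j y) =
  all (fun p => touches j p || ((upd f i x p.1, upd f i x p.2) \in X)) L &&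
  all (fun p => touches i p || ((upd f j y p.1, upd f j y p.2) \in X)) L.
Proof.
move=> ij Lp; rewrite -all_predI; apply: eq_in_all => -[a b] /Lp /=.
rewrite /touches /= !ffunE.
by case: (eqVneq a i) => ai; case: (eqVneq b i) => bi; case: (eqVneq a j) => aj;
  case: (eqVneq b j) => bj //=; rewrite ?andbT ?andbb.
Qed.

(** With the coordinates other than [i] and [j] fixed, the remaining constraints restrict the two
    values separately, to [inA] and [inB], since none of them involves both. The inequality [TW] for
    these two sets is then averaged over the rest. *)
Lemma hybrid_step i j L1 L2 : i != j ->
  (forall p, p \in L1 ++ L2 -> ~~ (touches i p && touches j p)) ->
  gam * hybrid ((i, j) :: L1) L2 <= hybrid L1 ((i, j) :: L2) + eps * n%:R ^+ #|I|.
Proof.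
move=> ij Lp.
have [n0|n0] := posnP n.
  have -> : hybrid ((i, j) :: L1) L2 = 0.
    rewrite /hybrid big1 // => f _.
    by have := fintype0 (f i) n0.
  rewrite mulr0 addr_ge0 //; first by apply: sumr_ge0 => f _; rewrite ler0n.
  by rewrite mulr_ge0 ?exprn_ge0.
have n20 : 0 < n%:R ^+ 2 :> R by rewrite exprn_gt0 // ltr0n.
rewrite -(ler_pM2l n20) mulrDr mulrCA /hybrid -!(resample2 i j).
have -> : n%:R ^+ 2 * (eps * n%:R ^+ #|I|) = \sum_(f : {ffun I -> V}) eps * n%:R ^+ 2 :> R.
  by rewrite sumr_const card_ffun -[RHS]mulr_natr natrX; ring.
rewrite big_distrr -big_split /=; apply: ler_sum => f _.
pose inA x := all (fun p => touches j p || ((upd f i x p.1, upd f i x p.2) \in T)) L1 &&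
  all (fun p => touches j p || ((upd f i x p.1, upd f i x p.2) \in W)) L2.
pose inB y := all (fun p => touches i p || ((upd f j y p.1, upd f j y p.2) \in T)) L1 &&
  all (fun p => touches i p || ((upd f j y p.1, upd f j y p.2) \in W)) L2.
have E (X : {set V * V}) : \sum_x \sum_y (((x, y) \in X) && (inA x && inB y))%:R =
    #|X :&: setX [set x | inA x] [set y | inB y]|%:R :> R.
  rewrite (pair_bigA _ (fun x y => (((x, y) \in X) && (inA x && inB y))%:R)) /=.
  rewrite -natr_sum; congr (_%:R); rewrite -sum1_card [RHS]big_mkcond; apply: eq_bigr => -[x y] _.
  by rewrite /= in_setI in_setX !inE; case: [&& _, _ & _].
have HL1 p : p \in L1 -> ~~ (touches i p && touches j p) by move=> pL; apply: Lp; rewrite mem_cat pL.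
have HL2 p : p \in L2 -> ~~ (touches i p && touches j p) by move=> pL; apply: Lp; rewrite mem_cat pL orbT.
have ev x y : (upd (upd f i x) j y i, upd (upd f i x) j y j) = (x, y).
  by rewrite !ffunE (negPf ij) !eqxx.
rewrite [X in gam * X](_ : _ = #|T :&: setX [set x | inA x] [set y | inB y]|%:R).
  rewrite [X in _ <= X + _](_ : _ = #|W :&: setX [set x | inA x] [set y | inB y]|%:R) //.
  rewrite -E; apply: eq_bigr => x _; apply: eq_bigr => y _; congr ((_ : bool)%:R).
  rewrite /= ev !(holds_split _ _ _ _ ij) // /inA /inB.
  by case: (_ \in W) => /=; rewrite ?andbF //; do !case: all.
rewrite -E; apply: eq_bigr => x _; apply: eq_bigr => y _; congr ((_ : bool)%:R).
rewrite /= ev !(holds_split _ _ _ _ ij) // /inA /inB.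
by case: (_ \in T) => //=; do !case: all.
Qed.

Lemma clique_count (m : nat) (g : 'I_m -> I) : injective g ->
  (forall h : 'I_m -> V, exists a b : 'I_m, (a < b)%N /\ (h a, h b) \notin W) ->
  gam ^+ (m * m) * #|[set f : {ffun I -> V} | [forall a : 'I_m, forall b : 'I_m, (a < b)%N ==> ((f (g a), f (g b)) \in T)]]|%:R
    <= (m * m)%:R * eps * n%:R ^+ #|I|.
Proof.
move=> g_inj Wfree; pose gg (p : 'I_m * 'I_m) := (g p.1, g p.2).
pose L := [seq p : 'I_m * 'I_m <- enum {: 'I_m * 'I_m} | (p.1 < p.2)%N].
have sL : (size L <= m * m)%N.
  by rewrite size_filter (leq_trans (count_size _ _)) // -cardE card_prod card_ord.
have N0 : 0 <= eps * n%:R ^+ #|I| by rewrite mulr_ge0 ?exprn_ge0.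
have step L1 L2 : perm_eq (L1 ++ L2) L ->
    gam ^+ size L1 * hybrid (map gg L1) (map gg L2) <= (size L1)%:R * (eps * n%:R ^+ #|I|).
  elim: L1 L2 => [|[a b] L1 IH] L2 pL.
    rewrite expr0 mul1r mul0r /hybrid big1 // => f _.
    have [a [b [ab]]] := Wfree (f \o g); rewrite /holds /=.
    case: allP => // H; have -> // := H (gg (a, b)).
    by apply: map_f; rewrite (perm_mem pL) mem_filter ab mem_enum.
  have uL : uniq ((a, b) :: L1 ++ L2) by rewrite (perm_uniq pL) filter_uniq // enum_uniq.
  have ltL p : p \in (a, b) :: L1 ++ L2 -> (p.1 < p.2)%N.
    by rewrite -cat_cons (perm_mem pL) mem_filter => /andP[].
  have ab : (a < b)%N by apply: (ltL (a, b)); rewrite inE eqxx.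
  have gab : g a != g b by rewrite (inj_eq g_inj); apply: contraTneq ab => ->; rewrite ltnn.
  rewrite [size _]/= exprS -mulrA mulrCA.
  have H : gam * hybrid (map gg ((a, b) :: L1)) (map gg L2) <=
      hybrid (map gg L1) (map gg ((a, b) :: L2)) + eps * n%:R ^+ #|I|.
    apply: hybrid_step => // q; rewrite -map_cat => /mapP[[a' b'] pL' ->].
    have /ltL /= a'b' : (a', b') \in (a, b) :: L1 ++ L2 by rewrite inE pL' orbT.
    rewrite /touches /gg /= !(inj_eq g_inj); apply/negP => /andP[].
    move=> /orP[]/eqP e1 /orP[]/eqP e2; move: a'b' ab uL; rewrite -?e1 -?e2 ?ltnn //.
      by move=> _ _ /= /andP[/negP].
    by move=> h1 h2; have := ltn_trans h1 h2; rewrite ltnn.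
  apply: (@le_trans _ _ (gam ^+ size L1 * (hybrid (map gg L1) (map gg ((a, b) :: L2)) + eps * n%:R ^+ #|I|))).
    by rewrite ler_wpM2l // exprn_ge0 // ltW.
  rewrite mulrDr -[in leRHS]addn1 natrD mulrDl mul1r lerD //.
    by apply: IH; rewrite -(perm_catCA [:: (a, b)]) in pL *.
  by rewrite ler_piMl // exprn_ile1 // ltW.
have := step L [::]; rewrite cats0 => /(_ (perm_refl _)) H.
apply: (@le_trans _ _ (gam ^+ size L * hybrid (map gg L) (map gg [::]))); last first.
  apply: (le_trans H); rewrite -mulrA ler_wpM2r // ler_nat //.
have -> : hybrid (map gg L) (map gg [::]) =
    #|[set f : {ffun I -> V} | [forall a : 'I_m, forall b : 'I_m, (a < b)%N ==> ((f (g a), f (g b)) \in T)]]|%:R.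
  rewrite /hybrid -natr_sum -sum1_card [in RHS]big_mkcond; congr (_%:R); apply: eq_bigr => f _.
  rewrite andbT inE; case: ifP => Hf; rewrite /holds all_map.
    case: allP => // -[]; move=> [a b]; rewrite mem_filter /= => /andP[ab _].
    by have /forallP/(_ a)/forallP/(_ b)/implyP := Hf; exact.
  apply/eqP; rewrite eqb0; apply: contraFN Hf => /allP Hf.
  apply/forallP => a; apply/forallP => b; apply/implyP => ab.
  by apply: (Hf (a, b)); rewrite mem_filter ab mem_enum.
rewrite ler_wpM2r // ler_wiXn2l // ltW //.
Qed.

End Hybrid.

End Greedy.

Lemma leq_card_bigcup (I T : finType) (P : pred I) (A : I -> {set T}) :
  (#|\bigcup_(i | P i) A i| <= \sum_(i | P i) #|A i|)%N.
Proof.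
elim/big_ind2: _ => [|B1 n1 B2 n2 le1 le2|c _]; rewrite ?cards0 //.
by apply: leq_trans (leq_card_setU _ _) _; rewrite leq_add.
Qed.

Section Containers.
Variables (R : realType) (s : nat) (k : 'I_s -> nat).

(* In each colour the complement of a template is a union of [K] symmetrised
   rectangles, so that a template carries only [O(n)] bits. *)
Definition code (V : finType) (K : nat) : finType :=
  {ffun 'I_s -> {ffun 'I_K -> {set V} * {set V}}}.

Definition template (V : finType) (K : nat) (t : code V K) (x y : V) : {set 'I_s} :=
  if x == y then set0 else [set c | (x, y) \in uncovered (codom (t c))].

Lemma template_pairing V K (t : code V K) : pairing (template t).
Proof.
split=> [x y|x]; rewrite /template ?eqxx // eq_sym; case: ifP => // _.
by apply: eq_finset => c; exact: uncovered_sym.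
Qed.

Lemma card_code V K : #|code V K| = (2 ^ (2 * K * s * #|V|))%N.
Proof.
rewrite card_ffun card_ffun card_prod -cardsT -powersetT card_powerset cardsT !card_ord.
by rewrite -expnD -!expnM; congr (_ ^ _)%N; ring.
Qed.

(** An invalid tuple contains a clique of colour [c] on some [k c] of its indices; [clique_count]
    bounds such tuples for each choice of indices, and [eps] is small enough for the sum over all
    choices. A family of index types is allowed because tuples of two sizes are used later. *)
Lemma container (I : finType) (J : I -> finType) (eta : R) : 0 < eta -> exists K : nat,
  forall (V : finType) (W : 'I_s -> {set V * V}), (0 < #|V|)%N ->
  (forall c x y, ((x, y) \in W c) = ((y, x) \in W c)) -> (forall c x, (x, x) \notin W c) ->
  (forall c (h : 'I_(k c) -> V), exists a b : 'I_(k c), (a < b)%N /\ (h a, h b) \notin W c) ->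
  exists t : code V K,
    (forall i, #|[set F : {ffun J i -> V} | ~~ valid k (fun a b => template t (F a) (F b))]|%:R
      <= eta * #|V|%:R ^+ #|J i|) /\
    forall c, #|[set p in W c | c \notin template t p.1 p.2]|%:R <= eta * #|V|%:R ^+ 2.
Proof.
move=> eta0; pose gam : R := Num.min 1 (eta / 2).
have gam0 : 0 < gam by rewrite lt_min ltr01 divr_gt0.
have gam1 : gam <= 1 by rewrite ge_min lexx.
have gam2 : 2 * gam <= eta.
  by rewrite mulrC -ler_pdivlMr // ge_min lexx orbT.
pose Ci i : R := \sum_c \sum_(g : {ffun 'I_(k c) -> J i}) (k c * k c)%:R / gam ^+ (k c * k c).
have Ci0 i : 0 <= Ci i.
  apply: sumr_ge0 => c _; apply: sumr_ge0 => g _.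
  by rewrite divr_ge0 // exprn_ge0 // ltW.
pose C := \sum_i Ci i; have C0 : 0 <= C by apply: sumr_ge0.
have C1 : 0 < C + 1 by rewrite ltr_wpDl.
pose eps := eta / (C + 1).
have eps0 : 0 < eps by rewrite divr_gt0.
have [K HK] := greedy_container gam0 gam1 eps0.
exists K => V W V0 Wsym Wirr Wfree.
have /fin_all_exists[t Ht] := fun c => HK V (W c) V0 (Wsym c).
exists (finfun t); set n := #|V|.
have tE c : finfun t c = t c by rewrite ffunE.
split=> [i|c]; last first.
  apply: le_trans (le_trans (Ht c).1 _); last by rewrite ler_wpM2r // exprn_ge0.
  rewrite ler_nat; apply: subset_leq_card; apply/fintype.subsetP => -[x y].
  rewrite inE /= => /andP[xyW]; rewrite in_setD xyW andbT /template.
  have -> : (x == y) = false by apply: contraTF xyW => /eqP ->.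
  by rewrite in_set tE.
pose S c (g : {ffun 'I_(k c) -> J i}) : {set {ffun J i -> V}} :=
  [set F : {ffun J i -> V} | [forall a : 'I_(k c), forall b : 'I_(k c), (a < b)%N ==> (c \in template (finfun t) (F (g a)) (F (g b)))]].
have Scard c g : #|S c g|%:R <= eps * n%:R ^+ #|J i| * ((k c * k c)%:R / gam ^+ (k c * k c)).
  (* A repeated index would need a colour on a loop, so a non-injective [g] contributes nothing. *)
  have [g_inj|/injectivePn[a [b ab gab]]] := boolP (injectiveb g); last first.
    have -> : S c g = set0.
      apply/setP => F; rewrite !inE; apply/negP => /forallP H.
      have := fun a => forallP (H a); clear H => H.
      have pp := template_pairing (finfun t).
      move: ab; rewrite neq_ltn => /orP[] ab; [have := H a b | have := H b a];
        by rewrite ab /= gab pp.2 inE.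
    rewrite cards0; apply: mulr_ge0; first by apply: mulr_ge0; [exact: ltW | exact: exprn_ge0].
    by apply: divr_ge0 => //; apply: exprn_ge0; exact: ltW.
  have := clique_count gam0 gam1 (ltW eps0) (Ht c).2 (injectiveP _ g_inj) (Wfree c).
  rewrite -mulrA [leRHS]mulrC => H.
  rewrite mulrA ler_pdivlMr ?exprn_gt0 //; apply: le_trans H.
  rewrite mulrC ler_wpM2l ?exprn_ge0 // ?(ltW gam0) //.
  rewrite ler_nat; apply: subset_leq_card; apply/fintype.subsetP => F.
  rewrite !inE => /forallP HF; apply/forallP => a; apply/forallP => b; apply/implyP => ab.
  have /forallP/(_ b)/implyP/(_ ab) := HF a; rewrite /template.
  by case: ifP => _; rewrite inE // tE.
apply: (@le_trans _ _ (\sum_c \sum_g #|S c g|%:R)).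
  under eq_bigr do rewrite -natr_sum; rewrite -natr_sum ler_nat.
  have sub : [set F : {ffun J i -> V} | ~~ valid k (fun a b => template (finfun t) (F a) (F b))]
      \subset \bigcup_c \bigcup_g S c g.
    apply/fintype.subsetP => F; rewrite inE => /validP /existsNP[c /existsNP[g Hg]].
    apply/finset.bigcupP; exists c => //; apply/finset.bigcupP; exists (finfun g) => //.
    rewrite inE; apply/forallP => a; apply/forallP => b; apply/implyP => ab.
    by rewrite !ffunE; apply: contra_notT Hg => cp; exists a, b.
  apply: leq_trans (subset_leq_card sub) _; apply: leq_trans (leq_card_bigcup _ _) _.
  by apply: leq_sum => c _; exact: leq_card_bigcup.
apply: (@le_trans _ _ (eps * n%:R ^+ #|J i| * Ci i)).
  by rewrite /Ci !big_distrr /=; apply: ler_sum => c _; rewrite big_distrr /=; apply: ler_sum => g _.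
rewrite mulrAC ler_wpM2r ?exprn_ge0 // /eps mulrAC ler_pdivrMr // ler_pM2l //.
by rewrite /C (bigD1 i) //= -addrA lerDl addr_ge0 // sumr_ge0.
Qed.

End Containers.

(** * Stability of templates *)

Section Sampling.
Variables (R : realType) (s : nat) (k : 'I_s -> nat).
Hypothesis (k2 : forall c, (2 <= k c)%N).
Local Notation weight := (@weight R s).
Local Notation Q := (Q R k).
Local Notation L := (log2 (s%:R : R)).

Lemma L_ge0 : 0 <= L. Proof. exact: log2_nat_ge0. Qed.

Lemma sum_mem_card (T : finType) (A : {set T}) : (\sum_x (x \in A) = #|A|)%N.
Proof.
by rewrite -sum1_card [RHS]big_mkcond; apply: eq_bigr => x _; case: (x \in A).
Qed.

Lemma sum_ffun1 (J V : finType) (i : J) (H : V -> R) :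
  #|V|%:R * \sum_(F : {ffun J -> V}) H (F i) = #|{ffun J -> V}|%:R * \sum_x H x.
Proof.
rewrite -(resample i (fun F : {ffun J -> V} => H (F i))).
under eq_bigr do under eq_bigr do rewrite ffunE eqxx.
by rewrite sumr_const mulr_natl.
Qed.

Lemma sum_ffun2 (J V : finType) (i j : J) (H : V -> V -> R) : i != j ->
  #|V|%:R ^+ 2 * \sum_(F : {ffun J -> V}) H (F i) (F j) =
  #|{ffun J -> V}|%:R * \sum_x \sum_y H x y.
Proof.
move=> ij; rewrite -(resample2 i j (fun F : {ffun J -> V} => H (F i) (F j))).
under eq_bigr do under eq_bigr do under eq_bigr do rewrite !ffunE (negPf ij) !eqxx.
by rewrite sumr_const mulr_natl.
Qed.

Lemma sum_pairs (J V : finType) (H : V -> V -> R) :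
  #|V|%:R ^+ 2 * \sum_(F : {ffun J -> V}) \sum_i \sum_(j | j != i) H (F i) (F j) =
  #|{ffun J -> V}|%:R * ((#|J| * (#|J| - 1))%:R * \sum_x \sum_y H x y).
Proof.
rewrite exchange_big big_distrr /=.
transitivity (\sum_(i : J) \sum_(j | j != i) #|{ffun J -> V}|%:R * \sum_x \sum_y H x y).
  apply: eq_bigr => i _; rewrite exchange_big big_distrr /=.
  by apply: eq_bigr => j ji; rewrite sum_ffun2 // eq_sym.
rewrite (eq_bigr (fun=> (#|J| - 1)%:R * (#|{ffun J -> V}|%:R * \sum_x \sum_y H x y))); last first.
  move=> i _; rewrite sumr_const [RHS]mulr_natl subn1; congr (_ *+ _).
  by rewrite -(cardC1 i); apply: eq_card.
by rewrite sumr_const -mulr_natl natrM; ring.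
Qed.

Lemma form_offdiag (J : finType) (p : J -> J -> {set 'I_s}) (al : J -> R) : pairing p ->
  form p al = \sum_i \sum_(j | j != i) al i * al j * weight (p i j).
Proof.
move=> pp; apply: eq_bigr => i _; rewrite (bigD1 i) //= pp.2 weight_small ?cards0 //.
by rewrite mulr0 add0r.
Qed.

Lemma comp_pairing (J V : finType) (tau : V -> V -> {set 'I_s}) (F : J -> V) :
  pairing tau -> pairing (fun i j => tau (F i) (F j)).
Proof. by move=> [h1 h2]; split=> [i j|i]; [exact: h1 | exact: h2]. Qed.

Definition invalid (J V : finType) (tau : V -> V -> {set 'I_s}) : {set {ffun J -> V}} :=
  [set F : {ffun J -> V} | ~~ valid k (fun i j => tau (F i) (F j))].

(** Average the form over random tuples [F]. Valid tuples obey [form_le_Q]; the coincidences $i=j$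
    in the square cost $Q/(|J|-1)$, and invalid tuples are bounded trivially by means of $L$.
    General weights [g] are needed for the bound on degrees. *)
Lemma spread_form_le (J V : finType) (tau : V -> V -> {set 'I_s}) (eta : R) (g : V -> R) :
  pairing tau -> (2 <= #|J|)%N -> (0 < #|V|)%N ->
  #|invalid J tau|%:R <= eta * #|V|%:R ^+ #|J| -> (forall x, 0 <= g x <= 1) ->
  form tau g <= Q * (\sum_x g x) ^+ 2 + (Q / (#|J| - 1)%:R + 2 * L * eta) * #|V|%:R ^+ 2.
Proof.
move=> tp J2 V0 inv g01; set n := #|V|; set m := #|J|.
have n0 : 0 < n%:R :> R by rewrite ltr0n.
have m1 : 0 < (m - 1)%:R :> R by rewrite ltr0n subn_gt0.
have m0 : 0 < m%:R :> R by rewrite ltr0n (leq_trans _ J2).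
have Q0 : 0 <= Q by exact: Q_ge0.
pose N : R := #|{ffun J -> V}|%:R.
have NE : N = n%:R ^+ m by rewrite /N card_ffun natrX.
have N0 : 0 < N by rewrite NE exprn_gt0.
have g0 x : 0 <= g x by case/andP: (g01 x).
have g1 x : g x <= 1 by case/andP: (g01 x).
have one (F : {ffun J -> V}) : \sum_i \sum_(j | j != i) g (F i) * g (F j) * weight (tau (F i) (F j)) <=
    Q * (\sum_i \sum_(j | j != i) g (F i) * g (F j) + m%:R) + (F \in invalid J tau)%:R * (L * m%:R ^+ 2).
  rewrite -(form_offdiag (fun i => g (F i)) (comp_pairing F tp)).
  have sm : \sum_i g (F i) <= m%:R.
    apply: le_trans (ler_sum _ (fun i _ => g1 (F i))) _.
    by rewrite sumr_const.
  have s0 : 0 <= \sum_i g (F i) by apply: sumr_ge0.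
  have sq : (\sum_i g (F i)) ^+ 2 <= \sum_i \sum_(j | j != i) g (F i) * g (F j) + m%:R.
    rewrite expr2 big_distrl /=.
    have -> : m%:R = \sum_(i : J) 1 :> R by rewrite sumr_const.
    rewrite -big_split; apply: ler_sum => i _ /=.
    rewrite big_distrr [leLHS](bigD1 i) //= [leLHS]addrC; apply: lerD => //.
    by rewrite -[leRHS]mulr1 ler_pM.
  have D0 : 0 <= \sum_i \sum_(j | j != i) g (F i) * g (F j).
    by apply: sumr_ge0 => i _; apply: sumr_ge0 => j _; rewrite mulr_ge0.
  rewrite inE; have [vF|vF] := boolP (valid k (fun i j => tau (F i) (F j))).
    rewrite mul0r addr0; apply: (le_trans (form_le_Q (comp_pairing F tp) vF _)) => //.
    by rewrite ler_wpM2l.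
  rewrite mul1r; apply: (le_trans (form_le _ _)) => //.
  rewrite -[leLHS]add0r lerD // ?mulr_ge0 ?addr_ge0 ?ler_wpM2l ?L_ge0 //.
  by rewrite lerXn2r ?nnegrE.
have : \sum_(F : {ffun J -> V}) \sum_i \sum_(j | j != i) g (F i) * g (F j) * weight (tau (F i) (F j)) <=
  \sum_(F : {ffun J -> V}) (Q * (\sum_i \sum_(j | j != i) g (F i) * g (F j) + m%:R) + (F \in invalid J tau)%:R * (L * m%:R ^+ 2)).
  by apply: ler_sum => F _; exact: one.
rewrite -(ler_pM2l (exprn_gt0 2 n0)).
rewrite (sum_pairs J (fun x y => g x * g y * weight (tau x y))) -/(form tau g) -/N -/m -/n.
have -> : \sum_(F : {ffun J -> V}) (Q * (\sum_i \sum_(j | j != i) g (F i) * g (F j) + m%:R) + (F \in invalid J tau)%:R * (L * m%:R ^+ 2)) =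
  Q * (\sum_(F : {ffun J -> V}) \sum_i \sum_(j | j != i) g (F i) * g (F j) + N * m%:R) + #|invalid J tau|%:R * (L * m%:R ^+ 2).
  rewrite big_split -big_distrr big_split sumr_const -big_distrl -natr_sum /=.
  rewrite -[X in Q * (_ + X)]mulr_natl; congr (_ + _%:R * _).
  exact: sum_mem_card.
have E2 := sum_pairs J (fun x y => g x * g y).
have E3 : \sum_x \sum_y g x * g y = (\sum_x g x) ^+ 2.
  by rewrite expr2 big_distrl; apply: eq_bigr => x _; rewrite big_distrr.
rewrite /= E3 -/N -/m -/n in E2.
rewrite mulrDr [X in _ <= X + _]mulrCA [X in _ <= Q * X + _]mulrDr E2 natrM => H.
have inv' : #|invalid J tau|%:R <= eta * N by rewrite NE.
set S2 := (\sum_x g x) ^+ 2 in H *; set f := form tau g in H *.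
have H2 : N * (m%:R * (m - 1)%:R * f) <=
    N * (m%:R * (m - 1)%:R * (Q * S2 + (Q / (m - 1)%:R + 2 * L * eta) * n%:R ^+ 2)).
  apply: (le_trans H).
  apply: (@le_trans _ _ (Q * (N * (m%:R * (m - 1)%:R * S2) + n%:R ^+ 2 * (N * m%:R)) + n%:R ^+ 2 * (eta * N * (L * m%:R ^+ 2)))).
    rewrite lerD2l ler_wpM2l ?exprn_ge0 //; apply: ler_wpM2r inv'.
    by rewrite mulr_ge0 ?L_ge0 ?exprn_ge0.
  have eta0 : 0 <= eta.
    have := le_trans (ler0n _ _) inv'; rewrite pmulr_lge0 //.
  have mm : m%:R <= 2 * (m - 1)%:R :> R.
    by rewrite -natrM ler_nat; move: J2; rewrite -/m; lia.
  rewrite -subr_ge0.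
  have -> : N * (m%:R * (m - 1)%:R * (Q * S2 + (Q / (m - 1)%:R + 2 * L * eta) * n%:R ^+ 2)) -
    (Q * (N * (m%:R * (m - 1)%:R * S2) + n%:R ^+ 2 * (N * m%:R)) + n%:R ^+ 2 * (eta * N * (L * m%:R ^+ 2))) =
    N * m%:R * n%:R ^+ 2 * (L * eta) * (2 * (m - 1)%:R - m%:R).
    by field; rewrite gt_eqF.
  apply: mulr_ge0; last by rewrite subr_ge0.
  apply: mulr_ge0; last by rewrite mulr_ge0 ?L_ge0.
  by rewrite !mulr_ge0 ?ler0n ?exprn_ge0 ?ler0n // ltW.
by move: H2; rewrite ler_pM2l // ler_pM2l // mulr_gt0.
Qed.

(** The numerical core of [low_degree], where [q] and [A] are the normalised first and second
    moments of the degrees. Expanding the first inequality, the terms linear in [th] give the second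
    moment about [Qr]; the others are small by the conditions on [x] and [th]. *)
Lemma variance_bound (q A Qr Lr th x nu : R) : 0 <= Qr -> 0 < th -> th <= 1 ->
  q + 2 * th * A <= Qr * (1 + th * q) ^+ 2 + x * (1 + th * Lr) ^+ 2 ->
  Qr - x <= q -> 0 <= q -> q <= Lr -> 0 <= x -> Qr * Lr ^+ 2 * th <= nu ->
  x * (1 + (1 + Lr) ^+ 2 + 2 * Qr) <= nu * th -> A - 2 * Qr * q + Qr ^+ 2 <= nu.
Proof.
move=> Q0 th0 th1 h1 h2 q0 qL x0 h3 h4.
have L0 : 0 <= Lr by exact: le_trans qL.
rewrite -(ler_pM2l (mulr_gt0 (ltr0n R 2) th0)).
have a1 : Qr * th * (th * q ^+ 2) <= th * nu.
  apply: (@le_trans _ _ (Qr * th * (th * Lr ^+ 2))).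
    by rewrite ler_wpM2l ?mulr_ge0 ?(ltW th0) // ler_wpM2l ?(ltW th0) // lerXn2r ?nnegrE.
  rewrite (_ : _ * _ = th * (Qr * Lr ^+ 2 * th)); last by ring.
  by rewrite ler_wpM2l ?(ltW th0).
have a2 : (Qr - q) * (1 + 2 * th * Qr) <= x * (1 + 2 * Qr).
  have c0 : 0 <= 1 + 2 * th * Qr by rewrite addr_ge0 // !mulr_ge0 // ltW.
  apply: (@le_trans _ _ (x * (1 + 2 * th * Qr))); first by rewrite ler_wpM2r //; lra.
  rewrite ler_wpM2l // lerD2l -mulrA ler_wpM2l // -[leRHS]mul1r ler_wpM2r //.
have a3 : x * (1 + th * Lr) ^+ 2 <= x * (1 + Lr) ^+ 2.
  rewrite ler_wpM2l // lerXn2r ?nnegrE ?addr_ge0 ?mulr_ge0 ?(ltW th0) // lerD2l.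
  by rewrite -[leRHS]mul1r ler_wpM2r.
lra.
Qed.

(* Testing [spread_form_le] on weights proportional to [1 + th D y], where [D] is
   the degree, bounds the variance of [D], so that few degrees are below [Q n]. *)
Lemma low_degree (nu : R) : 0 < nu -> exists2 x : R, 0 < x &
  forall (V : finType) (tau : V -> V -> {set 'I_s}), pairing tau -> (0 < #|V|)%N ->
  (forall g, (forall y, 0 <= g y <= 1) -> form tau g <= Q * (\sum_y g y) ^+ 2 + x * #|V|%:R ^+ 2) ->
  (Q - x) * #|V|%:R ^+ 2 <= form tau (fun=> 1) ->
  #|[set y | deg tau (fun=> 1) y < (Q - nu) * #|V|%:R]|%:R <= nu * #|V|%:R.
Proof.
move=> nu0; have Q0 : 0 <= Q by exact: Q_ge0.
have L0 := L_ge0; have nu30 : 0 < nu ^+ 3 by rewrite exprn_gt0.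
have QL0 : 0 <= Q * L ^+ 2 by rewrite mulr_ge0 ?exprn_ge0.
have QL1 : 0 < 1 + Q * L ^+ 2 by rewrite ltr_wpDr.
(* This makes the second-order term at most [nu ^+ 3]. The cube is needed because Chebyshev's
   inequality divides the variance by [nu ^+ 2] and a fraction [nu] has to remain. *)
pose th := Num.min 1 (nu ^+ 3 / (1 + Q * L ^+ 2)).
have th0 : 0 < th by rewrite lt_min ltr01 divr_gt0.
have th1 : th <= 1 by rewrite ge_min lexx.
have thQ : Q * L ^+ 2 * th <= nu ^+ 3.
  have t2 : th <= nu ^+ 3 / (1 + Q * L ^+ 2) by rewrite ge_min lexx orbT.
  apply: (le_trans (ler_wpM2l QL0 t2)).
  by rewrite mulrA ler_pdivrMr // mulrC ler_pM2l // lerDr.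
pose C := 1 + (1 + L) ^+ 2 + 2 * Q.
have C0 : 0 < C by have := sqr_ge0 (1 + L); rewrite /C; lra.
pose x := nu ^+ 3 * th / C.
have x0 : 0 < x by rewrite divr_gt0 ?mulr_gt0.
exists x => // V tau tp V0 SP fQ; set n := #|V|%:R in SP fQ *.
have n0 : 0 < n by rewrite ltr0n.
pose D := deg tau (fun=> 1 : R).
pose S1 := \sum_y D y; pose S2 := \sum_y D y ^+ 2.
have D0 y : 0 <= D y by apply: deg_ge0.
have DL y : D y <= L * n.
  by apply: (le_trans (deg_le _ _ _)) => //; rewrite sumr_const.
have f1 : form tau (fun=> 1) = S1.
  by rewrite form_deg; apply: eq_bigr => y _; rewrite mul1r.
have thL : 0 < 1 + th * L by rewrite ltr_wpDr // mulr_ge0 // ltW.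
pose q := S1 / n ^+ 2; pose A := S2 / n ^+ 3.
have var : A - 2 * Q * q + Q ^+ 2 <= nu ^+ 3.
  (* The factor in front keeps the test weights at most 1. *)
  have := SP (fun y => (1 + th * L)^-1 * (1 + th / n * D y)) _.
  rewrite form_scale -big_distrr /= exprMn.
  have -> : \sum_y (1 + th / n * D y) = n * (1 + th * q).
    by rewrite big_split sumr_const -big_distrr /= -/S1 /q; field; rewrite gt_eqF.
  have H1 : n ^+ 2 * (q + 2 * th * A) <= form tau (fun y => 1 + th / n * D y).
    rewrite formD // f1 form_scale.
    have -> : \sum_y th / n * D y * deg tau (fun=> 1) y = th / n * S2.
      by rewrite /S2 big_distrr; apply: eq_bigr => y _; rewrite -/D /=; ring.
    apply: (@le_trans _ _ (S1 + 2 * (th / n * S2))).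
      by rewrite le_eqVlt; apply/orP; left; apply/eqP; rewrite /q /A; field; rewrite gt_eqF.
    by rewrite lerDl mulr_ge0 ?exprn_ge0 ?divr_ge0 ?(ltW th0) ?(ltW n0) // form_ge0.
  move=> H2; apply: (@variance_bound q A Q L th x _) => //.
  - rewrite -(ler_pM2l (exprn_gt0 2 n0)); apply: (le_trans H1).
    rewrite -(ler_pM2l (exprn_gt0 2 (etrans (invr_gt0 _) thL))).
    apply: (le_trans (H2 _)) => [y|]; last first.
      rewrite le_eqVlt; apply/orP; left; apply/eqP.
      by field; rewrite gt_eqF.
    have b0 : 0 <= th / n * D y by rewrite mulr_ge0 // divr_ge0 ?(ltW th0) ?(ltW n0).
    have b1 : th / n * D y <= th * L by rewrite mulrAC ler_pdivrMr // -mulrA ler_pM2l.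
    rewrite mulr_ge0 ?invr_ge0 ?(ltW thL) ?addr_ge0 //=.
    by rewrite -[leRHS](@mulVf _ (1 + th * L)) ?gt_eqF // ler_wpM2l ?invr_ge0 ?(ltW thL) // lerD2l.
  - by rewrite /q ler_pdivlMr ?exprn_gt0 // -f1.
  - by rewrite /q divr_ge0 ?exprn_ge0 ?(ltW n0) // sumr_ge0.
  - rewrite /q ler_pdivrMr ?exprn_gt0 // -f1; apply: (le_trans (form_le _ _)) => //.
    by rewrite sumr_const.
  - exact: ltW.
  - by rewrite /x divfK ?gt_eqF.
set B := [set y | _].
have : \sum_(y in B) nu ^+ 2 * n ^+ 2 <= n ^+ 3 * nu ^+ 3.
  apply: (@le_trans _ _ (\sum_y (Q * n - D y) ^+ 2)).
    rewrite [leRHS](bigID (mem B)) /= -[leLHS]addr0 lerD //; last first.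
      by apply: sumr_ge0 => y _; rewrite sqr_ge0.
    apply: ler_sum => y; rewrite inE => yB; rewrite -exprMn.
    have lt : nu * n <= Q * n - D y by rewrite /D; lra.
    rewrite lerXn2r ?nnegrE ?mulr_ge0 ?(ltW nu0) ?(ltW n0) //.
    by apply: le_trans lt; rewrite mulr_ge0 ?(ltW nu0) ?(ltW n0).
  have -> : \sum_y (Q * n - D y) ^+ 2 = n ^+ 3 * (A - 2 * Q * q + Q ^+ 2).
    transitivity (\sum_(y : V) ((Q * n) ^+ 2 - 2 * Q * n * D y + D y ^+ 2)).
      by apply: eq_bigr => y _; ring.
    rewrite big_split sumrB sumr_const -big_distrr /= -/S1 -/S2 -mulr_natl -/n /q /A.
    by field; rewrite gt_eqF.
  by rewrite ler_wpM2l // exprn_ge0 // ltW.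
rewrite sumr_const -[leLHS]mulr_natl => H.
rewrite -(ler_pM2r (mulr_gt0 (exprn_gt0 2 nu0) (exprn_gt0 2 n0))).
by apply: (le_trans H); rewrite le_eqVlt; apply/orP; left; apply/eqP; ring.
Qed.

(* [Some (Some i)] are the indices of the sample, [None] and [Some None] those of
   a pair of further vertices. *)
Lemma sample (gam eps : R) : 0 < gam -> 0 < eps ->
  exists m (nu eta x : R), [/\ 0 < nu, 0 < eta, 0 < x, (0 < m)%N &
  forall (V : finType) (tau : V -> V -> {set 'I_s}) (Low : {set V}), pairing tau -> (0 < #|V|)%N ->
  #|Low|%:R <= nu * #|V|%:R -> (Q - x) * #|V|%:R ^+ 2 <= form tau (fun=> 1) ->
  #|invalid (option (option 'I_m)) tau|%:R <= eta * #|V|%:R ^+ #|{: option (option 'I_m)}| ->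
  exists F : {ffun option (option 'I_m) -> V},
  [/\ forall i, F (Some (Some i)) \notin Low,
      valid k (fun i j : 'I_m => tau (F (Some (Some i))) (F (Some (Some j)))),
      Q - gam < form (fun i j : 'I_m => tau (F (Some (Some i))) (F (Some (Some j)))) (fun=> m%:R^-1) &
      #|[set p : V * V | upd (upd F None p.1) (Some None) p.2 \in invalid _ tau]|%:R <= eps * #|V|%:R ^+ 2]].
Proof.
move=> gam0 eps0; have Q0 : 0 <= Q by exact: Q_ge0.
have L0 := L_ge0.
(* Coincidences among the sampled indices cost at most $Q/m$ of the value. *)
pose m := (Num.truncn (8 * Q / gam)).+1.
have mQ : Q / m%:R <= gam / 8.
  have : 8 * Q / gam < m%:R by exact: truncnS_gt.
  by rewrite ltr_pdivrMr // => H; rewrite ler_pdivrMr //; lra.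
pose C := eps^-1 + L / gam + 1.
have Lg : 0 <= L / gam by rewrite divr_ge0 // ltW.
have e0 : 0 < eps^-1 by rewrite invr_gt0.
have C0 : 0 < C by rewrite /C; lra.
have Ceps : eps^-1 <= C by rewrite /C; lra.
have CL : L / gam + 1 <= C by rewrite /C; lra.
exists m, (4 * m%:R)^-1, (4 * C)^-1, (gam / 8).
split; rewrite ?invr_gt0 ?divr_gt0 ?mulr_gt0 //.
move=> V tau Low tp V0 lowV fQ inv; set n : R := #|V|%:R in lowV fQ inv *.
have n0 : 0 < n by rewrite ltr0n.
have n20 : 0 < n ^+ 2 by rewrite exprn_gt0.
pose N : R := #|{ffun option (option 'I_m) -> V}|%:R.
have NE : N = n ^+ #|{: option (option 'I_m)}| by rewrite /N card_ffun natrX.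
have N0 : 0 < N by rewrite NE exprn_gt0.
pose ss (i : 'I_m) : option (option 'I_m) := Some (Some i).
pose pS (F : {ffun option (option 'I_m) -> V}) (i j : 'I_m) := tau (F (ss i)) (F (ss j)).
have pSp F : pairing (pS F) by exact: (comp_pairing (F \o ss) tp).
pose qS F : R := form (pS F) (fun=> m%:R^-1).
pose bad (F : {ffun option (option 'I_m) -> V}) := [set p : V * V | upd (upd F None p.1) (Some None) p.2 \in invalid _ tau].
(* One penalty for all requirements: its mean is below 1, and a tuple with penalty below 1 meets
   each of them. *)
pose pen F : R := (Q - qS F) / gam + (\sum_i (F (ss i) \in Low)%:R + C / n ^+ 2 * #|bad F|%:R).
have sumbad : \sum_F C / n ^+ 2 * #|bad F|%:R <= N / 4.
  rewrite -big_distrr /=.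
  have -> : \sum_F #|bad F|%:R = n ^+ 2 * #|invalid (option (option 'I_m)) tau|%:R :> R.
    rewrite -sum_mem_card natr_sum -(resample2 None (Some None)) ?eqxx //.
    apply: eq_bigr => F _; rewrite (pair_bigA _ (fun x y => (upd (upd F None x) (Some None) y \in invalid _ tau)%:R)) /=.
    by rewrite -natr_sum -sum_mem_card; congr (_%:R); apply: eq_bigr => -[x y] _; rewrite inE.
  rewrite mulrA divfK ?gt_eqF // mulrC -ler_pdivlMr // (le_trans inv) // -NE le_eqVlt.
  by apply/orP; left; apply/eqP; field; rewrite gt_eqF.
clear inv NE.
have sumlow : \sum_(F : {ffun option (option 'I_m) -> V}) \sum_i (F (ss i) \in Low)%:R <= N / 4.
  rewrite exchange_big /=.
  have E i : \sum_(F : {ffun option (option 'I_m) -> V}) (F (ss i) \in Low)%:R <= N / (4 * m%:R).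
    rewrite -(ler_pM2l n0) (sum_ffun1 (ss i) (fun x => (x \in Low)%:R)) -natr_sum sum_mem_card.
    by rewrite -/N mulrCA ler_pM2l // mulrC.
  apply: (le_trans (ler_sum _ (fun i _ => E i))); rewrite sumr_const card_ord -mulr_natl le_eqVlt.
  by apply/orP; left; apply/eqP; field; rewrite gt_eqF.
have sumq : N * (Q - gam / 4) <= \sum_F qS F.
  have -> : \sum_F qS F = m%:R^-1 ^+ 2 * \sum_F \sum_i \sum_(j | j != i) weight (pS F i j).
    rewrite big_distrr; apply: eq_bigr => F _; rewrite /qS form_offdiag // big_distrr.
    apply: eq_bigr => i _; rewrite big_distrr /=; apply: eq_bigr => j _.
    by rewrite expr2.
  have E : n ^+ 2 * \sum_F \sum_i \sum_(j | j != i) weight (pS F i j) = N * form tau (fun=> 1) * (m * (m - 1))%:R.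
    rewrite exchange_big big_distrr /=.
    transitivity (\sum_(i : 'I_m) \sum_(j | j != i) N * form tau (fun=> 1)).
      apply: eq_bigr => i _; rewrite exchange_big big_distrr /=.
      apply: eq_bigr => j ji; rewrite /pS (sum_ffun2 (fun x y => weight (tau x y))); last first.
        by rewrite /ss; apply: contra_neq ji => -[].
      by congr (_ * _); apply: eq_bigr => x _; apply: eq_bigr => y _; rewrite !mul1r.
    rewrite (eq_bigr (fun=> N * form tau (fun=> 1) * (m - 1)%:R)); last first.
      move=> i _; rewrite sumr_const [RHS]mulr_natr subn1; congr (_ *+ _).
      by rewrite -[X in X.-1](card_ord m) -(cardC1 i); apply: eq_card.
    by rewrite sumr_const card_ord -[LHS]mulr_natr -mulrA -natrM mulnC.
  rewrite -(ler_pM2l n20) mulrCA [leRHS]mulrCA E.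
  have H1 : N * (n ^+ 2 * (Q - gam / 8)) * (m * (m - 1))%:R <= N * form tau (fun=> 1) * (m * (m - 1))%:R.
    by rewrite ler_wpM2r // ler_pM2l // mulrC.
  have m2 : 0 <= m%:R^-1 ^+ 2 :> R by rewrite exprn_ge0 // invr_ge0.
  apply: le_trans (ler_wpM2l m2 H1).
  have m1E : (m - 1)%:R = m%:R - 1 :> R by rewrite natrB.
  rewrite natrM m1E.
  have -> : m%:R^-1 ^+ 2 * (N * (n ^+ 2 * (Q - gam / 8)) * (m%:R * (m%:R - 1))) =
    N * (n ^+ 2 * ((Q - gam / 8) - (Q - gam / 8) / m%:R)) by field; rewrite gt_eqF.
  rewrite ler_pM2l // ler_pM2l //.
  have : (Q - gam / 8) / m%:R <= Q / m%:R by rewrite ler_pM2r ?invr_gt0 // gerBl divr_ge0 // ltW.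
  lra.
have [F penF] : exists F, pen F < 1.
  apply: contrapT => /forallNP H.
  have : \sum_(F : {ffun option (option 'I_m) -> V}) 1 <= \sum_F pen F.
    by apply: ler_sum => F _; rewrite leNgt; apply/negP; exact: H.
  rewrite sumr_const -/N /pen big_split big_split /= -big_distrl sumrB sumr_const /=.
  rewrite -[Q *+ _]mulr_natl -/N => H1.
  have H2 : (N * Q - \sum_F qS F) / gam <= N / 4.
    by rewrite ler_pdivrMr //; lra.
  lra.
have qSL : qS F <= L.
  apply: (le_trans (form_le _ _)) => [i|]; first by rewrite invr_ge0.
  by rewrite sumr_const card_ord -[X in L * X ^+ 2]mulr_natl divff ?expr1n ?mulr1 // gt_eqF.
have low0 : 0 <= \sum_i (F (ss i) \in Low)%:R :> R by apply: sumr_ge0.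
have bad0 : 0 <= C / n ^+ 2 * #|bad F|%:R by rewrite mulr_ge0 // divr_ge0 ?(ltW C0) ?(ltW n20).
(* An invalid sample makes every pair of further vertices bad, which costs [C]; this outweighs the
   first term of the penalty, which is at least [- L / gam]. *)
have vF : valid k (pS F).
  apply: contraTT penF => nv; rewrite -leNgt /pen.
  have -> : #|bad F|%:R = n ^+ 2.
    rewrite /n -natrX -mulnn -card_prod -cardsT; congr (_%:R); apply: eq_card => -[x y].
    rewrite !inE; apply: contraNN nv => /(valid_comp ss); congr is_true; apply: valid_eq => i j.
    by rewrite /pS !ffunE.
  rewrite divfK ?gt_eqF //.
  have : (Q - L) / gam <= (Q - qS F) / gam by rewrite ler_pM2r ?invr_gt0 // lerD2l lerN2.
  rewrite mulrBl; have : 0 <= Q / gam by rewrite divr_ge0 // ltW.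
  lra.
have qSQ : qS F <= Q.
  apply: (le_trans (form_le_Q (pSp F) vF _)) => [i|]; first by rewrite invr_ge0.
  by rewrite sumr_const card_ord -[X in Q * X ^+ 2]mulr_natl divff ?expr1n ?mulr1 // gt_eqF.
have q0 : 0 <= (Q - qS F) / gam by rewrite divr_ge0 ?subr_ge0 // ltW.
exists F; split=> //.
- move=> i; apply: contraTN penF => Fi; rewrite -leNgt /pen.
  have : 1 <= \sum_i (F (ss i) \in Low)%:R :> R.
    by rewrite (bigD1 i) //= Fi lerDl sumr_ge0.
  lra.
- have : (Q - qS F) / gam < 1 by apply: le_lt_trans penF; rewrite /pen; lra.
  by rewrite ltr_pdivrMr // mul1r /qS /pS /ss; lra.
- have : C / n ^+ 2 * #|bad F|%:R < 1 by apply: le_lt_trans penF; rewrite /pen; lra.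
  rewrite mulrAC ltr_pdivrMr // mul1r => H.
  rewrite -ler_pdivrMl //; apply: le_trans (ltW H).
  by rewrite ler_wpM2r.
Qed.

End Sampling.

Section Structure.
Variables (R : realType) (s : nat) (k : 'I_s -> nat).
Hypothesis (k2 : forall c, (2 <= k c)%N).
Variable (c1 : 'I_s).
Hypothesis (kmax : forall c, (k c <= k c1)%N).
Hypothesis hext : extension_property R k.
Local Notation weight := (@weight R s).
Local Notation Q := (Q R k).
Local Notation L := (log2 (s%:R : R)).

(** A pair of strictly smaller weight cannot be excluded by looking at it alone; such pairs turn out
    to be few because the form is nearly optimal. *)
Definition good_pair (V : finType) (tau : V -> V -> {set 'I_s}) r (phi : pattern r s)
    (lam : V -> 'I_r) (y y' : V) : Prop :=
  (lam y != lam y' -> tau y y' = pcol phi (lam y) (lam y') \/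
     weight (tau y y') < weight (pcol phi (lam y) (lam y'))) /\
  (lam y = lam y' -> (#|tau y y'| <= 1)%N /\
     (tau y y' != set0 -> [/\ ~ strong_extension_property R k, tau y y' = [set c1] &
       forall g h, g != h -> c1 \in pcol phi g h])).

(** Let [y] take the place of the vertex [lam y] and attach [y'], which looks like [lam y'] except
    on the pair $yy'$. The value differs from [Q] by a positive multiple of the weight of $yy'$
    minus the weight in [phi]. As it cannot exceed [Q], this bounds the colours of $yy'$; in the
    case of equality the extension property determines them. *)
Lemma good_pair_ext (V : finType) (tau : V -> V -> {set 'I_s}) r (phi : pattern r s)
    (al : 'rV[R]_r) (lam : V -> 'I_r) (y y' : V) (colp : 'I_r -> {set 'I_s}) :
  opt_star k phi al -> valid k (extp phi colp) -> colp (lam y) = tau y y' ->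
  (forall l, l != lam y -> l != lam y' -> colp l = pcol phi (lam y') l) ->
  (lam y != lam y' -> (#|colp (lam y')| <= 1)%N) -> good_pair tau phi lam y y'.
Proof.
rewrite /good_pair => oal vc; move: (lam y) (lam y') => i j ci cl cj.
have [fe qQ al0] := oal; have [/PhiP[vphi phi2] sal] := fe.
have pp := pcol_pairing phi.
have base : \sum_l al 0 l * weight (colp l) =
    Q + al 0 i * (weight (tau y y') - weight (pcol phi j i)).
  rewrite -(lagrange k2 oal j) /deg (bigD1 i) //= [in RHS](bigD1 i) //= ci.
  rewrite (eq_bigr (fun l => al 0 l * weight (pcol phi j l))); first by ring.
  move=> l li; have [lj|lj] := eqVneq l j; last by rewrite cl.
  subst l; rewrite pp.2 !weight_small ?cards0 // cj // eq_sym //.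
have le := ext_le_Q k2 sal qQ vc; rewrite base gerDl pmulr_rle0 // subr_le0 in le.
split=> [ij|ij].
  rewrite pp.1; move: le; rewrite le_eqVlt => /orP[/eqP eqw|]; last by right.
  left; rewrite eqw subrr mulr0 addr0 in base.
  have [j' [cj' cj1]] := ext_clone hext oal vc base.
  (* The new vertex can only be a clone of [lam y']: its pair with any other vertex of the triple
     carries at least two colours. *)
  have [j'i|j'i] := eqVneq j' i.
    move: cj1; rewrite j'i ci => /(@weight_small R); rewrite eqw => w0.
    have := @weight_lt R s set0 (pcol phi j i); rewrite w0 weight_small ?cards0 // ltxx.
    have ji : j != i by rewrite eq_sym.
    by move=> /(_ (phi2 _ _ ji) (ltnW (phi2 _ _ ji))).
  have [j'j|j'j] := eqVneq j' j; first by rewrite -ci cj' ?j'j.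
  by move: cj1; rewrite cl // leqNgt phi2 // eq_sym.
subst j; rewrite pp.2 [weight set0]weight_small ?cards0 // in le.
have t1 : (#|tau y y'| <= 1)%N.
  rewrite leqNgt; apply/negP => t1; have := @weight_lt R s set0 (tau y y') t1.
  by rewrite cards0 (ltnW t1) weight_small ?cards0 // ltNge le => /(_ isT).
split=> // t0.
have [|||h1 h2 h3] := weak_clone k2 kmax (j := i) oal vc; rewrite ?ci //.
  by move=> l li; rewrite cl.
by split=> //; rewrite -ci.
Qed.

Lemma structure (eps : R) : 0 < eps -> exists m M (eta x : R), [/\ 0 < eta, 0 < x &
  forall (V : finType) (tau : V -> V -> {set 'I_s}), pairing tau -> (0 < #|V|)%N ->
  (Q - x) * #|V|%:R ^+ 2 <= form tau (fun=> 1) ->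
  #|invalid k (option (option 'I_m)) tau|%:R <= eta * #|V|%:R ^+ #|{: option (option 'I_m)}| ->
  #|invalid k 'I_M tau|%:R <= eta * #|V|%:R ^+ M ->
  exists r (phi : pattern r s) (al : 'rV[R]_r) (lam : V -> 'I_r) (Bad : {set V * V}),
  [/\ opt_star k phi al, #|Bad|%:R <= eps * #|V|%:R ^+ 2 &
      forall y y', (y, y') \notin Bad -> good_pair tau phi lam y y']].
Proof.
move=> eps0; have Q0 : 0 <= Q by exact: Q_ge0.
have L0 := L_ge0 R s.
have [g1 g10 Hg1] := near_opt R k c1.
have [g2 g20 Hg2] := opt_constants k2 c1 hext ltr01.
pose eps1 := Num.min (eps / 6) (eps * g2 / (8 * (L + 1))).
have L1 : 0 < L + 1 by rewrite ltr_wpDl.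
have eps10 : 0 < eps1 by rewrite lt_min !divr_gt0 ?mulr_gt0.
have e1a : 6 * eps1 <= eps by rewrite mulrC -ler_pdivlMr // ge_min lexx.
have e1b : 8 * (L * eps1) <= eps * g2.
  have : eps1 <= eps * g2 / (8 * (L + 1)) by rewrite ge_min lexx orbT.
  rewrite ler_pdivlMr ?mulr_gt0 // => H; lra.
have [m [nu0 [eta0 [x0 [nu00 eta00 x00 m0 Hs]]]]] := sample k2 g10 eps10.
pose nu := Num.min nu0 (eps * g2 / 8).
have nuP : 0 < nu by rewrite lt_min nu00 divr_gt0 ?mulr_gt0.
have nua : nu <= nu0 by rewrite ge_min lexx.
have nub : 8 * nu <= eps * g2 by rewrite mulrC -ler_pdivlMr // ge_min lexx orbT.
have [x1 x10 Hl] := low_degree k2 nuP.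
pose M := (Num.truncn (2 * Q / x1)).+2.
have MQ : Q / (M - 1)%:R <= x1 / 2.
  have : 2 * Q / x1 < (M - 1)%:R by rewrite /M subSS subn0; exact: truncnS_gt.
  rewrite ltr_pdivrMr // => H; rewrite ler_pdivrMr; first by lra.
  by rewrite ltr0n.
pose eta := Num.min eta0 (x1 / (4 * (L + 1))).
exists m, M, eta, (Num.min x0 x1).
split; rewrite ?lt_min ?eta00 ?x00 ?divr_gt0 ?mulr_gt0 //.
move=> V tau tp V0 fQ inv1 inv2; have n0 : 0 < #|V|%:R :> R by rewrite ltr0n.
have n20 : 0 < #|V|%:R ^+ 2 :> R by rewrite exprn_gt0.
pose Low := [set y | deg tau (fun=> 1) y < (Q - nu) * #|V|%:R].
have lowV : #|Low|%:R <= nu * #|V|%:R.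
  apply: Hl => //; last first.
    by apply: le_trans fQ; rewrite ler_pM2r // lerD2l lerN2 ge_min lexx orbT.
  move=> g g01; have inv2' : #|invalid k 'I_M tau|%:R <= eta * #|V|%:R ^+ #|'I_M| by rewrite card_ord.
  apply: (le_trans (spread_form_le k2 tp _ V0 inv2' g01)); rewrite card_ord //.
  rewrite lerD2l ler_wpM2r ?(ltW n20) //.
  have : eta <= x1 / (4 * (L + 1)) by rewrite ge_min lexx orbT.
  rewrite ler_pdivlMr ?mulr_gt0 // => H.
  have eta_ge : 0 <= eta by rewrite le_min ltW //= divr_ge0 ?mulr_ge0 // ltW.
  clear -MQ H eta_ge x10; lra.
have [|||F [Flow vF qF badF]] := Hs V tau Low tp V0.
- by apply: (le_trans lowV); rewrite ler_pM2r.
- by apply: le_trans fQ; rewrite ler_pM2r // lerD2l lerN2 ge_min lexx.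
- by apply: (le_trans inv1); rewrite ler_wpM2r ?exprn_ge0 // ge_min lexx.
clear Hs Hl inv1 inv2 fQ.
have [||||r [e [phi [al [e_inj oal _ phiE]]]]] :=
  Hg1 'I_m (fun i j => tau (F (Some (Some i))) (F (Some (Some j)))) (fun=> m%:R^-1) _ vF.
- exact: (comp_pairing (fun i => F (Some (Some i))) tp).
- by move=> _; rewrite invr_ge0.
- by rewrite sumr_const card_ord -[LHS]mulr_natl divff // pnatr_eq0 -lt0n.
- exact: qF.
have [fe qQ al0] := oal; have [/PhiP[vphi phi2] [_ al1]] := fe.
have pp := pcol_pairing phi.
have [_ gap2 _] := Hg2 _ _ _ oal.
set Bd := [set p : V * V | _] in badF.
pose col1 y i := tau (F (Some (Some (e i)))) y.
have F'ss y y' i : upd (upd F None y) (Some None) y' (Some (Some i)) = F (Some (Some i)) by rewrite !ffunE.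
have F'a y y' : upd (upd F None y) (Some None) y' None = y by rewrite !ffunE.
have F'b y y' : upd (upd F None y) (Some None) y' (Some None) = y' by rewrite !ffunE.
have vBd y y' : (y, y') \notin Bd ->
    valid k (fun i j => tau (upd (upd F None y) (Some None) y' i) (upd (upd F None y) (Some None) y' j)).
  by rewrite !inE negbK.
have v1 y0 y : (y0, y) \notin Bd -> valid k (extp phi (col1 y)).
  move=> /vBd v; pose h x := if x is Some l then Some (Some (e l)) else Some None : option (option 'I_m).
  move: (valid_comp h v); congr is_true; apply/esym; apply: valid_eq.
  move=> [a|] [b|] /=; rewrite ?F'ss ?F'b //.
    by rewrite /col1 tp.1.
  by rewrite tp.2.
(* For [y] outside [Z] some partner gives a valid tuple, which certifies the extension by [y]
   alone. *)
pose Z := [set y | [forall y0, (y0, y) \in Bd]].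
have Zn : #|Z|%:R <= eps1 * #|V|%:R.
  rewrite -(ler_pM2r n0) -mulrA -expr2; apply: le_trans badF.
  rewrite -natrM ler_nat mulnC -cardsT -cardsX; apply: subset_leq_card.
  by apply/fintype.subsetP => -[a b]; rewrite in_setX inE /= inE => /forallP/(_ a).
have nZ y : y \notin Z -> exists y0, (y0, y) \notin Bd.
  by rewrite inE negb_forall => /existsP.
pose P y j := [forall i, (i != j) ==> (col1 y i == pcol phi j i)] && (#|col1 y j| <= 1)%N.
pose D := [set y | ~~ [exists j, P y j]].
pose ex y := \sum_i al 0 i * weight (col1 y i).
have exL y : ex y <= L.
  rewrite /ex -[leRHS]mul1r -[X in X * _]al1 big_distrl; apply: ler_sum => i _.
  by rewrite ler_pM2l // weight_le.
have exQ y : ex y <= Q - g2 * (y \in D)%:R + (L + g2) * (y \in Z)%:R.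
  have [yZ|yZ] := boolP (y \in Z).
    rewrite mulr1; have := exL y; have : g2 * (y \in D)%:R <= g2 by rewrite ler_piMr ?(ltW g20) // lern1 leq_b1.
    clear -Q0; lra.
  have [y0 /v1 v] := nZ _ yZ; rewrite mulr0 addr0.
  have [yD|yD] := boolP (y \in D); last by rewrite mulr0 subr0; exact: (ext_le_Q k2 fe.2 qQ v).
  rewrite mulr1 leNgt; apply/negP => /(gap2 _ v) eQ.
  have [j [cj cj1]] := ext_clone hext oal v eQ.
  move: yD; rewrite inE => /negP; apply; apply/existsP; exists j; rewrite /P cj1 andbT.
  by apply/forallP => i; apply/implyP => ij; rewrite cj.
have Dn : #|D|%:R <= (nu + (L + g2) * eps1) / g2 * #|V|%:R.
  (* Exchanging the sums gives a weighted mean of the degrees of vertices outside [Low]. Together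
     with the pointwise bound [exQ] this leaves few vertices in [D]. *)
  have : (Q - nu) * #|V|%:R <= \sum_y ex y.
    rewrite /ex exchange_big /=.
    apply: (@le_trans _ _ (\sum_i al 0 i * ((Q - nu) * #|V|%:R))).
      by rewrite -big_distrl /= al1 mul1r.
    apply: ler_sum => i _; rewrite -big_distrr ler_pM2l //=.
    have := Flow (e i); rewrite inE -leNgt => H; apply: (le_trans H).
    by rewrite /deg; apply: ler_sum => y _; rewrite mul1r.
  move=> H; have := le_trans H (ler_sum _ (fun y _ => exQ y)).
  rewrite big_split sumrB sumr_const -!big_distrr -!natr_sum !sum_mem_card /= -[Q *+ _]mulr_natr.
  move=> H2; rewrite mulrAC ler_pdivlMr //.
  have : (L + g2) * #|Z|%:R <= (L + g2) * (eps1 * #|V|%:R) by rewrite ler_wpM2l // addr_ge0 // ltW.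
  clear -H2; lra.
have [i0 _] : exists i : 'I_r, true.
  apply: contrapT => /forallNP H; move: al1; rewrite big1 => [|i _]; last by have := H i.
  by move/eqP; rewrite eq_sym oner_eq0.
pose lam y := odflt i0 [pick j | P y j].
have lamP y : y \notin D -> P y (lam y).
  rewrite inE negbK => /existsP[j Pj]; rewrite /lam; case: pickP => [//|/(_ j)].
  by rewrite Pj.
exists r, phi, al, lam, (Bd :|: (setX D setT :|: setX setT D)); split=> //.
  apply: (@le_trans _ _ (eps1 * #|V|%:R ^+ 2 + 2 * (#|D|%:R * #|V|%:R))).
    apply: (@le_trans _ _ (#|Bd|%:R + 2 * (#|D|%:R * #|V|%:R))); last by rewrite lerD2r.
    rewrite -!natrM -natrD ler_nat; apply: leq_trans (leq_card_setU _ _) _; rewrite leq_add2l.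
    by apply: leq_trans (leq_card_setU _ _) _; rewrite !cardsX !cardsT mul2n -addnn leq_add // mulnC.
  have e2 : #|D|%:R <= 5 / 12 * eps * #|V|%:R.
    apply: (le_trans Dn); rewrite ler_wpM2r ?(ltW n0) // ler_pdivrMr //.
    have := ler_wpM2r (ltW g20) e1a; clear -nub e1b; lra.
  have := ler_wpM2r (ltW n0) e2; have := ler_wpM2r (ltW n20) e1a.
  clear; rewrite expr2; lra.
move=> y y'; rewrite !in_setU !in_setX !in_setT /= andbT => /norP[yBd /norP[yD y'D]].
have vyy := vBd _ _ yBd.
have /andP[/forallP Py Py1] := lamP _ yD.
have /andP[/forallP Py' Py'1] := lamP _ y'D.
(* The colours of [y'] to the triple in which [y] replaces the vertex [lam y]; being a clone, [y]
   sees the other vertices of the triple as [lam y] does. *)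
pose colp l := if l == lam y then tau y y' else col1 y' l.
apply: (@good_pair_ext _ _ _ phi al lam y y' colp oal).
- pose h x := if x is Some l then (if l == lam y then None else Some (Some (e l))) else Some None : option (option 'I_m).
  move: (valid_comp h vyy); congr is_true; apply/esym; apply: valid_eq.
  have H l : l != lam y -> pcol phi (lam y) l = tau y (F (Some (Some (e l)))).
    by move=> ly; have /implyP/(_ ly)/eqP <- := Py l; rewrite /col1 tp.1.
  move=> [a|] [b|] /=; rewrite ?F'b ?tp.2 //.
  + case: (eqVneq a (lam y)) => [->|ay]; case: (eqVneq b (lam y)) => [->|by_]; rewrite ?F'ss ?F'a ?pp.2 ?tp.2 //.
      exact: H.
    by rewrite pp.1 H // tp.1.
  + by rewrite /colp; case: ifP => _; rewrite ?F'ss ?F'a // tp.1.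
  + by rewrite /colp; case: ifP => _; rewrite ?F'ss ?F'a // tp.1.
- by rewrite /colp eqxx.
- by move=> l ly ly'; rewrite /colp (negPf ly); have /implyP/(_ ly')/eqP := Py' l.
- by move=> yy'; rewrite /colp eq_sym (negPf yy').
Qed.

End Structure.

(** * Correcting the sizes of the classes *)

(** Vertices are moved one at a time from an overfull class to one that is too small; each move
    lowers the total deficit by one. *)
Lemma relabel (V I : finType) (lam : V -> I) (m : I -> nat) : (\sum_i m i = #|V|)%N ->
  exists lam' : V -> I, (forall i, #|[set y | lam' y == i]| = m i) /\
    (#|[set y | lam y != lam' y]| <= \sum_i (m i - #|[set y | lam y == i]|))%N.
Proof.
move=> mV.
have sumc (l : V -> I) : (\sum_i #|[set y | l y == i]| = #|V|)%N.
  rewrite -sum1_card (partition_big l xpredT) //=.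
  by apply: eq_bigr => i _; rewrite -sum1_card; apply: eq_bigl => y; rewrite inE.
have [N] := ubnP (\sum_i (m i - #|[set y | lam y == i]|))%N.
elim: N lam => // N IHN lam; rewrite ltnS => lN.
have [[i ci]|nex] := pselect (exists i, (#|[set y | lam y == i]| < m i)%N); last first.
  have le i : (m i <= #|[set y | lam y == i]|)%N by rewrite leqNgt; apply/negP => H; apply: nex; exists i.
  exists lam; split; last by rewrite (_ : [set y | _] = set0) ?cards0 //; apply/setP => y; rewrite !inE eqxx.
  move=> i; have : (\sum_i m i == \sum_i #|[set y | lam y == i]|)%N by rewrite mV sumc.
  have := leqif_sum (fun i (_ : true) => leqif_eq (le i)) => /= H.
  by rewrite H => /forallP/(_ i)/eqP.
have [j cj] : exists j, (m j < #|[set y | lam y == j]|)%N.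
  apply: contrapT => /forallNP H.
  have : (\sum_i #|[set y | lam y == i]| < \sum_i m i)%N.
    rewrite (bigD1 i) //= [X in (_ < X)%N](bigD1 i) //= -addSn leq_add //.
    by apply: leq_sum => j _; rewrite leqNgt; apply/negP; exact: H.
  by rewrite mV sumc ltnn.
have ij : i != j by apply: contraTneq ci => ->; rewrite -leqNgt ltnW.
have /card_gt0P[y] : (0 < #|[set y | lam y == j]|)%N by apply: leq_ltn_trans cj.
rewrite inE => /eqP lyj.
pose lam1 z := if z == y then i else lam z.
have E1 : [set z | lam1 z == i] = y |: [set z | lam z == i].
  by apply/setP => z; rewrite !inE /lam1; case: (eqVneq z y) => _ /=; rewrite ?eqxx.
have E2 : [set z | lam1 z == j] = [set z | lam z == j] :\ y.
  by apply/setP => z; rewrite !inE /lam1; case: (eqVneq z y) => _ /=; rewrite ?(negPf ij).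
have E3 l : l != i -> l != j -> [set z | lam1 z == l] = [set z | lam z == l].
  move=> li lj; apply/setP => z; rewrite !inE /lam1; case: (eqVneq z y) => // ->.
  by rewrite lyj eq_sym (negPf li) eq_sym (negPf lj).
have c1 : #|[set z | lam1 z == i]| = #|[set z | lam z == i]|.+1.
  by rewrite E1 cardsU1 inE lyj eq_sym (negPf ij).
have c2 : #|[set z | lam z == j]| = #|[set z | lam1 z == j]|.+1.
  by rewrite E2 (cardsD1 y) inE lyj eqxx.
have S : (\sum_i (m i - #|[set y | lam y == i]|) = (\sum_i (m i - #|[set y | lam1 y == i]|)).+1)%N.
  rewrite (bigD1 i) //= [in RHS](bigD1 i) //= -addSn c1; congr (_ + _)%N; first by lia.
  apply: eq_bigr => l li; have [->|lj] := eqVneq l j; first by lia.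
  by rewrite E3.
have [|lam' [c' d']] := IHN lam1; first by rewrite -ltnS -S.
exists lam'; split=> //; rewrite S.
apply: (@leq_trans (#|[set z | lam1 z != lam' z]|).+1); last by rewrite ltnS.
have : [set z | lam z != lam' z] \subset y |: [set z | lam1 z != lam' z].
  by apply/fintype.subsetP => z; rewrite !inE /lam1; case: (eqVneq z y).
by move=> /subset_leq_card H; apply: (leq_trans H); rewrite cardsU1; case: (_ \notin _).
Qed.

(** Differences of truncated partial sums: the truncation errors lie in $[0,1)$, so two of them
    differ by less than 1. *)
Lemma rounding (R : realType) r (al : 'rV[R]_r) (n : nat) : simplex al ->
  exists m : 'I_r -> nat, (\sum_i m i = n)%N /\ forall i, `|(m i)%:R - al 0 i * n%:R| < 1.
Proof.
move=> [al0 al1].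
pose S (j : nat) : R := (\sum_(i < r | (i < j)%N) al 0 i) * n%:R.
have S0 j : 0 <= S j by rewrite mulr_ge0 // sumr_ge0.
have SS (i : 'I_r) : S i.+1 = S i + al 0 i * n%:R.
  rewrite /S -mulrDl; congr (_ * _); rewrite (bigD1 i) //= addrC; congr (_ + _).
  by apply: eq_bigl => j; rewrite ltnS andbC -(inj_eq val_inj) /= -ltn_neqAle.
have Smono : {homo S : i j / (i <= j)%N >-> i <= j}.
  move=> i j ij; rewrite /S ler_wpM2r //.
  rewrite [leRHS](bigID (fun l : 'I_r => (l < i)%N)) /=.
  rewrite (eq_bigl (fun l : 'I_r => (l < j)%N && (l < i)%N)) ?lerDl ?sumr_ge0 // => l.
  by apply/idP/andP => [li|[]//]; split=> //; exact: leq_trans ij.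
pose t j := Num.truncn (S j).
have tS j : (t j)%:R <= S j < (t j).+1%:R by exact: truncn_itv.
have tmono : {homo t : i j / (i <= j)%N >-> (i <= j)%N}.
  by move=> i j ij; apply: le_truncn; exact: Smono.
exists (fun i => (t i.+1 - t i)%N); split.
  rewrite -(big_mkord xpredT (fun i => (t i.+1 - t i)%N)) telescope_sumn //.
  have -> : t 0%N = 0%N by rewrite /t /S big_pred0 // mul0r truncn0.
  rewrite subn0 /t /S (eq_bigl xpredT) => [|i]; last by rewrite ltn_ord.
  by rewrite al1 mul1r natrK.
move=> i; rewrite natrB; last by apply: tmono.
have := tS i; have := tS i.+1; rewrite SS -!natr1 => /andP[h1 h2] /andP[h3 h4].
by rewrite ltr_norml; apply/andP; split; lra.
Qed.

Lemma card_fibres (T I : finType) (f : T -> I) (A : {set T}) :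
  #|A| = (\sum_i #|[set x in A | f x == i]|)%N.
Proof.
rewrite -sum1_card (partition_big f xpredT) //=; apply: eq_bigr => i _.
by rewrite -sum1_card; apply: eq_bigl => x; rewrite inE.
Qed.

Section Stability.
Variables (R : realType) (s : nat) (k : 'I_s -> nat).
Hypothesis (k2 : forall c, (2 <= k c)%N).
Variable (c1 : 'I_s).
Hypothesis (kmax : forall c, (k c <= k c1)%N).
Hypothesis hext : extension_property R k.
Local Notation weight := (@weight R s).
Local Notation Q := (Q R k).
Local Notation L := (log2 (s%:R : R)).

Lemma weight_gap : exists2 x : R, 0 < x & forall A B : {set 'I_s},
  weight A < weight B -> weight A <= weight B - x.
Proof.
have [||x x0 Hx] := @finite_uniform R ({set 'I_s} * {set 'I_s})%type
  (fun p x => weight p.1 < weight p.2 -> weight p.1 <= weight p.2 - x).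
- by move=> [A B] x y _ yx H /H /= h; lra.
- move=> [A B] /=; have [lt|_] := boolP (weight A < weight B); last by exists 1.
  by exists (weight B - weight A); [rewrite subr_gt0 | rewrite subKr].
- by exists x => // A B; exact: (Hx (A, B)).
Qed.

Lemma form_labels (V : finType) r (p : 'I_r -> 'I_r -> {set 'I_s}) (lam : V -> 'I_r) :
  \sum_y \sum_y' weight (p (lam y) (lam y')) = form p (fun i => #|[set y | lam y == i]|%:R : R).
Proof.
have E (F : 'I_r -> R) : \sum_y F (lam y) = \sum_i #|[set y | lam y == i]|%:R * F i.
  rewrite (partition_big lam xpredT) //=; apply: eq_bigr => i _.
  rewrite (eq_bigr (fun=> F i)) => [|y /eqP -> //]; rewrite sumr_const mulr_natl; congr (_ *+ _).
  by apply: eq_card => y; rewrite inE.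
rewrite (E (fun i => \sum_y' weight (p i (lam y')))) form_deg; apply: eq_bigr => i _.
by rewrite (E (fun j => weight (p i j))).
Qed.

Lemma sum_card (V : finType) r (lam : V -> 'I_r) :
  \sum_i #|[set y | lam y == i]|%:R = #|V|%:R :> R.
Proof.
rewrite -natr_sum -cardsT (card_fibres lam); congr (_%:R).
by apply: eq_bigr => i _; apply: eq_card => y; rewrite !inE.
Qed.

(** The form is at most $n^2$ times the value [q] of the class proportions, minus a fixed loss for
    each mismatched pair outside [Bad], plus $L$ for each pair in [Bad]. Being nearly $Qn^2$, it
    forces mismatches to be rare and, by uniqueness of the optimal weights, the proportions to be
    close to [al]; adjusting the class sizes then moves few vertices. *)
Lemma stability (eps : R) : 0 < eps -> exists m M n0 (eta x : R), [/\ 0 < eta, 0 < x &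
  forall (V : finType) (tau : V -> V -> {set 'I_s}), pairing tau -> (0 < #|V|)%N -> (n0 <= #|V|)%N ->
  (Q - x) * #|V|%:R ^+ 2 <= form tau (fun=> 1) ->
  #|invalid k (option (option 'I_m)) tau|%:R <= eta * #|V|%:R ^+ #|{: option (option 'I_m)}| ->
  #|invalid k 'I_M tau|%:R <= eta * #|V|%:R ^+ M ->
  exists r (phi : pattern r s) (al : 'rV[R]_r) (lam : V -> 'I_r),
  [/\ opt_star k phi al, forall i, `|#|[set y | lam y == i]|%:R - al 0 i * #|V|%:R| < 1,
    #|[set p : V * V | (lam p.1 != lam p.2) && (tau p.1 p.2 != pcol phi (lam p.1) (lam p.2))]|%:R
      <= eps * #|V|%:R ^+ 2 &
    #|[set p : V * V | (lam p.1 == lam p.2) && (tau p.1 p.2 != set0)]|%:R <= eps * #|V|%:R ^+ 2 \/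
    [/\ ~ strong_extension_property R k, forall g h, g != h -> c1 \in pcol phi g h &
      #|[set p : V * V | (lam p.1 == lam p.2) && ~~ (tau p.1 p.2 \subset [set c1])]|%:R <= eps * #|V|%:R ^+ 2]]].
Proof.
move=> eps0; have Q0 : 0 <= Q by exact: Q_ge0.
have L0 := L_ge0 R s; have L1 : 0 < L + 1 by rewrite ltr_wpDl.
have [r0 Hr0] := rank_bound k c1.
have [g3 g30 Hg3] := weight_gap.
(* At most [r0] classes will be corrected, each by at most [2 * eps4] times the number of
   vertices. *)
pose eps4 := eps / (16 * (r0 + 1)%:R).
have eps40 : 0 < eps4 by rewrite divr_gt0 ?mulr_gt0 ?ltr0n ?addn1.
have eps4r : 16 * (r0%:R * eps4) <= eps.
  have : 16 * ((r0 + 1)%:R * eps4) = eps.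
    have : (r0 + 1)%:R != 0 :> R by rewrite pnatr_eq0 addn1.
    by rewrite /eps4; move: (r0 + 1)%:R => w w0; field.
  by rewrite natrD => H; lra.
have [x4 x40 Hx4] := opt_constants k2 c1 hext eps40.
pose T := Num.min (x4 / 2) (g3 * eps / 2).
have T0 : 0 < T by rewrite lt_min !divr_gt0 ?mulr_gt0.
have T1 : 2 * T <= x4 by rewrite mulrC -ler_pdivlMr // ge_min lexx.
have T2 : 2 * T <= g3 * eps by rewrite mulrC -ler_pdivlMr // ge_min lexx orbT.
pose eps2 := Num.min (eps / 4) (T / (2 * (L + 1))).
have eps20 : 0 < eps2 by rewrite lt_min !divr_gt0 ?mulr_gt0.
have e2a : 4 * eps2 <= eps by rewrite mulrC -ler_pdivlMr // ge_min lexx.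
have e2b : 2 * (L * eps2) <= T.
  have : eps2 <= T / (2 * (L + 1)) by rewrite ge_min lexx orbT.
  rewrite ler_pdivlMr ?mulr_gt0 // => H; lra.
have [m [M [eta [x [eta0 x0 Hst]]]]] := structure k2 kmax hext eps20.
exists m, M, (Num.truncn eps4^-1).+1, eta, (Num.min x (T / 4)).
split; rewrite ?lt_min ?x0 ?divr_gt0 //.
move=> V tau tp V0 Vn0 fQ inv1 inv2; have n0 : 0 < #|V|%:R :> R by rewrite ltr0n.
have n20 : 0 < #|V|%:R ^+ 2 :> R by rewrite exprn_gt0.
have fQx : (Q - x) * #|V|%:R ^+ 2 <= form tau (fun=> 1).
  by apply: le_trans fQ; rewrite ler_pM2r // lerD2l lerN2 ge_min lexx.
have fQT : (Q - T / 4) * #|V|%:R ^+ 2 <= form tau (fun=> 1).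
  by apply: le_trans fQ; rewrite ler_pM2r // lerD2l lerN2 ge_min lexx orbT.
have [r [phi [al [lam [Bad [oal BadV good]]]]]] := Hst V tau tp V0 fQx inv1 inv2.
clear Hst inv1 inv2 fQ fQx.
have eps4n : 1 <= eps4 * #|V|%:R.
  rewrite mulrC -ler_pdivrMr // mul1r; apply: (@le_trans _ _ (Num.truncn eps4^-1).+1%:R).
    by apply: ltW; exact: truncnS_gt.
  by rewrite ler_nat.
have [fe qQ al0] := oal; have [/PhiP[vphi phi2] sal] := fe.
have pp := pcol_pairing phi.
have rr0 : (r <= r0)%N.
  rewrite -[r]card_ord; apply: Hr0 pp vphi _ => i j ij.
  by rewrite -card_gt0 (leq_trans _ (phi2 _ _ ij)).
pose MS := [set p : V * V | (p \notin Bad) && ((lam p.1 != lam p.2) && (tau p.1 p.2 != pcol phi (lam p.1) (lam p.2)))].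
pose be : 'rV[R]_r := \row_i (#|[set y | lam y == i]|%:R / #|V|%:R).
have sbe : simplex be.
  split=> [i|]; first by rewrite mxE divr_ge0.
  by under eq_bigr do rewrite mxE; rewrite -big_distrl /= sum_card divff // gt_eqF.
have qbe : form (pcol phi) (fun i => #|[set y | lam y == i]|%:R : R) = #|V|%:R ^+ 2 * q phi be.
  rewrite q_form -form_scale; apply: eq_form => // i.
  by rewrite mxE mulrC divfK // gt_eqF.
have key : (Q - T / 4) * #|V|%:R ^+ 2 <= #|V|%:R ^+ 2 * q phi be - g3 * #|MS|%:R + L * #|Bad|%:R.
  apply: (le_trans fQT).
  rewrite -qbe -form_labels /form (pair_bigA _ (fun y y' => weight (pcol phi (lam y) (lam y')))).
  rewrite (pair_bigA _ (fun y y' => 1 * 1 * weight (tau y y'))) /=.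
  rewrite -!sum_mem_card !natr_sum !big_distrr -sumrB -big_split /=.
  apply: ler_sum => -[y y'] _ /=; rewrite !mul1r.
  have [yB|yB] := boolP ((y, y') \in Bad).
    rewrite !inE yB /= mulr0 subr0 mulr1; apply: (le_trans (weight_le _ _)).
    by rewrite lerDr weight_ge0.
  rewrite mulr0 addr0 !inE yB /=.
  have [h1 h2] := good _ _ yB.
  have [ll|ll] := eqVneq (lam y) (lam y') => /=.
    have [t1 _] := h2 ll; rewrite mulr0 subr0 weight_small //; exact: weight_ge0.
  have [->|ht] := h1 ll; first by rewrite eqxx mulr0 subr0.
  case: eqP => [e|_] /=; first by rewrite e ltxx in ht.
  by rewrite mulr1; exact: Hg3.
have LB : L * #|Bad|%:R <= T / 2 * #|V|%:R ^+ 2.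
  apply: (@le_trans _ _ (L * (eps2 * #|V|%:R ^+ 2))); first by rewrite ler_wpM2l.
  by rewrite mulrA ler_pM2r //; lra.
have qle : q phi be <= Q.
  by apply: feas_le_Q; split=> //; case: fe.
have MSn : #|MS|%:R <= eps / 2 * #|V|%:R ^+ 2.
  rewrite -(ler_pM2l g30).
  have := ler_wpM2l (ltW n20) qle; have := ler_wpM2r (ltW n20) T2.
  clear -key LB T0 n20; have : 0 <= T * #|V|%:R ^+ 2 by rewrite mulr_ge0 // ltW.
  lra.
have qbeQ : Q - x4 < q phi be.
  rewrite -(ltr_pM2r n20); have : 0 <= g3 * #|MS|%:R by rewrite mulr_ge0 // ltW.
  have := ler_wpM2r (ltW n20) T1; have : 0 < T * #|V|%:R ^+ 2 by rewrite mulr_gt0.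
  clear -key LB; lra.
have [_ _ /(_ be sbe qbeQ) bal] := Hx4 _ _ _ oal.
have [mi [smi mial]] := rounding #|V| sal.
have [lam' [cl' dl']] := relabel lam smi.
pose X := [set y | lam y != lam' y].
have Xn : #|X|%:R <= r0%:R * (2 * eps4 * #|V|%:R).
  have : #|X|%:R <= \sum_i (mi i - #|[set y | lam y == i]|)%:R :> R by rewrite -natr_sum ler_nat.
  move=> H; apply: (le_trans H).
  apply: (@le_trans _ _ (\sum_(i < r) 2 * eps4 * #|V|%:R)); last first.
    rewrite sumr_const card_ord -[leLHS]mulr_natl ler_wpM2r ?ler_nat //.
    by rewrite !mulr_ge0 // ltW.
  apply: ler_sum => i _.
  have [le|lt] := leqP (mi i) #|[set y | lam y == i]|.
    by move: (le); rewrite -subn_eq0 => /eqP ->; rewrite !mulr_ge0 // ltW.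
  rewrite natrB ?(ltnW lt) //.
  have := bal i; rewrite mxE ltr_norml => /andP[b1 _].
  have := mial i; rewrite ltr_norml => /andP[_ b2].
  have b3 : (al 0 i - eps4) * #|V|%:R <= #|[set y | lam y == i]|%:R.
    by rewrite -ler_pdivlMr //; lra.
  clear -b3 b2 eps4n; lra.
pose Bad' := Bad :|: (setX X setT :|: setX setT X).
have Bad'n : #|Bad'|%:R <= eps / 2 * #|V|%:R ^+ 2.
  apply: (@le_trans _ _ (eps2 * #|V|%:R ^+ 2 + 2 * (#|X|%:R * #|V|%:R))).
    apply: (@le_trans _ _ (#|Bad|%:R + 2 * (#|X|%:R * #|V|%:R))); last by rewrite lerD2r.
    rewrite -!natrM -natrD ler_nat; apply: leq_trans (leq_card_setU _ _) _; rewrite leq_add2l.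
    by apply: leq_trans (leq_card_setU _ _) _; rewrite !cardsX !cardsT mul2n -addnn leq_add // mulnC.
  have := ler_wpM2r (ltW n0) Xn; have := ler_wpM2r (ltW n20) e2a; have := ler_wpM2r (ltW n20) eps4r.
  clear; rewrite expr2; lra.
have Bad'n2 : #|Bad'|%:R <= eps * #|V|%:R ^+ 2.
  by have := mulr_gt0 eps0 n20; clear -Bad'n; lra.
have notBad' y y' : (y, y') \notin Bad' -> [/\ (y, y') \notin Bad, lam' y = lam y & lam' y' = lam y'].
  rewrite !in_setU !in_setX !in_setT /= andbT => /norP[yBd /norP[]].
  by rewrite !inE !negbK => /eqP -> /eqP ->.
exists r, phi, al, lam'; split=> //.
- by move=> i; rewrite cl'.
- apply: (@le_trans _ _ (#|MS|%:R + #|Bad'|%:R)); last by lra.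
  rewrite -natrD ler_nat; apply: leq_trans (leq_card_setU _ _); apply: subset_leq_card.
  apply/fintype.subsetP => -[y y']; rewrite in_setU orbC.
  have [//|/notBad'[yB e1 e2]] := boolP ((y, y') \in Bad').
  by rewrite !inE /= yB e1 e2.
(* A single pair outside [Bad'] with a colour inside a part yields the global statements of the
   second alternative. *)
have [[y [y' [yB ll t0]]]|nex] := pselect (exists y y', [/\ (y, y') \notin Bad', lam' y = lam' y' & tau y y' != set0]).
  right; have [yB' e1 e2] := notBad' _ _ yB; rewrite e1 e2 in ll.
  have [_ /(_ ll)[_ /(_ t0)[h1 h2 h3]]] := good _ _ yB'.
  split=> //; apply: (@le_trans _ _ #|Bad'|%:R); last exact: Bad'n2.
  rewrite ler_nat; apply: subset_leq_card; apply/fintype.subsetP => -[z z']; rewrite inE /=.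
  apply: contraTT => /[dup] /notBad'[zB e3 e4] zB'; rewrite negb_and negbK.
  have [/eqP zz|//] := boolP (lam' z == lam' z'); rewrite /=.
  have [->|t0'] := eqVneq (tau z z') set0; first by rewrite sub0set.
  by rewrite e3 e4 in zz; have [_ /(_ zz)[_ /(_ t0')[_ -> _]]] := good _ _ zB.
left; apply: (@le_trans _ _ #|Bad'|%:R); last exact: Bad'n2.
rewrite ler_nat; apply: subset_leq_card; apply/fintype.subsetP => -[z z']; rewrite inE /=.
apply: contraTT => zB; apply/negP => /andP[/eqP zz t0]; apply: nex.
by exists z, z'.
Qed.

End Stability.

(** * Counting colourings that follow a template *)

Section Counting.
Variables (R : realType) (s : nat) (c1 : 'I_s) (V : finType).
Variables (C : {set V} -> {set 'I_s}) (lam : R).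
Hypothesis C0 : forall e : {set V}, #|e| == 2 -> C e != set0.
Hypotheses (lam0 : 0 < lam) (lam1 : lam <= 1).
Local Notation n := (#|V|%:R : R).
Local Notation colour := {ffun {set V} -> 'I_s}.

Definition allowed_prod : R := \prod_(e : {set V} | #|e| == 2) #|C e|%:R.

Definition defect (psi : colour) : nat := #|[set e : {set V} | (#|e| == 2) && (psi e \notin C e)]|.

(** Functions on all subsets of [V] stand for colourings of pairs; fixing their values elsewhere
    keeps the count right. *)
Definition normal (psi : colour) : bool := [forall e : {set V}, (#|e| != 2) ==> (psi e == c1)].

(* Colours outside [C e] get the weight [lam] instead of 0, so that colourings with
   a small defect keep most of their mass. *)
Definition base (e : {set V}) (c : 'I_s) : R :=
  if #|e| == 2 then (if c \in C e then 1 else lam) else (c == c1)%:R.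

Lemma base_ge0 e c : 0 <= base e c.
Proof. by rewrite /base; case: ifP => // _; case: ifP => // _; exact: ltW. Qed.

Lemma prod_base (psi : colour) : normal psi -> \prod_e base e (psi e) = lam ^+ defect psi.
Proof.
move=> /forallP npsi.
rewrite (eq_bigr (fun e : {set V} => if (#|e| == 2) && (psi e \notin C e) then lam else 1)).
  by rewrite -big_mkcond /= prodr_const; congr (_ ^+ _); apply: eq_card => e; rewrite inE.
move=> e _; rewrite /base; case: eqP => e2 /=; first by case: (_ \in _).
by have /implyP/(_ _)/eqP -> := npsi e; [rewrite eqxx | apply/eqP].
Qed.

Lemma total_mass (g : {set V} -> 'I_s -> R) :
  \sum_(psi : colour) \prod_e g e (psi e) = \prod_e \sum_c g e c.
Proof. by rewrite bigA_distr_bigA. Qed.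

Lemma allowed_ge1 (e : {set V}) : #|e| == 2 -> 1 <= #|C e|%:R :> R.
Proof. by move=> /C0; rewrite -card_gt0 ler1n. Qed.

Lemma sum_allowed (F : 'I_s -> R) (e : {set V}) : #|e| == 2 ->
  \sum_c (if c \in C e then F c else lam) <= \sum_(c in C e) F c + lam * s%:R.
Proof.
move=> e2; rewrite [leRHS](_ : _ = \sum_c ((if c \in C e then F c else 0) + lam)); last first.
  by rewrite big_split /= -big_mkcond sumr_const card_ord mulr_natr.
by apply: ler_sum => c _; case: ifP => _; rewrite ?add0r // lerDl ltW.
Qed.

Lemma sum_base (e : {set V}) : 0 < \sum_c base e c /\
  \sum_c base e c <= (if #|e| == 2 then #|C e|%:R * expR (lam * s%:R) else 1).
Proof.
rewrite /base; case: ifP => e2; last first.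
  have -> : \sum_c (c == c1)%:R = 1 :> R.
    by rewrite (bigD1 c1) //= eqxx big1 ?addr0 // => c /negPf ->.
  by split; [exact: ltr01 | exact: lexx].
split.
  have /set0Pn[c cC] := C0 e2; rewrite (bigD1 c) //= cC ltr_pwDl // sumr_ge0 // => c' _.
  by case: ifP => // _; exact: ltW.
apply: (le_trans (sum_allowed (fun=> 1) e2)); rewrite sumr_const.
have cge := allowed_ge1 e2; have ls0 : 0 <= lam * s%:R by rewrite mulr_ge0 // ltW.
apply: (@le_trans _ _ (#|C e|%:R * (1 + lam * s%:R))).
  by rewrite mulrDr mulr1 lerD2l -[leLHS]mul1r ler_wpM2r.
by rewrite ler_wpM2l // expR_ge1Dx.
Qed.

Lemma card_pairs : (#|[set e : {set V} | #|e| == 2]|%:R <= n ^+ 2 :> R).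
Proof.
rewrite card_draws -natrX ler_nat bin2 -mulnn -divn2.
by apply: leq_trans (leq_div _ _) _; rewrite leq_mul2l leq_pred orbT.
Qed.

Lemma prod_bound (P : {set {set V}}) (z : R) : 0 <= z ->
  \prod_(e : {set V}) ((if #|e| == 2 then #|C e|%:R * expR (lam * s%:R) else 1) * (if e \in P then z else 1))
  <= allowed_prod * expR (lam * s%:R * n ^+ 2) * z ^+ #|P|.
Proof.
move=> z0; rewrite big_split /= -[X in _ * X]big_mkcond prodr_const ler_wpM2r ?exprn_ge0 //.
rewrite -big_mkcond big_split /= -/allowed_prod prodr_const ler_wpM2l //.
  by apply: prodr_ge0 => e _.
rewrite -expRM_natl ler_expR mulrC ler_wpM2l ?mulr_ge0 ?(ltW lam0) //.
by apply: le_trans card_pairs; rewrite ler_nat; apply: subset_leq_card; apply/fintype.subsetP => e; rewrite inE.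
Qed.

Variables (theta zeta : R) (X : {set colour}).
Hypothesis lam_zeta : lam * s%:R <= zeta / 2.
Hypothesis theta_zeta : - ln lam * theta <= zeta / 2.
Hypothesis X_normal : forall psi, psi \in X -> normal psi.
Hypothesis X_defect : forall psi, psi \in X -> (defect psi)%:R <= theta * n ^+ 2.

(** A weighted Markov inequality: a colouring with defect at most $\theta n^2$ has base weight at
    least $\lambda^{\theta n^2}$. This factor and the excess $\exp(\lambda sn^2)$ of the total mass
    together cost $\exp(\zeta n^2)$. *)
Lemma mass_bound (H : colour -> R) (kap gam : R) : 0 <= kap -> 0 <= gam ->
  (forall psi, 0 <= H psi) -> (forall psi, psi \in X -> kap <= H psi) ->
  \sum_(psi : colour) (\prod_e base e (psi e)) * H psi <= allowed_prod * expR (lam * s%:R * n ^+ 2) * gam ->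
  #|X|%:R * kap <= expR (zeta * n ^+ 2) * allowed_prod * gam.
Proof.
move=> kap0 gam0 H0 HX tot; have n20 : 0 <= n ^+ 2 by rewrite exprn_ge0.
have lb (psi : colour) : psi \in X -> expR (ln lam * theta * n ^+ 2) * kap <= (\prod_e base e (psi e)) * H psi.
  move=> pX; rewrite ler_pM ?expR_ge0 ?HX // prod_base ?X_normal //.
  have -> : lam ^+ defect psi = expR (ln lam * (defect psi)%:R).
    by rewrite mulrC expRM_natl lnK ?posrE.
  by rewrite ler_expR -mulrA ler_wnM2l ?ln_le0 // X_defect.
have : #|X|%:R * (expR (ln lam * theta * n ^+ 2) * kap) <= allowed_prod * expR (lam * s%:R * n ^+ 2) * gam.
  apply: le_trans tot; rewrite [leRHS](bigID (mem X)) /=.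
  apply: (@le_trans _ _ (\sum_(psi in X) expR (ln lam * theta * n ^+ 2) * kap)).
    by rewrite sumr_const mulr_natl.
  apply: (@le_trans _ _ (\sum_(psi in X) (\prod_e base e (psi e)) * H psi)); first exact: ler_sum.
  rewrite lerDl; apply: sumr_ge0 => psi _; rewrite mulr_ge0 ?H0 //.
  by apply: prodr_ge0 => e _; exact: base_ge0.
rewrite mulrCA -ler_pdivlMl ?expR_gt0 // => h; apply: (le_trans h).
rewrite -expRN !mulrA ler_wpM2r // [leRHS]mulrC mulrAC -expRD mulrC.
rewrite ler_wpM2r ?prodr_ge0 // ler_expR.
have := ler_wpM2r n20 (lerD lam_zeta theta_zeta); rewrite expr2; lra.
Qed.

Lemma count_basic : #|X|%:R <= expR (zeta * n ^+ 2) * allowed_prod.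
Proof.
have := @mass_bound (fun=> 1) 1 1; rewrite !mulr1; apply=> //.
under eq_bigr do rewrite mulr1.
rewrite total_mass; have := prod_bound set0 ler01; rewrite cards0 expr0 mulr1; apply: le_trans.
apply: ler_prod => e _; rewrite inE mulr1.
by have [h1 h2] := sum_base e; rewrite (ltW h1).
Qed.

Lemma expR_quadratic (h : R) : h <= 1 / 2 -> expR h <= 1 + h + 2 * h ^+ 2.
Proof.
move=> h2; have h1 : 0 < 1 - h by lra.
have : 1 - h <= expR (- h) by exact: expR_ge1Dx.
rewrite expRN => H; apply: (@le_trans _ _ (1 - h)^-1).
  by rewrite -[leLHS]invrK lef_pV2 ?posrE ?invr_gt0 ?expR_gt0.
rewrite -[leLHS]mul1r ler_pdivrMr // -subr_ge0.
have -> : (1 + h + 2 * h ^+ 2) * (1 - h) - 1 = h ^+ 2 * (1 - 2 * h) by ring.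
by rewrite mulr_ge0 ?sqr_ge0 //; lra.
Qed.

(* Chernoff's method with the exponential moment of [h] times the number of
   pairs of colour [c]; the sign of [h] selects the tail. *)
Lemma count_deviation (P : {set {set V}}) (c : 'I_s) (m : nat) (h dlt : R) :
  (2 <= m)%N -> (forall e : {set V}, e \in P -> [/\ #|e| == 2, c \in C e & #|C e| = m]) ->
  0 < dlt -> dlt <= 1 -> `|h| = dlt / 4 ->
  (forall psi, psi \in X -> #|P|%:R * (h / m%:R + dlt ^+ 2 / 8) <= h * #|[set e in P | psi e == c]|%:R) ->
  #|X|%:R <= expR (zeta * n ^+ 2) * allowed_prod * expR (- (dlt ^+ 2 / 16) * #|P|%:R).
Proof.
move=> m2 PC d0 d1 hd dev; set N := #|P|%:R.
have m0 : 0 < m%:R :> R by rewrite ltr0n (ltn_trans _ m2).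
have := @mass_bound (fun psi : colour => expR (h * #|[set e in P | psi e == c]|%:R))
  (expR (N * (h / m%:R + dlt ^+ 2 / 8))) (expR ((expR h - 1) / m%:R * N)).
rewrite !expR_ge0 => /(_ isT isT (fun=> expR_ge0 _) _ _) H.
have {}H : #|X|%:R * expR (N * (h / m%:R + dlt ^+ 2 / 8)) <=
    expR (zeta * n ^+ 2) * allowed_prod * expR ((expR h - 1) / m%:R * N).
  apply: H => [psi pX|]; first by rewrite ler_expR; exact: dev.
  rewrite (eq_bigr (fun psi : colour => \prod_e (base e (psi e) * (if (e \in P) && (psi e == c) then expR h else 1)))); last first.
    move=> psi _; rewrite big_split /= -[X in _ = _ * X]big_mkcond prodr_const; congr (_ * _).
    by rewrite mulrC expRM_natl; congr (_ ^+ _); apply: eq_card => e; rewrite inE.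
  rewrite (total_mass (fun e c' => base e c' * (if (e \in P) && (c' == c) then expR h else 1))).
  have -> : expR ((expR h - 1) / m%:R * N) = expR ((expR h - 1) / m%:R) ^+ #|P|.
    by rewrite -expRM_natl mulrC.
  apply: le_trans (prod_bound P (expR_ge0 _)); apply: ler_prod => e _.
  have fge0 : 0 <= \sum_c0 base e c0 * (if (e \in P) && (c0 == c) then expR h else 1).
    by apply: sumr_ge0 => c' _; rewrite mulr_ge0 ?base_ge0 //; case: ifP => // _; exact: expR_ge0.
  rewrite fge0 /=; have [eP|eP] := boolP (e \in P); last first.
    by rewrite mulr1; under eq_bigr do rewrite mulr1; have [] := sum_base e.
  have [e2 cC Cm] := PC e eP; rewrite e2.
  apply: (@le_trans _ _ (\sum_c' (if c' \in C e then (if c' == c then expR h else 1) else lam))).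
    apply: ler_sum => c' _; rewrite /base e2 /=; case: ifP => [_|c'C]; first by rewrite mul1r.
    by case: eqP => [c'c|_]; [rewrite c'c cC in c'C | rewrite mulr1].
  apply: (le_trans (sum_allowed _ e2)).
  rewrite (bigD1 c) //= eqxx (eq_bigr (fun=> 1)) => [|c' /andP[_ /negPf -> //]].
  rewrite sumr_const (_ : #|_| = m.-1); last first.
    by rewrite -Cm (cardsD1 c (C e)) cC /=; apply: eq_card => c'; rewrite !inE andbC.
  have mE : m.-1%:R = m%:R - 1 :> R by rewrite -subn1 natrB // (ltnW m2).
  rewrite mE Cm; set u := expR h + (m%:R - 1).
  have m2R : 2 <= m%:R :> R by rewrite ler_nat.
  have u1 : 1 <= u by rewrite /u; have := expR_ge0 h; lra.
  have ls0 : 0 <= lam * s%:R by rewrite mulr_ge0 // ltW.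
  apply: (@le_trans _ _ (u * expR (lam * s%:R))).
    apply: (@le_trans _ _ (u * (1 + lam * s%:R))).
      by rewrite mulrDr mulr1 lerD2l -[leLHS]mul1r ler_wpM2r.
    by rewrite ler_wpM2l ?expR_ge1Dx // (le_trans _ u1).
  rewrite mulrAC ler_wpM2r ?expR_ge0 //.
  have -> : u = m%:R * (1 + (expR h - 1) / m%:R) by rewrite /u; field; rewrite gt_eqF.
  by rewrite ler_wpM2l ?expR_ge1Dx.
rewrite -ler_pdivlMr ?expR_gt0 // -expRN -[leRHS]mulrA -expRD in H.
apply: (le_trans H); rewrite ler_wpM2l ?mulr_ge0 ?expR_ge0 ?prodr_ge0 // ler_expR.
rewrite -[X in _ - X]mulrC -[in leLHS]mulNr -mulrDl ler_wpM2r //.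
(* As $m\ge2$, the exponent per pair is at most
   $2h^2/m-\mathrm{dlt}^2/8\le\mathrm{dlt}^2/16-\mathrm{dlt}^2/8$. *)
have h2 : h <= 1 / 2 by apply: (le_trans (ler_norm _)); rewrite hd; lra.
have hh : h ^+ 2 = dlt ^+ 2 / 16 by rewrite -real_normK ?num_real // hd; field.
have := expR_quadratic h2; rewrite hh => q.
have minv : m%:R^-1 <= 1 / 2 :> R by rewrite mul1r lef_pV2 ?posrE // ler_nat.
have : (expR h - 1 - h) / m%:R <= (2 * (dlt ^+ 2 / 16)) / m%:R by rewrite ler_pM2r ?invr_gt0 //; lra.
have : (2 * (dlt ^+ 2 / 16)) / m%:R <= (2 * (dlt ^+ 2 / 16)) * (1 / 2).
  by rewrite ler_wpM2l // mulr_ge0 // divr_ge0 // sqr_ge0.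
rewrite mulrBl [h / _]mulrC; lra.
Qed.

Section Tuples.
Variables (T : finType) (E : T -> {set {set V}}) (K : nat).
Hypothesis Edisj : forall t t', t != t' -> [disjoint E t & E t'].
Hypothesis EC : forall t (e : {set V}), e \in E t -> (#|e| == 2) && (c1 \in C e).
Hypothesis EK : forall t, (#|E t| <= K)%N.

Definition mono (t : T) (psi : colour) : bool := [forall e in E t, psi e == c1].

(* The factor of [t] is expanded as a difference; in the second term the weights
   on [E t] are concentrated at [c1], which leaves the other tuples unaffected. *)
Lemma tuple_mass (ts : seq T) (g : {set V} -> 'I_s -> R) : uniq ts ->
  (forall e, 0 < \sum_c g e c) ->
  (forall t e, t \in ts -> e \in E t -> 0 < g e c1) ->
  \sum_(psi : colour) (\prod_e g e (psi e)) * \prod_(t <- ts) (1 - (mono t psi)%:R) =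
  (\prod_e \sum_c g e c) * \prod_(t <- ts) (1 - \prod_(e in E t) (g e c1 / \sum_c g e c)).
Proof.
elim: ts g => [|t ts IH] g /=.
  by move=> _ _ _; rewrite big_nil mulr1; under eq_bigr do rewrite big_nil mulr1; rewrite total_mass.
move=> /andP[tts uts] Z0 g0.
pose g' e c := if (e \in E t) && (c != c1) then 0 else g e c.
have Zg' e : \sum_c g' e c = if e \in E t then g e c1 else \sum_c g e c.
  rewrite /g'; case: ifP => eE /=; last by [].
  by rewrite (bigD1 c1) //= eqxx big1 ?addr0 // => c ->.
have mg (psi : colour) : (\prod_e g e (psi e)) * (mono t psi)%:R = \prod_e g' e (psi e).
  have [/forall_inP mt|/forall_inPn[e eE pe]] := boolP (mono t psi).
    rewrite mulr1; apply: eq_bigr => e _; rewrite /g'; case: ifP => // /andP[eE].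
    by rewrite (mt e eE).
  by rewrite mulr0 (bigD1 e) //= /g' eE pe mul0r.
rewrite (eq_bigr (fun psi : colour => (\prod_e g e (psi e)) * \prod_(t <- ts) (1 - (mono t psi)%:R)
   - (\prod_e g' e (psi e)) * \prod_(t <- ts) (1 - (mono t psi)%:R))); last first.
  by move=> psi _; rewrite big_cons -mg; ring.
rewrite sumrB IH //; last by move=> t' e t'ts; apply: g0; rewrite inE t'ts orbT.
rewrite IH //.
- rewrite big_cons.
  have -> : \prod_e \sum_c g' e c = (\prod_e \sum_c g e c) * \prod_(e in E t) (g e c1 / \sum_c g e c).
    rewrite [X in _ = _ * X]big_mkcond -big_split /=; apply: eq_bigr => e _; rewrite Zg'.
    by case: ifP => _; rewrite ?mulr1 // mulrC divfK // gt_eqF.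
  have -> : \prod_(t' <- ts) (1 - \prod_(e in E t') (g' e c1 / \sum_c g' e c)) =
      \prod_(t' <- ts) (1 - \prod_(e in E t') (g e c1 / \sum_c g e c)).
    rewrite big_seq [RHS]big_seq; apply: eq_bigr => t' t'ts; congr (1 - _); apply: eq_bigr => e eE.
    have eEt : e \in E t = false.
      have tt' : t' != t by apply: contraNneq tts => <-.
      by have := Edisj tt' => /disjointFr ->.
    by rewrite Zg' /g' eEt.
  by ring.
- by move=> e; rewrite Zg'; case: ifP => // eE; apply: g0 eE; rewrite inE eqxx.
- by move=> t' e t'ts eE; rewrite /g' eqxx andbF; apply: g0 eE; rewrite inE t'ts orbT.
Qed.

Hypothesis X_mono : forall psi t, psi \in X -> ~~ mono t psi.

(** By [tuple_mass] the tuples behave independently. On each pair of [E t] colour 1 has the largest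
    possible weight 1, hence probability at least $1/s$. *)
Lemma count_tuples :
  #|X|%:R <= expR (zeta * n ^+ 2) * allowed_prod * (1 - s%:R^-1 ^+ K) ^+ #|T|.
Proof.
have s0 : 0 < s%:R :> R by rewrite ltr0n; case: s c1 => [[]|].
have s1 : 1 <= s%:R :> R by rewrite ler1n -(ltr0n R).
have si1 : s%:R^-1 <= 1 :> R by rewrite invf_le1.
have si0 : 0 <= s%:R^-1 :> R by rewrite invr_ge0.
have K0 : 0 <= 1 - s%:R^-1 ^+ K :> R by rewrite subr_ge0 exprn_ile1.
have := @mass_bound (fun psi : colour => \prod_(t <- index_enum T) (1 - (mono t psi)%:R)) 1 ((1 - s%:R^-1 ^+ K) ^+ #|T|).
rewrite mulr1; apply=> //.
- by rewrite exprn_ge0.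
- by move=> psi; apply: prodr_ge0 => t _; rewrite subr_ge0 lern1 leq_b1.
- move=> psi pX; rewrite big1 // => t _; rewrite (negPf (X_mono t pX)) subr0 //.
have gpos t e : e \in E t -> base e c1 = 1.
  by move=> /EC /andP[e2 cC]; rewrite /base e2 cC.
rewrite tuple_mass ?index_enum_uniq //; first last.
- by move=> t e _ /gpos ->.
- by move=> e; have [] := sum_base e.
have pb := prod_bound set0 ler01; rewrite cards0 expr0 mulr1 in pb.
have pos : 0 <= \prod_e \sum_c base e c by apply: prodr_ge0 => e _; apply: ltW; have [] := sum_base e.
apply: ler_pM => //.
- apply: prodr_ge0 => t _; rewrite subr_ge0; apply: prodr_ile1 => e eE.
  have [Z0 _] := sum_base e; rewrite divr_ge0 ?base_ge0 ?(ltW Z0) //=.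
  rewrite ler_pdivrMr // mul1r (bigD1 c1) //= lerDl sumr_ge0 // => c _; exact: base_ge0.
- apply: le_trans pb; apply: ler_prod => e _; rewrite inE mulr1.
  by have [h1 h2] := sum_base e; rewrite (ltW h1).
have -> : (1 - s%:R^-1 ^+ K) ^+ #|T| = \prod_(t : T) (1 - s%:R^-1 ^+ K) :> R.
  by rewrite prodr_const.
apply: ler_prod => t _; apply/andP; split.
  rewrite subr_ge0; apply: prodr_ile1 => e eE.
  have [Z0 _] := sum_base e; rewrite divr_ge0 ?base_ge0 ?(ltW Z0) //=.
  rewrite ler_pdivrMr // mul1r (bigD1 c1) //= lerDl sumr_ge0 // => c _; exact: base_ge0.
rewrite lerD2l lerN2; apply: (@le_trans _ _ (s%:R^-1 ^+ #|E t|)).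
  by rewrite ler_wiXn2l.
rewrite -prodr_const; apply: ler_prod => e eE; rewrite si0 /=.
have [Z0 _] := sum_base e; rewrite (gpos _ _ eE) mul1r lef_pV2 ?posrE //.
have -> : s%:R = \sum_(c : 'I_s) 1 :> R by rewrite sumr_const card_ord.
apply: ler_sum => c _; have /andP[e2 _] := EC eE; rewrite /base e2.
by case: ifP.
Qed.

End Tuples.

End Counting.

Section TwoSets.
Variables (R : realType) (s : nat) (V : finType).
Local Notation weight := (@weight R s).

Lemma sum_two_sets (F : {set V} -> R) :
  \sum_x \sum_(y | y != x) F [set x; y] = 2 * \sum_(e : {set V} | #|e| == 2) F e.
Proof.
rewrite (pair_big_dep xpredT (fun x y => y != x) (fun x y => F [set x; y])) /=.
rewrite (partition_big (fun p : V * V => [set p.1; p.2]) (fun e : {set V} => #|e| == 2)) /=; last first.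
  by move=> [x y] /= xy; rewrite cards2 (eq_sym x y) xy.
rewrite big_distrr; apply: eq_bigr => e /cards2P[a [b [ab ->]]] /=.
rewrite (eq_bigr (fun=> F [set a; b])) => [|p /andP[_ /eqP -> //]].
rewrite sumr_const mulr_natl; congr (_ *+ _).
rewrite (@eq_card _ _ (mem [set (a, b); (b, a)])); last first.
  move=> [x y]; rewrite !inE /= !xpair_eqE; apply/andP/idP => [[xy /eqP E]|].
    have xE : x \in [set a; b] by rewrite -E !inE eqxx.
    have yE : y \in [set a; b] by rewrite -E !inE eqxx orbT.
    move: xE yE xy; rewrite !inE => /orP[]/eqP -> /orP[]/eqP ->; rewrite ?eqxx ?orbT //.
  move=> /orP[]/andP[/eqP -> /eqP ->]; first by rewrite eq_sym ab.
  by rewrite ab setUC eqxx.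
by rewrite cards2 xpair_eqE negb_and ab.
Qed.

(** The form runs over ordered pairs and uses binary logarithms, hence the factor $\ln2/2$. Only the
    weights of [C] and [p] have to agree, so an empty set of [p] may become a single colour in
    [C]. *)
Lemma allowed_prod_form (C : {set V} -> {set 'I_s}) (p : V -> V -> {set 'I_s}) : pairing p ->
  (forall e : {set V}, #|e| == 2 -> C e != set0) ->
  (forall x y, x != y -> weight (C [set x; y]) = weight (p x y)) ->
  allowed_prod R C = expR (ln 2 / 2 * form p (fun=> 1)).
Proof.
move=> pp C0 Cp; rewrite form_offdiag //.
rewrite (_ : \sum_i \sum_(j | j != i) 1 * 1 * weight (p i j) = 2 * \sum_(e : {set V} | #|e| == 2) weight (C e)); last first.
  rewrite -sum_two_sets; apply: eq_bigr => x _; apply: eq_bigr => y yx.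
  by rewrite !mul1r Cp // eq_sym.
rewrite mulrA divfK // big_distrr expR_sum; apply: eq_bigr => e /C0 /=.
rewrite -card_gt0 => Ce; rewrite /weight /log2 mulrC divfK ?gt_eqF ?ln2_gt0 // lnK // posrE ltr0n //.
Qed.

End TwoSets.

Section Extension.
Variables (s : nat) (c1 : 'I_s) (V : finType) (G : {set {set V}}).
Hypothesis Gs : simple_graph G.
Variables (C : {set V} -> {set 'I_s}) (d : {set V} -> 'I_s).
Hypothesis dC : forall e : {set V}, #|e| == 2 -> d e \in C e.
Hypothesis d1 : forall e : {set V}, #|e| != 2 -> d e = c1.

Lemma simple_card e : e \in G -> #|e| == 2.
Proof. by move/forall_inP: Gs; exact. Qed.

(* Non-edges get the colour [d e], which turns colourings of [G] into functions on all pairs. *)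
Definition ext_col (chi : colouring s G) : {ffun {set V} -> 'I_s} :=
  [ffun e => if insub e is Some e' then chi e' else d e].

Lemma ext_colE (chi : colouring s G) (e : {e : {set V} | e \in G}) : ext_col chi (val e) = chi e.
Proof. by rewrite ffunE valK. Qed.

Lemma ext_col_out (chi : colouring s G) e : e \notin G -> ext_col chi e = d e.
Proof. by move=> eG; rewrite ffunE insubN. Qed.

Lemma ext_col_inj : injective ext_col.
Proof. by move=> chi chi' E; apply/ffunP => e; rewrite -!ext_colE E. Qed.

Lemma in_colour_class (chi : colouring s G) c e :
  (e \in colour_class chi c) = (e \in G) && (ext_col chi e == c).
Proof.
apply/imsetP/andP => [[e' /[!inE] /eqP chie ->]|[eG ec]].
  by split; [exact: valP | rewrite ext_colE chie].
by exists (Sub e eG); rewrite ?inE // -ext_colE.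
Qed.

Lemma ext_col_normal (chi : colouring s G) : normal c1 (ext_col chi).
Proof.
apply/forallP => e; apply/implyP => e2; rewrite ext_col_out ?d1 //.
by apply: contra e2; exact: simple_card.
Qed.

Lemma ext_col_defect (chi : colouring s G) :
  (defect C (ext_col chi) <= #|[set p : V * V | ([set p.1; p.2] \in G) && (ext_col chi [set p.1; p.2] \notin C [set p.1; p.2])]|)%N.
Proof.
apply: leq_trans (leq_imset_card (fun p : V * V => [set p.1; p.2]) _).
apply: subset_leq_card; apply/fintype.subsetP => e; rewrite inE => /andP[e2 eC].
have eG : e \in G.
  by apply: contraNT eC => eG; rewrite ext_col_out // dC.
have /cards2P[x [y [xy exy]]] := e2; apply/imsetP; exists (x, y); rewrite ?inE -?exy //.
by rewrite eG.
Qed.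

Definition colour_pairs (chi : colouring s G) (c : 'I_s) : {set V * V} :=
  [set p | [set p.1; p.2] \in colour_class chi c].

Lemma colour_pairs_sym (chi : colouring s G) c x y :
  ((x, y) \in colour_pairs chi c) = ((y, x) \in colour_pairs chi c).
Proof. by rewrite !inE /= setUC. Qed.

Lemma colour_class_loop (chi : colouring s G) c x : [set x; x] \notin colour_class chi c.
Proof.
rewrite in_colour_class negb_and; apply/orP; left; apply/negP => /simple_card.
by rewrite setUid cards1.
Qed.

Lemma colour_pairs_irr (chi : colouring s G) c x : (x, x) \notin colour_pairs chi c.
Proof. by rewrite inE colour_class_loop. Qed.

Lemma colour_pairs_free (k : 'I_s -> nat) (chi : colouring s G) c (h : 'I_(k c) -> V) :
  valid_colouring k chi -> exists a b : 'I_(k c), (a < b)%N /\ (h a, h b) \notin colour_pairs chi c.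
Proof.
move=> /forallP/(_ c)/negP; apply: contra_notP => Hn.
apply/(contains_cliqueP _ (colour_class_loop chi c)); exists (finfun h) => a b ab.
by rewrite !ffunE; apply: contra_notT Hn => Hc; exists a, b; rewrite inE.
Qed.

End Extension.

Section Irregular.
Variables (R : realType) (V : finType).

(** Either the density of the whole pair is off by [dl / 2], or that of a subpair differs from it by
    [delta], and the triangle inequality leaves half of this. The minimum with 1 lets [A] and [B]
    themselves serve as witnesses. *)
Lemma irregular_witness (delta mi : R) (H : {set {set V}}) (A B : {set V}) :
  0 < delta -> A != set0 -> B != set0 -> ~ regular_pair delta mi H A B ->
  exists X Y : {set V}, [/\ X \subset A, Y \subset B,
    Num.min delta 1 * #|A|%:R <= #|X|%:R /\ Num.min delta 1 * #|B|%:R <= #|Y|%:R &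
    Num.min delta 1 / 2 * (#|X|%:R * #|Y|%:R) <= `|(edges_between H X Y)%:R - mi * (#|X|%:R * #|Y|%:R)|].
Proof.
move=> d0 A0 B0; set dl := Num.min delta 1.
have dl0 : 0 < dl by rewrite lt_min d0 ltr01.
have dl1 : dl <= 1 by rewrite ge_min lexx orbT.
have dld : dl <= delta by rewrite ge_min lexx.
have cpos (X Y : {set V}) : dl * #|A|%:R <= #|X|%:R -> dl * #|B|%:R <= #|Y|%:R -> 0 < #|X|%:R * #|Y|%:R :> R.
  move=> hX hY; rewrite mulr_gt0 //.
    by apply: lt_le_trans hX; rewrite mulr_gt0 // ltr0n card_gt0.
  by apply: lt_le_trans hY; rewrite mulr_gt0 // ltr0n card_gt0.
have conv (X Y : {set V}) : X \subset A -> Y \subset B ->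
    dl * #|A|%:R <= #|X|%:R -> dl * #|B|%:R <= #|Y|%:R -> dl / 2 <= `|density R H X Y - mi| ->
    exists X Y : {set V}, [/\ X \subset A, Y \subset B,
    dl * #|A|%:R <= #|X|%:R /\ dl * #|B|%:R <= #|Y|%:R &
    dl / 2 * (#|X|%:R * #|Y|%:R) <= `|(edges_between H X Y)%:R - mi * (#|X|%:R * #|Y|%:R)|].
  move=> XA YB hX hY h; exists X, Y; split=> //; have p0 := cpos X Y hX hY.
  rewrite (_ : _ - _ = (density R H X Y - mi) * (#|X|%:R * #|Y|%:R)); last first.
    by rewrite mulrBl /density divfK // gt_eqF.
  by rewrite normrM (gtr0_norm p0) ler_pM2r.
have hA : dl * #|A|%:R <= #|A|%:R by rewrite ler_piMl.
have hB : dl * #|B|%:R <= #|B|%:R by rewrite ler_piMl.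
move=> nreg; have [far|near] := leP (dl / 2) `|density R H A B - mi|; first exact: (conv A B).
have [X [Y [XA YB hX hY hd]]] : exists X Y : {set V}, [/\ X \subset A, Y \subset B,
    delta * #|A|%:R <= #|X|%:R, delta * #|B|%:R <= #|Y|%:R & delta <= `|density R H X Y - density R H A B|].
  apply: contrapT => Hn; apply: nreg; split.
    by move: near; rewrite ltr_distl => /andP[h1 h2]; apply/andP; split; lra.
  by move=> X Y XA YB hX hY; rewrite ltNge; apply/negP => hd; apply: Hn; exists X, Y.
apply: (conv X Y) => //.
- by apply: le_trans hX; rewrite ler_wpM2r.
- by apply: le_trans hY; rewrite ler_wpM2r.
have := ler_distD mi (density R H X Y) (density R H A B).
by rewrite [`|mi - _|]distrC => h; lra.
Qed.

End Irregular.

(* Two lines modulo [p] that meet in two points coincide. *)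
Lemma index_inj (p r i j a b a' b' : nat) : coprime p r`! -> (i < r)%N -> (j < r)%N -> i != j ->
  (a < p)%N -> (b < p)%N -> (a' < p)%N -> (b' < p)%N ->
  a + i * b = a' + i * b' %[mod p] -> a + j * b = a' + j * b' %[mod p] -> a = a' /\ b = b'.
Proof.
wlog ij : i j / (i < j)%N.
  move=> W cp ir jr; rewrite neq_ltn => /orP[] ij ap bp a'p b'p e1 e2.
    by apply: (W i j) => //; rewrite neq_ltn ij.
  by apply: (W j i) => //; rewrite neq_ltn ij.
move=> cp ir jr _ ap bp a'p b'p /eqP ei /eqP ej.
have [e e0 jE] : exists2 e, (0 < e)%N & j = (i + e)%N by exists (j - i)%N; rewrite ?subn_gt0 // subnKC // ltnW.
have er : (e <= r)%N by apply: leq_trans (ltnW jr); rewrite jE leq_addl.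
have cd : coprime p e by apply: coprime_dvdr cp; apply: dvdn_fact; rewrite e0.
have key : (e * b == e * b' %[mod p])%N.
  rewrite -(eqn_modDl (a + i * b + i * b')).
  have -> : (a + i * b + i * b' + e * b = (a + j * b) + i * b')%N.
    by rewrite jE mulnDl !addnA addnAC.
  have -> : (a + i * b + i * b' + e * b' = (a + i * b) + j * b')%N.
    by rewrite jE mulnDl !addnA.
  apply/eqP; rewrite -modnDml (eqP ej) modnDml -[RHS]modnDml (eqP ei) modnDml.
  by rewrite addnAC.
have bb : b = b'.
  have sub (u v : nat) : (u <= v)%N -> (v < p)%N -> (e * v == e * u %[mod p])%N -> v = u.
    move=> uv vp; rewrite eqn_mod_dvd ?leq_mul2l ?uv ?orbT // -mulnBr Gauss_dvdr // => /dvdn_leq H.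
    apply/eqP; rewrite eqn_leq uv andbT -subn_eq0 -leqn0 leqNgt; apply/negP => /H.
    by rewrite leqNgt (leq_ltn_trans _ vp) // leq_subr.
  have [le|lt] := leqP b b'; last by apply: sub => //; exact: ltnW.
  by apply/esym/sub => //; rewrite eq_sym.
subst b'; split=> //; move: ei; rewrite eqn_modDr => /eqP.
by rewrite !modn_small.
Qed.

Lemma eventually_ge (R : realType) (t : R) : exists N : nat, forall n : nat, (N <= n)%N -> t <= n%:R.
Proof.
exists (Num.truncn t).+1 => n Nn; apply: (@le_trans _ _ (Num.truncn t).+1%:R); last by rewrite ler_nat.
by apply: ltW; exact: truncnS_gt.
Qed.

Lemma ln_le_linear (R : realType) (z : R) : 0 < z -> exists n0 : nat, forall n : nat, (n0 <= n)%N ->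
  (0 < n)%N -> ln n%:R <= z * n%:R :> R.
Proof.
move=> z0; have [N HN] := eventually_ge (4 / z ^+ 2); exists N => n /HN H n1.
have n0 : 0 < n%:R :> R by rewrite ltr0n.
rewrite -ler_expR lnK ?posrE //.
have -> : z * n%:R = 2%:R * (z / 2 * n%:R) by field.
rewrite expRM_natl; apply: (@le_trans _ _ ((z / 2 * n%:R) ^+ 2)); last first.
  have h0 : 0 <= z / 2 * n%:R by rewrite mulr_ge0 // divr_ge0 // ltW.
  rewrite lerXn2r ?nnegrE ?expR_ge0 //; apply: le_trans (expR_ge1Dx _); lra.
move: H; rewrite ler_pdivrMr ?exprn_gt0 // => H.
have -> : (z / 2 * n%:R) ^+ 2 = n%:R * (n%:R * z ^+ 2) / 4 by field.
by rewrite ler_pdivlMr // ler_wpM2l // ltW.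
Qed.

Lemma contains_clique_le (V : finType) (l l' : nat) (G : {set {set V}}) : (l' <= l)%N ->
  contains_clique l G -> contains_clique l' G.
Proof.
move=> ll /existsP[A /andP[/eqP Al /forall_inP AG]].
have [B BA Bl] : exists2 B : {set V}, B \subset A & #|B| = l'.
  have : (l' <= #|A|)%N by rewrite Al.
  exists [set x in take l' (enum A)].
    by apply/fintype.subsetP => x; rewrite inE => /mem_take; rewrite mem_enum.
  have u : uniq (take l' (enum A)) by rewrite take_uniq // enum_uniq.
  by rewrite cardsE (card_uniqP u) size_takel // -cardE.
apply/existsP; exists B; rewrite Bl eqxx /=; apply/forall_inP => x xB; apply/forall_inP => y yB.
by have /forall_inP := AG x (fintype.subsetP BA _ xB); apply; exact: (fintype.subsetP BA).
Qed.

(** * Disjoint cliques in graphs far from being clique-free *)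

Section DisjointCliques.
Variables (R : realType) (V : finType) (G H : {set {set V}}) (Y : {set V}) (delta : R) (l : nat).
Hypotheses (Gs : simple_graph G) (HG : H \subset G).
Hypothesis far : far_from_clique_free delta l (induced_subgraph G Y).
Variables (b : R).
Hypothesis GH : #|[set e in G | (e \subset Y) && (e \notin H)]|%:R <= b.

(** Deleting the edges that are not in [H] or meet [U] changes the induced graph on [Y] in fewer
    than $\delta|Y|^2$ pairs, so a clique survives; each of its vertices lies on an edge and
    therefore avoids [U]. *)
Lemma far_clique (l' : nat) (U : {set V}) : (0 < l' <= l)%N -> (#|U| < #|Y|)%N ->
  b + (#|U| * #|V|)%:R < delta * #|Y|%:R ^+ 2 ->
  exists A : {set V}, [/\ A \subset Y :\: U, #|A| = l' &
    forall x y, x \in A -> y \in A -> x != y -> [set x; y] \in H].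
Proof.
move=> /andP[l'0 l'l] UY small.
(* A clique with one vertex has no edge to keep it out of [U], so this case is separate. *)
have [l'1|l'1] := eqVneq l' 1%N.
  have /set0Pn[x xYU] : Y :\: U != set0.
    apply: contraTneq UY => E; rewrite -leqNgt; apply: subset_leq_card.
    by rewrite -setD_eq0 E.
  exists [set x]; rewrite sub1set xYU cards1; split=> // y z; rewrite !inE => /eqP -> /eqP ->.
  by rewrite eqxx.
pose T := {x : V | x \in Y}.
pose G' : {set {set T}} := [set e : {set T} | ([set val x | x in e] \in H) && [disjoint [set val x | x in e] & U]].
have Gs2 e : e \in G -> #|e| == 2 by move/forall_inP: Gs; exact.
have G's : simple_graph G'.
  apply/forall_inP => e; rewrite inE => /andP[/(fintype.subsetP HG)/Gs2].
  by rewrite card_imset //; exact: val_inj.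
have [cl|/negP ncl] := boolP (contains_clique l' G'); last first.
  have /(far G's) : clique_free l G'.
    by apply/negP => /(contains_clique_le l'l).
  have cT : #|{: T}| = #|Y| by rewrite card_sig; apply: eq_card => x.
  rewrite cT leNgt => /negP[]; apply: le_lt_trans small; rewrite /edit_distance.
  have -> : G' :\: induced_subgraph G Y = set0.
    apply/eqP; rewrite setD_eq0; apply/fintype.subsetP => e; rewrite !inE => /andP[/(fintype.subsetP HG)] //.
  rewrite setU0.
  pose B1 := [set e in G | (e \subset Y) && (e \notin H)].
  pose B2 := [set [set p.1; p.2] | p in setX U [set: V]].
  have sub : [set [set val x | x in (e : {set T})] | e in induced_subgraph G Y :\: G'] \subset B1 :|: B2.
    apply/fintype.subsetP => _ /imsetP[e + ->]; rewrite !inE negb_and => /andP[/orP[eH|eU] eG].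
      apply/orP; left; rewrite eG eH andbT /=; apply/fintype.subsetP => _ /imsetP[x _ ->].
      exact: valP.
    apply/orP; right; move: eU; rewrite disjoint_sym -setI_eq0 => /set0Pn[x /setIP[xU xe]].
    have /cards2P[y [z [yz E]]] := Gs2 _ eG; move: xe; rewrite E !inE => /orP[]/eqP ex.
      by apply/imsetP; exists (y, z); rewrite ?in_setX ?in_setT -?ex ?xU.
    by apply/imsetP; exists (z, y); rewrite ?in_setX ?in_setT -?ex ?xU //= setUC.
  have inj : injective (fun e : {set T} => [set val x | x in e]) by apply: imset_inj; exact: val_inj.
  apply: (@le_trans _ _ (#|B1| + #|B2|)%:R).
    rewrite ler_nat -(card_imset _ inj).
    by apply: leq_trans (subset_leq_card sub) _; exact: leq_card_setU.
  rewrite natrD lerD // ler_nat; apply: leq_trans (leq_imset_card _ _) _.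
  by rewrite cardsX cardsT.
have /existsP[A /andP[/eqP Al /forall_inP AG]] := cl.
have AGp x y : x \in A -> y \in A -> x != y -> ([set val x; val y] \in H) && [disjoint [set val x; val y] & U].
  move=> xA yA xy; have /forall_inP/(_ y yA)/implyP/(_ xy) := AG x xA.
  by rewrite inE imsetU1 imset_set1.
exists [set val x | x in A]; split.
- apply/fintype.subsetP => _ /imsetP[x xA ->]; rewrite inE (valP x) andbT.
  have [y yA yx] : exists2 y, y \in A & x != y.
    have : (0 < #|A :\ x|)%N
      by move: l'1 l'0; rewrite -Al (cardsD1 x A) xA; case: #|_ :\ _| => [|[]].
    by case/card_gt0P => y; rewrite !inE => /andP[yx yA]; exists y; rewrite // eq_sym.
  have /andP[_ /disjointFr H'] := AGp x y xA yA yx.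
  by rewrite H' // !inE eqxx.
- by rewrite card_imset //; exact: val_inj.
move=> _ _ /imsetP[x xA ->] /imsetP[y yA ->] xy.
have xy' : x != y by apply: contra_neq xy => ->.
by have /andP[] := AGp x y xA yA xy'.
Qed.

(** Greedy choice: [U] is the union of the cliques found so far. *)
Lemma disjoint_cliques (l' q : nat) : (0 < l' <= l)%N -> (q * l' < #|Y|)%N ->
  b + (q * l' * #|V|)%:R < delta * #|Y|%:R ^+ 2 ->
  exists A : 'I_q -> {set V}, [/\ forall a, A a \subset Y, forall a, #|A a| = l',
    forall a a', a != a' -> [disjoint A a & A a'] &
    forall a x y, x \in A a -> y \in A a -> x != y -> [set x; y] \in H].
Proof.
move=> ll; elim: q => [|q IH] qY small.
  by exists (fun=> set0); split=> [[]|[]|[]|[]].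
have [||A [AY Al Ad AH]] := IH.
- by apply: leq_ltn_trans qY; rewrite leq_mul2r leqnSn orbT.
- by apply: le_lt_trans small; rewrite lerD2l ler_nat !leq_mul2r leqnSn !orbT.
pose U := \bigcup_a A a.
have Uc : (#|U| <= q * l')%N.
  apply: leq_trans (leq_card_bigcup _ _) _; under eq_bigr do rewrite Al.
  by rewrite sum_nat_const card_ord.
have [||B [BY Bl BH]] := @far_clique l' U ll.
- by apply: leq_ltn_trans qY; apply: (leq_trans Uc); rewrite leq_mul2r leqnSn orbT.
- apply: le_lt_trans small; rewrite lerD2l ler_nat leq_mul2r; apply/orP; right.
  by apply: (leq_trans Uc); rewrite leq_mul2r leqnSn orbT.
have BU a : [disjoint B & A a].
  rewrite -setI_eq0; apply/eqP/setP => x; rewrite !inE; apply/negP => /andP[/(fintype.subsetP BY)].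
  rewrite inE => /andP[xU _] xA; case/negP: xU; apply/finset.bigcupP; by exists a.
exists (fun a : 'I_q.+1 => if unlift ord_max a is Some a' then A a' else B); split=> [a|a|a a'|a x y].
- case: unliftP => [a' _|_] //; by apply: fintype.subset_trans BY _; exact: subsetDl.
- by case: unliftP.
- case: unliftP => [b0 ->|->]; case: unliftP => [b1 ->|->]; rewrite ?eqxx // => ne.
  + by apply: Ad; apply: contra_neq ne => ->.
  + by rewrite disjoint_sym.
- by case: unliftP => [a' _|_]; [exact: AH | exact: BH].
Qed.

End DisjointCliques.

Lemma union_bound (R : realType) (I T : finType) (X : {set T}) (Z : I -> {set T}) (b : R) :
  (forall x, x \in X -> exists i, x \in Z i) -> (forall i, #|Z i|%:R <= b) -> #|X|%:R <= #|I|%:R * b.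
Proof.
move=> cov Zb; apply: (@le_trans _ _ (\sum_i #|Z i|)%:R).
  rewrite ler_nat; apply: leq_trans (leq_card_bigcup _ _); apply: subset_leq_card.
  by apply/fintype.subsetP => x /cov[i xi]; apply/finset.bigcupP; exists i.
rewrite natr_sum; apply: le_trans (ler_sum _ (fun i _ => Zb i)) _.
by rewrite sumr_const mulr_natl.
Qed.

(** First [lam] is chosen to make the excess mass small; then [theta] is chosen against
    $-\ln\lambda$, which may be large. *)
Lemma small_lambda (R : realType) (s : nat) (zeta : R) : 0 < zeta -> exists lam theta : R,
  [/\ 0 < lam, lam <= 1, 0 < theta, lam * s%:R <= zeta / 2 & - ln lam * theta <= zeta / 2].
Proof.
move=> z0; have s0 : 0 <= s%:R :> R by [].
pose lam := Num.min 1 (zeta / (2 * (s%:R + 1))).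
have lam0 : 0 < lam by rewrite lt_min ltr01 divr_gt0 // mulr_gt0 // ltr_wpDl.
have lam1 : lam <= 1 by rewrite ge_min lexx.
have ln0 : 0 <= - ln lam by rewrite oppr_ge0 ln_le0.
exists lam, (zeta / (2 * (- ln lam + 1))); split=> //.
- by rewrite divr_gt0 // mulr_gt0 // ltr_wpDl.
- apply: (@le_trans _ _ (zeta / (2 * (s%:R + 1)) * (s%:R + 1))); last first.
    by rewrite invfM mulrA divfK // gt_eqF // ltr_wpDl.
  apply: ler_pM => //; [exact: ltW | by rewrite ge_min lexx orbT | by rewrite lerDl].
- rewrite mulrCA ler_wpM2l ?(ltW z0) // invfM mulrCA -[leRHS]mulr1 ler_wpM2l ?invr_ge0 //.
  by rewrite ler_pdivrMr ?ltr_wpDl // mul1r lerDl.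
Qed.

Section Transfer.
Variables (s : nat) (c1 : 'I_s) (V : finType) (G : {set {set V}}).
Hypothesis Gs : simple_graph G.
Variables (C : {set V} -> {set 'I_s}).
Hypothesis C0 : forall e : {set V}, #|e| == 2 -> C e != set0.

(* [c] is avoided if possible, so that the pairs of colour [c] are edges of [G]. *)
Definition default (c : 'I_s) (e : {set V}) : 'I_s :=
  if #|e| == 2 then odflt (odflt c1 [pick c' in C e]) [pick c' in C e :\ c] else c1.

Lemma default_in c (e : {set V}) : #|e| == 2 -> default c e \in C e.
Proof.
move=> e2; rewrite /default e2; case: (pickP [pred c' | c' \in C e :\ c]) => [c' /= /[!inE] /andP[] //|_] /=.
case: pickP => //= H; have /set0Pn[c'] := C0 e2; by rewrite (H c').
Qed.

Lemma default1 c (e : {set V}) : #|e| != 2 -> default c e = c1.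
Proof. by rewrite /default => /negPf ->. Qed.

Lemma default_neq c (e : {set V}) : #|e| == 2 -> (2 <= #|C e|)%N -> default c e != c.
Proof.
move=> e2 C2; rewrite /default e2; case: (pickP [pred c' | c' \in C e :\ c]) => [c' /= /[!inE] /andP[] //|H] /=.
have E : C e :\ c = set0 by apply/setP => c'; rewrite [RHS]in_set0; exact: H.
by move: C2; rewrite (cardsD1 c) E cards0 addn0; case: (_ \in _).
Qed.

Definition exceptional (chi : colouring s G) : {set V * V} :=
  [set p | [exists c, (p \in colour_pairs chi c) && (c \notin C [set p.1; p.2])]].

Lemma defect_exceptional c (chi : colouring s G) :
  (defect C (ext_col (default c) chi) <= #|exceptional chi|)%N.
Proof.
apply: leq_trans (ext_col_defect (@default_in c) chi) _.
apply: subset_leq_card; apply/fintype.subsetP => p; rewrite !inE => /andP[pG pC].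
apply/existsP; exists (ext_col (default c) chi [set p.1; p.2]).
by rewrite pC andbT inE (in_colour_class (default c)) pG eqxx.
Qed.

Lemma colour_class_default c (chi : colouring s G) (e : {set V}) : #|e| == 2 -> (2 <= #|C e|)%N ->
  (e \in colour_class chi c) = (ext_col (default c) chi e == c).
Proof.
move=> e2 C2; rewrite (in_colour_class (default c)); have [//|eG] := boolP (e \in G).
by rewrite ext_col_out // (negPf (default_neq c e2 C2)).
Qed.

Lemma card_ext_col d (X : {set colouring s G}) : #|[set ext_col d chi | chi in X]| = #|X|.
Proof. by rewrite card_imset //; exact: ext_col_inj. Qed.

End Transfer.

Lemma exceptional_template (R : realType) (s : nat) (V : finType) (G : {set {set V}}) (C : {set V} -> {set 'I_s})
  (tau : V -> V -> {set 'I_s}) (B : {set V * V}) (chi : colouring s G) (eta b : R) :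
  simple_graph G ->
  (forall c, #|[set p in colour_pairs chi c | c \notin tau p.1 p.2]|%:R <= eta) ->
  (forall p c, p.1 != p.2 -> p \notin B -> c \in tau p.1 p.2 -> c \in C [set p.1; p.2]) ->
  #|B|%:R <= b -> #|exceptional C chi|%:R <= s%:R * eta + b.
Proof.
move=> Gs tauE CE Bb.
apply: (@le_trans _ _ (\sum_c #|[set p in colour_pairs chi c | c \notin tau p.1 p.2]| + #|B|)%:R).
  rewrite ler_nat; apply: (@leq_trans #|(\bigcup_c [set p in colour_pairs chi c | c \notin tau p.1 p.2]) :|: B|).
    apply: subset_leq_card; apply/fintype.subsetP => p; rewrite !inE => /existsP[c /andP[pc cC]].
    have [//|pB] := boolP (p \in B); rewrite ?orbT // orbF; apply/finset.bigcupP; exists c => //; rewrite inE pc /=.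
    apply: contra cC => ct; apply: (CE p) => //.
    apply: contraTneq pc => e; rewrite inE e; exact: colour_class_loop.
  by apply: leq_trans (leq_card_setU _ _) _; rewrite leq_add2r leq_card_bigcup.
rewrite natrD lerD // natr_sum; apply: le_trans (ler_sum _ (fun c _ => tauE c)) _.
by rewrite sumr_const card_ord mulr_natl.
Qed.

(** The allowed product is at most $\exp(\frac{\ln2}{2}(Q-x)n^2)$, and half of the saving pays for
    the colours outside the template. *)
Lemma sparse_template (R : realType) (s : nat) (c1 : 'I_s) (x Q : R) : 0 < x -> exists2 eta : R, 0 < eta &
  forall (V : finType) (G : {set {set V}}) (tau : V -> V -> {set 'I_s}) (X : {set colouring s G}),
  simple_graph G -> pairing tau -> form tau (fun=> 1) <= (Q - x) * #|V|%:R ^+ 2 ->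
  (forall chi, chi \in X -> forall c,
     #|[set p in colour_pairs chi c | c \notin tau p.1 p.2]|%:R <= eta * #|V|%:R ^+ 2) ->
  #|X|%:R <= expR ((ln 2 / 2 * Q - ln 2 / 4 * x) * #|V|%:R ^+ 2).
Proof.
move=> x0; have l2 := ln2_gt0 R.
have [|lam [theta [lam0 lam1 th0 lams lamt]]] := @small_lambda R s (ln 2 / 4 * x).
  by rewrite mulr_gt0 // divr_gt0.
exists (theta / (s%:R + 1)); first by rewrite divr_gt0 // ltr_wpDl.
move=> V G tau X Gs tp small Xt; set n := #|V|%:R.
(* Empty sets become [[set c1]]: [count_basic] needs an allowed colour on every pair, and one colour
   has the same weight as none. *)
pose C (e : {set V}) : {set 'I_s} := if [set c | [exists x in e, exists y in e, c \in tau x y]] == set0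
  then [set c1] else [set c | [exists x in e, exists y in e, c \in tau x y]].
have CE u v : [set c | [exists x in [set u; v], exists y in [set u; v], c \in tau x y]] = tau u v.
  apply/setP => c; rewrite inE; apply/existsP/idP => [[y /andP[yuv /existsP[z /andP[zuv]]]]|cuv].
    by move: yuv zuv; rewrite !inE => /orP[]/eqP -> /orP[]/eqP ->; rewrite ?tp.2 ?inE // tp.1.
  by exists u; rewrite !inE eqxx; apply/existsP; exists v; rewrite !inE eqxx orbT.
have C0 (e : {set V}) : #|e| == 2 -> C e != set0.
  by move=> _; rewrite /C; case: ifPn => // _; apply/set0Pn; exists c1; rewrite inE.
have -> : #|X| = #|[set ext_col (default c1 C c1) chi | chi in X]| by rewrite card_ext_col.
have := @count_basic R s c1 V C lam C0 lam0 lam1 theta (ln 2 / 4 * x) [set ext_col (default c1 C c1) chi | chi in X] lams lamt.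
move=> /(_ _ _)/le_trans -> //.
- by move=> _ /imsetP[chi _ ->]; apply: ext_col_normal => // e; exact: default1.
- move=> _ /imsetP[chi chiX ->]; apply: (@le_trans _ _ #|exceptional C chi|%:R).
    by rewrite ler_nat defect_exceptional.
  apply: (le_trans (exceptional_template (B := set0) (b := 0) Gs (Xt chi chiX) _ _)).
  + by move=> p c _ _; rewrite /C CE; case: ifPn => // /eqP ->; rewrite inE.
  + by rewrite cards0.
  rewrite addr0 mulrA ler_wpM2r ?exprn_ge0 // mulrCA -[leRHS]mulr1 ler_wpM2l ?(ltW th0) //.
  by rewrite ler_pdivrMr ?ltr_wpDl // mul1r lerDl.
rewrite (allowed_prod_form tp C0); last first.
  move=> u v _; rewrite /C CE; case: ifPn => // /eqP ->.
  by rewrite !weight_small ?cards0 ?cards1.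
rewrite -expRD ler_expR.
have : ln 2 / 2 * form tau (fun=> 1) <= ln 2 / 2 * ((Q - x) * n ^+ 2).
  by rewrite ler_wpM2l // divr_ge0 // ltW.
rewrite -/n; lra.
Qed.

Lemma pair_set_inj (V : finType) (X Y : {set V}) : [disjoint X & Y] ->
  {in setX X Y &, injective (fun p : V * V => [set p.1; p.2])}.
Proof.
move=> dXY [x y] [x' y']; rewrite !in_setX /= => /andP[xX yY] /andP[x'X y'Y] E.
have ne u v : u \in X -> v \in Y -> u != v.
  by move=> uX vY; apply: contraTneq vY => <-; rewrite (disjointFr dXY uX).
have : x \in [set x'; y'] by rewrite -E !inE eqxx.
have : y \in [set x'; y'] by rewrite -E !inE eqxx orbT.
by rewrite !inE (negPf (ne x y' xX y'Y)) orbF [y == x']eq_sym (negPf (ne x' y x'X yY)) => /eqP -> /eqP ->.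
Qed.

Section Partition.
Variables (R : realType) (s : nat) (k : 'I_s -> nat) (c1 : 'I_s).
Variables (V : finType) (G : {set {set V}}).
Hypothesis Gs : simple_graph G.
Variables (r : nat) (phi : pattern r s) (lam : V -> 'I_r).
Hypotheses (vphi : valid k (pcol phi)) (phi2 : forall i j, i != j -> (2 <= #|phi [set i; j]|)%N).
Local Notation Q := (Q R k).
Local Notation n := (#|V|%:R : R).
Local Notation part i := [set y | lam y == i].

(** Colour 1 is allowed inside the parts whether or not the template uses it there: a single colour
    has weight 0 and leaves the product unchanged. *)
Definition partition_set (e : {set V}) : {set 'I_s} :=
  if #|lam @: e| == 2 then phi (lam @: e) else [set c1].

Lemma partition_set_pair x y : partition_set [set x; y] =
  if lam x == lam y then [set c1] else phi [set lam x; lam y].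
Proof.
by rewrite /partition_set imsetU1 imset_set1 cards2; case: (eqVneq (lam x) (lam y)).
Qed.

Lemma partition_set_n0 (e : {set V}) : #|e| == 2 -> partition_set e != set0.
Proof.
move=> /cards2P[x [y [_ ->]]]; rewrite partition_set_pair; case: ifPn => [_|/phi2 h].
  by apply/set0Pn; exists c1; rewrite inE.
by rewrite -card_gt0 (leq_trans _ h).
Qed.

(** The pattern pulled back along [lam] is valid on [V], so [form_le_Q] applies with all weights
    equal to 1. *)
Lemma partition_set_prod : allowed_prod R partition_set <= expR (ln 2 / 2 * Q * n ^+ 2).
Proof.
have pp : pairing (fun x y => pcol phi (lam x) (lam y)).
  by split=> [x y|x]; rewrite ?(pcol_pairing phi).2 // (pcol_pairing phi).1.
rewrite (allowed_prod_form pp partition_set_n0); last first.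
  move=> x y _; rewrite partition_set_pair /pcol; case: ifP => // _.
  by rewrite !weight_small ?cards0 ?cards1.
rewrite ler_expR -[leRHS]mulrA ler_wpM2l ?divr_ge0 ?(ltW (ln2_gt0 R)) //.
apply: (le_trans (form_le_Q (k := k) pp (valid_comp lam vphi) (fun=> ler01))).
by rewrite sumr_const.
Qed.

Variables (la zeta theta : R).
Hypotheses (la0 : 0 < la) (la1 : la <= 1).
Hypotheses (la_zeta : la * s%:R <= zeta / 2) (la_theta : - ln la * theta <= zeta / 2).
Local Notation bound := (expR ((zeta + ln 2 / 2 * Q) * n ^+ 2)).

Lemma bound_prod (g : R) : 0 <= g ->
  expR (zeta * n ^+ 2) * allowed_prod R partition_set * g <= bound * g.
Proof.
move=> g0; rewrite ler_wpM2r // mulrDl expRD ler_wpM2l ?expR_ge0 //.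
exact: partition_set_prod.
Qed.

Definition deviates (dl : R) (chi : colouring s G) (c : 'I_s) (m : nat) (A B : {set V}) : bool :=
  dl / 2 * (#|A|%:R * #|B|%:R) <=
    `|(edges_between (colour_class chi c) A B)%:R - m%:R^-1 * (#|A|%:R * #|B|%:R)|.

(** A union bound over the two parts, the colour, the sets [A] and [B], and the sign of the
    deviation; for each choice [count_deviation] applies to the pairs between [A] and [B]. *)
Lemma count_irregular (dl b : R) (X : {set colouring s G}) : 0 < dl -> dl <= 1 -> 0 <= b ->
  (forall chi, chi \in X -> #|exceptional partition_set chi|%:R <= theta * n ^+ 2) ->
  (forall chi, chi \in X -> exists i j c (A B : {set V}), [/\ i != j, c \in phi [set i; j],
     A \subset part i, B \subset part j &
     [/\ b * n <= #|A|%:R, b * n <= #|B|%:R & deviates dl chi c #|phi [set i; j]| A B]]) ->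
  #|X|%:R <= (r * r * s * 4 ^ #|V| * 2)%:R * (bound * expR (- (dl ^+ 2 / 16) * (b * n) ^+ 2)).
Proof.
move=> dl0 dl1 b0 Xex Xdev.
pose I := ('I_r * 'I_r * 'I_s * ({set V} * {set V}) * bool)%type.
pose sg (u : bool) : R := if u then 1 else -1.
pose Z (t : I) : {set colouring s G} := let: (i, j, c, (A, B), u) := t in
  [set chi in X | [&& i != j, c \in phi [set i; j], A \subset part i, B \subset part j,
     b * n <= #|A|%:R, b * n <= #|B|%:R &
     dl / 2 * (#|A|%:R * #|B|%:R) <= sg u * ((edges_between (colour_class chi c) A B)%:R
       - #|phi [set i; j]|%:R^-1 * (#|A|%:R * #|B|%:R))]].
have -> : (r * r * s * 4 ^ #|V| * 2 = #|{: I}|)%N.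
  have cV : #|{set V}| = (2 ^ #|V|)%N
    by rewrite -[LHS]cardsT -powersetT card_powerset cardsT.
  by rewrite !card_prod !card_ord card_bool cV -expnMn.
apply: (@union_bound R I _ X Z) => [chi chiX|[[[[i j] c] [A B]] u]].
  have [i [j [c [A [B [ij cij Ai Bj [Ab Bb dev]]]]]]] := Xdev chi chiX.
  move: dev; rewrite /deviates; set D := (_ - _ : R) => dev.
  exists (i, j, c, (A, B), 0 <= D); rewrite inE chiX ij cij Ai Bj Ab Bb /= -/D /sg.
  move: dev; case: (lerP 0 D) => D0; first by rewrite ger0_norm // mul1r.
  by rewrite ltr0_norm // mulN1r.
rewrite /Z; set Zt := [set chi in X | _].
have [->|/set0Pn[chi0]] := eqVneq Zt set0.
  by rewrite cards0 mulr_ge0 ?expR_ge0.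
rewrite inE => /andP[_ /and5P[ij cij Ai Bj /and3P[Ab Bb _]]].
have dAB : [disjoint A & B].
  rewrite -setI_eq0; apply/eqP/setP => x; rewrite !inE; apply/negP => /andP[xA xB].
  have := fintype.subsetP Ai x xA; have := fintype.subsetP Bj x xB; rewrite !inE => /eqP -> /eqP e.
  by rewrite e eqxx in ij.
pose P := [set [set p.1; p.2] | p in setX A B].
have PE : #|P| = (#|A| * #|B|)%N by rewrite card_in_imset ?cardsX //; exact: pair_set_inj.
have Pin (e : {set V}) : e \in P -> [/\ #|e| == 2, c \in partition_set e & #|partition_set e| = #|phi [set i; j]|].
  move=> /imsetP[[x y] /[!in_setX] /= /andP[xA yB] ->].
  have := fintype.subsetP Ai x xA; have := fintype.subsetP Bj y yB; rewrite !inE => /eqP ly /eqP lx.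
  rewrite partition_set_pair lx ly (negPf ij) cij cards2; split=> //.
  by rewrite (_ : x != y) //; apply: contraNneq ij => xy; rewrite -lx -ly xy.
pose psi (chi : colouring s G) := ext_col (default c1 partition_set c) chi.
have cnt (chi : colouring s G) :
    #|[set e in P | psi chi e == c]| = edges_between (colour_class chi c) A B.
  rewrite /edges_between -(card_in_imset (f := fun p : V * V => [set p.1; p.2])); last first.
    by move=> p p' /setIdP[p1 _] /setIdP[p2 _]; exact: (pair_set_inj dAB).
  apply: eq_card => e; apply/setIdP/imsetP => [[/imsetP[p pAB ->] pc]|[p /setIdP[pAB pc] ->]].
    exists p => //; rewrite inE pAB.
    have [e2 _ em] := Pin _ (imset_f _ pAB).
    by rewrite (colour_class_default c1 (C := partition_set)) // em phi2.
  have pP : [set p.1; p.2] \in P by apply: imset_f.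
  split=> //; have [e2 _ em] := Pin _ pP.
  by rewrite -(colour_class_default c1 (C := partition_set)) // em phi2.
have -> : #|Zt| = #|[set psi chi | chi in Zt]| by rewrite card_ext_col.
apply: (le_trans (@count_deviation R s c1 V partition_set la partition_set_n0 la0 la1 theta zeta [set psi chi | chi in Zt]
   la_zeta la_theta _ _ P c #|phi [set i; j]| (sg u * (dl / 4)) dl (phi2 ij) Pin dl0 dl1 _ _)).
- by move=> _ /imsetP[chi _ ->]; apply: ext_col_normal => // e; exact: default1.
- move=> _ /imsetP[chi /setIdP[chiX _] ->]; apply: le_trans (Xex chi chiX).
  by rewrite ler_nat; apply: defect_exceptional => //; exact: partition_set_n0.
- by rewrite normrM /sg (ger0_norm (x := dl / 4)) ?divr_ge0 ?(ltW dl0) //; case: u {Zt chi0};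
    rewrite ?normrN normr1 mul1r.
- move=> _ /imsetP[chi /setIdP[chiX /and5P[_ _ _ _ /and3P[_ _ dev]]] ->]; rewrite cnt PE natrM.
  have := ler_wpM2l (x := dl / 4) (divr_ge0 (ltW dl0) (ler0n _ _)) dev.
  lra.
apply: le_trans (bound_prod (expR_ge0 _)) _.
rewrite ler_wpM2l ?expR_ge0 // ler_expR PE natrM.
rewrite !mulNr lerN2 ler_wpM2l ?divr_ge0 ?sqr_ge0 // expr2 ler_pM ?mulr_ge0 //.
Qed.

End Partition.

(** * Systems of cliques in colour 1 *)

Section CliqueSystems.
Variables (R : realType) (s : nat) (k : 'I_s -> nat) (c1 : 'I_s).
Variables (V : finType) (G : {set {set V}}).
Hypothesis Gs : simple_graph G.
Variables (r : nat) (phi : pattern r s) (lam : V -> 'I_r).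
Hypotheses (vphi : valid k (pcol phi)) (phi2 : forall i j, i != j -> (2 <= #|phi [set i; j]|)%N).
Hypothesis phi1 : forall i j, i != j -> c1 \in phi [set i; j].
Local Notation Q := (Q R k).
Local Notation n := (#|V|%:R : R).
Local Notation C := (partition_set c1 phi lam).
Variables (la zeta theta : R).
Hypotheses (la0 : 0 < la) (la1 : la <= 1).
Hypotheses (la_zeta : la * s%:R <= zeta / 2) (la_theta : - ln la * theta <= zeta / 2).
Local Notation bound := (expR ((zeta + ln 2 / 2 * Q) * n ^+ 2)).
Variables (p w : nat).
Local Notation system := {ffun 'I_r * 'I_p * 'I_w -> V}.

Definition union_of (f : system) (h : 'I_r -> 'I_p) : {set V} :=
  [set f (q.1, h q.1, q.2) | q in [set: 'I_r * 'I_w]].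

(** A block lists its vertices with repetitions, so that blocks of different sizes share the index
    type ['I_w]. That blocks are cliques is left to [monochromatic], as it depends on the
    colouring. *)
Definition clique_system (l : nat) (f : system) : Prop :=
  [/\ forall i a b, lam (f (i, a, b)) = i,
      forall i a a' b b', a != a' -> f (i, a, b) != f (i, a', b') &
      forall h, (l <= #|union_of f h|)%N].

Definition monochromatic (chi : colouring s G) (f : system) : Prop :=
  forall i a b b', f (i, a, b) != f (i, a, b') ->
    [set f (i, a, b); f (i, a, b')] \in colour_class chi c1.

Lemma card_union_of f h : (#|union_of f h| <= r * w)%N.
Proof.
by apply: leq_trans (leq_imset_card _ _) _; rewrite cardsT card_prod !card_ord.
Qed.

(* Two systems [shift t] and [shift t'] agree in at most one part, hence they
   have no crossing pair in common. *)
Definition shift (t : 'I_p * 'I_p) (i : 'I_r) : 'I_p :=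
  Ordinal (ltn_pmod (t.1 + i * t.2) (leq_ltn_trans (leq0n _) (ltn_ord t.1))).

Definition crossing (f : system) (h : 'I_r -> 'I_p) : {set {set V}} :=
  [set e : {set V} | [&& #|e| == 2, e \subset union_of f h & #|lam @: e| == 2]].

Lemma union_ofP l f h x : clique_system l f -> x \in union_of f h -> exists b, x = f (lam x, h (lam x), b).
Proof.
by move=> [fl _ _] /imsetP[[i b] _ /= ->]; exists b; rewrite fl.
Qed.

Lemma crossing_disjoint l f (t t' : 'I_p * 'I_p) : clique_system l f -> coprime p r`! -> t != t' ->
  [disjoint crossing f (shift t) & crossing f (shift t')].
Proof.
move=> cs cp tt'; rewrite -setI_eq0; apply/eqP/setP => e; rewrite !inE; apply/negP.
move=> /andP[/and3P[/cards2P[x [y [xy ->]]] eU l2] /and3P[_ eU' _]].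
have lxy : lam x != lam y by move: l2; rewrite imsetU1 imset_set1 cards2; case: (eqVneq (lam x) (lam y)).
have same z : z \in union_of f (shift t) -> z \in union_of f (shift t') ->
    t.1 + lam z * t.2 = t'.1 + lam z * t'.2 %[mod p].
  move=> /(union_ofP cs)[b zb] /(union_ofP cs)[b' zb'].
  have [_ dis _] := cs; have /(congr1 val) // : shift t (lam z) = shift t' (lam z).
  by apply/eqP; apply: contraTT isT => /(dis (lam z) _ _ b b'); rewrite -zb -zb' eqxx.
have xe : x \in [set x; y] by rewrite !inE eqxx.
have ye : y \in [set x; y] by rewrite !inE eqxx orbT.
have ex := same x (fintype.subsetP eU x xe) (fintype.subsetP eU' x xe).
have ey := same y (fintype.subsetP eU y ye) (fintype.subsetP eU' y ye).
have [e1 e2] := index_inj cp (ltn_ord (lam x)) (ltn_ord (lam y)) lxy (ltn_ord t.1) (ltn_ord t.2)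
  (ltn_ord t'.1) (ltn_ord t'.2) ex ey.
case/eqP: tt'; case: t t' e1 e2 {eU eU' same ex ey} => [a b] [a' b'] /= /val_inj -> /val_inj -> //.
Qed.

Lemma crossing_colour f h (e : {set V}) : e \in crossing f h -> (#|e| == 2) && (c1 \in C e).
Proof.
rewrite inE => /and3P[/cards2P[x [y [xy ->]]] _].
rewrite imsetU1 imset_set1 !cards2 xy partition_set_pair; case: (eqVneq (lam x) (lam y)) => //= ? _.
exact: phi1.
Qed.

Lemma card_crossing f h : (#|crossing f h| <= 2 ^ (r * w))%N.
Proof.
apply: (@leq_trans #|powerset (union_of f h)|).
  by apply: subset_leq_card; apply/fintype.subsetP => e; rewrite inE powersetE => /and3P[].
by rewrite card_powerset leq_exp2l // card_union_of.
Qed.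

(** The blocks selected by [shift t] are cliques of colour 1 with at least [k c1] vertices in total;
    if all pairs crossing between the parts had colour 1 too, they would form a forbidden clique. *)
Lemma not_mono (chi : colouring s G) f (t : 'I_p * 'I_p) : valid_colouring k chi -> clique_system (k c1) f ->
  monochromatic chi f -> ~~ mono c1 (fun t => crossing f (shift t)) t (ext_col (default c1 C c1) chi).
Proof.
move=> /forallP/(_ c1) vc cs mf; apply: contra vc => /forall_inP mc.
have [fl _ big] := cs.
apply: (contains_clique_le (big (shift t))); apply/existsP; exists (union_of f (shift t)); rewrite eqxx /=.
apply/forall_inP => x xU; apply/forall_inP => y yU; apply/implyP => xy.
have [b xb] := union_ofP cs xU; have [b' yb'] := union_ofP cs yU.
have [lxy|lxy] := eqVneq (lam x) (lam y).
  by rewrite xb yb' -lxy; apply: mf; rewrite -xb lxy -yb'.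
rewrite (colour_class_default c1 (C := C)) ?cards2 ?xy //; last first.
  by rewrite partition_set_pair (negPf lxy) phi2.
apply: mc; rewrite inE cards2 xy imsetU1 imset_set1 cards2 lxy eqxx andbT /=.
by apply/fintype.subsetP => z; rewrite !inE => /orP[]/eqP ->.
Qed.

(** There are $n^{rpw}$ systems, and for each of them $p^2$ selections without common crossing pairs
    must all fail to be joined up. When [p] is linear in $n$, the resulting factor beats the number
    of systems. *)
Lemma count_cliques (X : {set colouring s G}) : coprime p r`! ->
  (forall chi, chi \in X -> #|exceptional C chi|%:R <= theta * n ^+ 2) ->
  (forall chi, chi \in X -> valid_colouring k chi /\ exists f, clique_system (k c1) f /\ monochromatic chi f) ->
  #|X|%:R <= (#|V| ^ (r * p * w))%:R * (bound * (1 - s%:R^-1 ^+ (2 ^ (r * w))) ^+ (p * p)).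
Proof.
move=> cp Xex Xf.
have -> : (#|V| ^ (r * p * w) = #|{: system}|)%N by rewrite card_ffun !card_prod !card_ord.
pose Z (f : system) : {set colouring s G} := [set chi in X | `[< clique_system (k c1) f /\ monochromatic chi f >]].
apply: (@union_bound R _ _ X Z) => [chi chiX|f].
  by have [_ [f Hf]] := Xf chi chiX; exists f; rewrite inE chiX; apply/asboolP.
have C0 := partition_set_n0 c1 lam phi2.
have sinv : s%:R^-1 <= 1 :> R.
  have s0 : (0 < s)%N by case: (s) c1 => [[]|].
  by rewrite invf_le1 ?ltr0n // ler1n.
have [->|/set0Pn[chi0]] := eqVneq (Z f) set0.
  by rewrite cards0 mulr_ge0 ?expR_ge0 // exprn_ge0 // subr_ge0 exprn_ile1 // invr_ge0.
rewrite inE => /andP[_ /asboolP[cs _]].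
have -> : #|Z f| = #|[set ext_col (default c1 C c1) chi | chi in Z f]| by rewrite card_ext_col.
apply: (@le_trans _ _ (expR (zeta * n ^+ 2) * allowed_prod R C * (1 - s%:R^-1 ^+ (2 ^ (r * w))) ^+ (p * p))); last first.
  apply: bound_prod => //.
  by rewrite exprn_ge0 // subr_ge0 exprn_ile1 // invr_ge0.
have -> : (p * p = #|{: 'I_p * 'I_p}|)%N by rewrite card_prod !card_ord.
apply: (@count_tuples R s c1 V C la C0 la0 la1 theta zeta [set ext_col (default c1 C c1) chi | chi in Z f]
  la_zeta la_theta _ _ _ (fun t => crossing f (shift t)) (2 ^ (r * w))).
- by move=> _ /imsetP[chi _ ->]; apply: ext_col_normal => // e; exact: default1.
- move=> _ /imsetP[chi /setIdP[chiX _] ->]; apply: le_trans (Xex chi chiX).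
  by rewrite ler_nat; exact: defect_exceptional.
- by move=> t t'; exact: (crossing_disjoint cs cp).
- by move=> t e; exact: crossing_colour.
- by move=> t; exact: card_crossing.
move=> _ t /imsetP[chi /setIdP[chiX /asboolP[_ mf]] ->].
by have [vc _] := Xf chi chiX; exact: (not_mono t vc cs mf).
Qed.

End CliqueSystems.

(** * Unstable colourings *)

Lemma set_codom (V : finType) (A : {set V}) (w : nat) : (0 < #|A| <= w)%N ->
  exists g : 'I_w -> V, (forall b, g b \in A) /\ forall x, x \in A -> exists b, x = g b.
Proof.
move=> /andP[/card_gt0P[x0 x0A] Aw]; exists (fun b : 'I_w => nth x0 (enum A) b); split=> [b|x xA].
  have [lt|ge] := ltnP b (size (enum A)); last by rewrite nth_default.
  by rewrite -mem_enum mem_nth.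
have xe : x \in enum A by rewrite mem_enum.
have iw : (index x (enum A) < w)%N by apply: leq_trans Aw; rewrite cardE index_mem.
by exists (Ordinal iw); rewrite /= nth_index.
Qed.

(** The colour classes are disjoint, and each of the $|S|\le s$ colours has density above
    $1/|S|-\delta$. *)
Lemma edges_between_regular (R : realType) (s : nat) (c1 : 'I_s) (V : finType) (G : {set {set V}})
  (chi : colouring s G) (S : {set 'I_s}) (A B : {set V}) (delta : R) : simple_graph G ->
  0 < delta -> S != set0 ->
  (forall c, c \in S -> regular_pair delta #|S|%:R^-1 (colour_class chi c) A B) ->
  (1 - s%:R * delta) * (#|A|%:R * #|B|%:R) <= (edges_between G A B)%:R.
Proof.
move=> Gs d0 S0 reg; set N : R := #|A|%:R * #|B|%:R.
have N0 : 0 <= N by rewrite mulr_ge0.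
have [->|N1] := eqVneq N 0; first by rewrite mulr0.
have Sr : 0 < #|S|%:R :> R by rewrite ltr0n card_gt0.
have Ss : #|S|%:R <= s%:R :> R by rewrite ler_nat -[leqRHS]card_ord max_card.
pose psi := ext_col (fun=> c1) chi.
apply: (@le_trans _ _ (\sum_(c in S) edges_between (colour_class chi c) A B)%:R); last first.
  rewrite ler_nat /edges_between [leqRHS](card_fibres (fun p : V * V => psi [set p.1; p.2])).
  rewrite [leqRHS](bigID (mem S)) /=; apply: leq_trans (leq_addr _ _).
  apply: leq_sum => c _; apply: subset_leq_card; apply/fintype.subsetP => p; rewrite !inE.
  by rewrite (in_colour_class (fun=> c1)) => /and3P[-> -> ->].
rewrite natr_sum; apply: (@le_trans _ _ (\sum_(c in S) (#|S|%:R^-1 - delta) * N)); last first.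
  apply: ler_sum => c /reg[/andP[h _] _]; rewrite -ler_pdivlMr ?lt_neqAle 1?eq_sym ?N1 //.
  exact: ltW.
rewrite sumr_const -[leRHS]mulr_natl mulrA ler_wpM2r // mulrBr divff ?gt_eqF //.
by rewrite lerB // ler_wpM2r // ltW.
Qed.

Section Unstable.
Variables (R : realType) (s : nat) (k : 'I_s -> nat) (c1 : 'I_s).
Variables (V : finType) (G : {set {set V}}).
Hypothesis Gs : simple_graph G.
Variables (r : nat) (phi : pattern r s) (lam : V -> 'I_r) (al : 'rV[R]_r).
Hypothesis phi2 : forall i j, i != j -> (2 <= #|phi [set i; j]|)%N.
Local Notation n := (#|V|%:R : R).
Local Notation C := (partition_set c1 phi lam).
Local Notation part := (fun i => [set y | lam y == i]).
Local Notation inside := [set p : V * V | (lam p.1 == lam p.2) && ([set p.1; p.2] \in G)].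

Lemma card_inside : (\sum_i #|induced_subgraph G (part i)| <= #|inside|)%N.
Proof.
rewrite [leqRHS](card_fibres (fun p : V * V => lam p.1)); apply: leq_sum => i _.
pose T := {x : V | x \in part i}.
have inj : injective (fun e : {set T} => [set val x | x in e]) by apply: imset_inj; exact: val_inj.
rewrite -(card_imset _ inj); apply: leq_trans (leq_imset_card (fun p : V * V => [set p.1; p.2]) _).
apply: subset_leq_card; apply/fintype.subsetP => _ /imsetP[e + ->]; rewrite inE => eG.
have /cards2P[x [y [xy E]]] := simple_card Gs eG.
have inp z : z \in [set x; y] -> lam z = i.
  by rewrite -E => /imsetP[u _ ->]; have := valP u; rewrite inE => /eqP.
have lx : lam x = i by apply: inp; rewrite !inE eqxx.
have ly : lam y = i by apply: inp; rewrite !inE eqxx orbT.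
by apply/imsetP; exists (x, y); rewrite // !inE /= lx ly eqxx -E eG.
Qed.

Lemma card_inside_colour (chi : colouring s G) :
  (#|[set e : {e : {set V} | e \in G} | [exists i, val e \subset part i] && (chi e != c1)]|
    <= #|exceptional C chi|)%N.
Proof.
have inj : injective (val : {e : {set V} | e \in G} -> {set V}) by exact: val_inj.
rewrite -(card_imset _ inj); apply: leq_trans (leq_imset_card (fun p : V * V => [set p.1; p.2]) _).
apply: subset_leq_card; apply/fintype.subsetP => _ /imsetP[e + ->]; rewrite inE => /andP[/existsP[i ei] ec].
have /cards2P[x [y [xy E]]] := simple_card Gs (valP e).
have inp z : z \in [set x; y] -> lam z = i.
  by rewrite -E => /(fintype.subsetP ei); rewrite inE => /eqP.
have lx : lam x = i by apply: inp; rewrite !inE eqxx.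
have ly : lam y = i by apply: inp; rewrite !inE eqxx orbT.
apply/imsetP; exists (x, y) => //; rewrite inE; apply/existsP; exists (chi e).
rewrite /= partition_set_pair lx ly eqxx !inE ec andbT /=.
by rewrite -E (in_colour_class (fun=> c1)) ext_colE eqxx (valP e).
Qed.

(** Without an irregular pair and without clique sizes [l] of too large a sum, every clause of the
    structure holds: edges inside the parts are few, or all but exceptional ones have colour 1. *)
Lemma unstable_cases (delta a th : R) (chi : colouring s G) : 0 < delta -> 0 < a -> (0 < #|V|)%N ->
  th <= delta -> (forall i, a * n <= #|part i|%:R) ->
  (forall i, `|#|part i|%:R - al 0 i * n| < 1) ->
  #|exceptional C chi|%:R <= th * n ^+ 2 ->
  #|inside|%:R <= th * n ^+ 2 \/ ~ strong_extension_property R k /\ (forall i j, i != j -> c1 \in phi [set i; j]) ->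
  ~ stable_structure k c1 delta chi phi al part ->
  (exists i j c (A B : {set V}), [/\ i != j, c \in phi [set i; j], A \subset part i, B \subset part j &
     [/\ Num.min delta 1 * a * n <= #|A|%:R, Num.min delta 1 * a * n <= #|B|%:R &
         deviates (Num.min delta 1) chi c #|phi [set i; j]| A B]]) \/
  ((forall i j, i != j -> c1 \in phi [set i; j]) /\
   exists l : 'I_r -> nat, [/\ forall i, (0 < l i)%N,
     forall i, far_from_clique_free delta (l i) (induced_subgraph G (part i)) &
     (k c1 <= \sum_i l i)%N]).
Proof.
move=> d0 a0 V0 thd lo clo Hex alt nst.
have n0 : 0 < n by rewrite ltr0n.
have dl0 : 0 <= Num.min delta 1 by rewrite le_min (ltW d0) ler01.
have pne i : part i != set0.
  by rewrite -card_gt0 -(ltr0n R); apply: lt_le_trans (lo i); rewrite mulr_gt0.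
apply: contrapT => /not_orP[nirr nfar]; apply: nst; split=> // [i j ij|big].
  have reg c : c \in phi [set i; j] -> regular_pair delta #|phi [set i; j]|%:R^-1 (colour_class chi c) (part i) (part j).
    move=> cij; apply: contrapT => nreg; apply: nirr.
    have [A [B [Ai Bj [Ab Bb] dev]]] := irregular_witness d0 (pne i) (pne j) nreg.
    exists i, j, c, A, B; split=> //; split=> //.
      by apply: le_trans Ab; rewrite -mulrA ler_wpM2l.
    by apply: le_trans Bb; rewrite -mulrA ler_wpM2l.
  split=> //; apply: (edges_between_regular c1 Gs d0 _ reg).
  by rewrite -card_gt0 (leq_trans _ (phi2 ij)).
case: alt => [small|[nstr phi1]].
  exfalso; move: big; rewrite ltNge => /negP[]; apply: (@le_trans _ _ #|inside|%:R).
    by rewrite ler_nat card_inside.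
  by apply: (le_trans small); rewrite ler_wpM2r.
split=> // [|l l0 lf].
  apply: (@le_trans _ _ #|exceptional C chi|%:R); first by rewrite ler_nat card_inside_colour.
  by apply: (le_trans Hex); rewrite ler_wpM2r.
rewrite leqNgt; apply/negP => ll; apply: nfar; split=> //; exists l; split=> //.
by move: ll; rewrite -ltnS; case: (k c1) => // m; rewrite subn1 /=.
Qed.

(** Truncating each [l i] at [k c1] bounds the block size and keeps the sum at least [k c1]. Inside
    the parts few edges lack colour 1, so [disjoint_cliques] can be applied to that colour class. *)
Lemma far_system (delta a th : R) (chi : colouring s G) (l : 'I_r -> nat) (p : nat) :
  (forall i, (0 < l i)%N) -> (0 < k c1)%N ->
  (forall i, far_from_clique_free delta (l i) (induced_subgraph G (part i))) ->
  (k c1 <= \sum_i l i)%N -> 0 < delta -> 0 < a ->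
  (forall i, a * n <= #|part i|%:R) -> #|exceptional C chi|%:R <= th * n ^+ 2 ->
  (p * k c1)%:R < a * n -> th * n ^+ 2 + (p * k c1)%:R * n < delta * (a * n) ^+ 2 ->
  exists f : {ffun 'I_r * 'I_p * 'I_(k c1) -> V}, clique_system lam (k c1) f /\ monochromatic c1 chi f.
Proof.
move=> l0 k0 far big d0 a0 lo Hex pw small; set w := k c1.
pose H := colour_class chi c1.
have HG : H \subset G.
  by apply/fintype.subsetP => e; rewrite (in_colour_class (fun=> c1)) => /andP[].
pose l' i := minn (l i) w.
have l'0 i : (0 < l' i <= l i)%N by rewrite leq_min l0 k0 geq_minl.
have bad i : #|[set e in G | (e \subset part i) && (e \notin H)]|%:R <= th * n ^+ 2.
  apply: le_trans Hex; rewrite ler_nat; apply: leq_trans (card_inside_colour chi).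
  have inj : injective (val : {e : {set V} | e \in G} -> {set V}) by exact: val_inj.
  rewrite -(card_imset _ inj); apply: subset_leq_card; apply/fintype.subsetP => e; rewrite inE => /and3P[eG ei eH].
  apply/imsetP; exists (Sub e eG) => //; rewrite inE; apply/andP; split; first by apply/existsP; exists i.
  by apply: contra eH => chie; rewrite (in_colour_class (fun=> c1)) eG -(ext_colE (fun=> c1)) in chie *.
have l'w i : (l' i <= w)%N by rewrite geq_minr.
have pl i : (p * l' i)%:R <= (p * w)%:R :> R by rewrite ler_nat leq_mul2l l'w orbT.
have an0 : 0 <= a * n by rewrite mulr_ge0 // ltW.
have sys i : exists A : 'I_p -> {set V}, [/\ forall b, A b \subset part i, forall b, #|A b| = l' i,
    forall b b', b != b' -> [disjoint A b & A b'] &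
    forall b x y, x \in A b -> y \in A b -> x != y -> [set x; y] \in H].
  apply: (disjoint_cliques Gs HG (far i) (bad i) (l'0 i)).
    by rewrite -(ltr_nat R); apply: le_lt_trans (pl i) (lt_le_trans pw (lo i)).
  apply: (@le_lt_trans _ _ (th * n ^+ 2 + (p * w)%:R * n)).
    by rewrite lerD2l natrM ler_wpM2r.
  by apply: (lt_le_trans small); rewrite ler_wpM2l ?(ltW d0) // lerXn2r ?nnegrE.
have [A HA] := fin_all_exists sys.
have gex (q : 'I_r * 'I_p) : exists g : 'I_w -> V, (forall b, g b \in A q.1 q.2) /\ forall x, x \in A q.1 q.2 -> exists b, x = g b.
  by apply: set_codom; have [_ -> _ _] := HA q.1; rewrite l'w; have /andP[->] := l'0 q.1.
have [g Hg] := fin_all_exists gex.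
pose f : {ffun 'I_r * 'I_p * 'I_w -> V} := [ffun t => g t.1 t.2].
have fA i b c : f (i, b, c) \in A i b by rewrite ffunE; exact: (Hg (i, b)).1.
have lamf i b x : x \in A i b -> lam x = i.
  by have [/(_ b)/fintype.subsetP sub _ _ _] := HA i; move=> /sub; rewrite inE => /eqP.
exists f; split; last first.
  by move=> i b c c' ne; have [_ _ _ cl] := HA i; exact: (cl b).
split=> [i b c|i b b' c c' bb'|h].
- exact: lamf (fA i b c).
- apply/eqP => e; have [_ _ /(_ b b' bb') dis _] := HA i.
  by have := fA i b' c'; rewrite -e (disjointFr dis (fA i b c)).
rewrite (card_fibres lam); apply: (@leq_trans (\sum_i l' i)).
  have [/existsP[i wi]|] := boolP [exists i, w <= l i]%N.
    by rewrite (bigD1 i) //= /l' (minn_idPr wi) leq_addr.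
  rewrite negb_exists => /forallP small'; apply: (leq_trans big).
  apply: leq_sum => i _; rewrite /l' leq_min leqnn /=; apply: ltnW; rewrite ltnNge; exact: small'.
apply: leq_sum => i _; have [_ /(_ (h i)) <- _ _] := HA i.
apply: subset_leq_card; apply/fintype.subsetP => x xA; rewrite inE (lamf _ _ _ xA) eqxx andbT.
have [c xc] := (Hg (i, h i)).2 x xA; by apply/imsetP; exists (i, c); rewrite ?in_setT ?ffunE.
Qed.

End Unstable.

(** * Factors of lower order *)

Section Absorb.
Variable R : realType.

Lemma absorb_exponential (g : R) (c : nat) : 0 < g -> exists N : nat, forall n : nat, (N <= n)%N -> (0 < n)%N ->
  (c * 4 ^ n)%:R <= expR (g * n%:R ^+ 2) :> R.
Proof.
move=> g0; have [N HN] := eventually_ge ((c%:R + 4) / g); exists N => n Nn n0.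
have n1 : 1 <= n%:R :> R by rewrite ler1n.
apply: (@le_trans _ _ (expR (c%:R + 4 * n%:R))).
  rewrite natrM expRD ler_pM //; first by apply: le_trans (expR_ge1Dx _); rewrite lerDr.
  rewrite mulrC expRM_natl natrX lerXn2r ?nnegrE ?expR_ge0 //.
  by apply: le_trans (expR_ge1Dx _); rewrite lerDr.
rewrite ler_expR; have := HN n Nn; rewrite ler_pdivrMr // => h.
apply: (@le_trans _ _ ((c%:R + 4) * n%:R)); first by rewrite [leRHS]mulrDl lerD2r ler_peMr.
by rewrite expr2 mulrA ler_wpM2r // mulrC.
Qed.

Lemma absorb_power (g : R) (r : nat) : 0 < g -> exists N : nat, forall n m : nat, (N <= n)%N -> (0 < n)%N ->
  m%:R <= r%:R * n%:R :> R -> (n ^ m)%:R <= expR (g * n%:R ^+ 2) :> R.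
Proof.
move=> g0; have r0 : 0 < r%:R + 1 :> R by rewrite ltr_wpDl.
have [|N HN] := @ln_le_linear R (g / (r%:R + 1)); first by rewrite divr_gt0.
exists N => n m Nn n0 mr; have nR : 0 < n%:R :> R by rewrite ltr0n.
rewrite natrX -[X in X ^+ m]lnK ?posrE // -expRM_natl ler_expR.
apply: (@le_trans _ _ ((r%:R + 1) * n%:R * (g / (r%:R + 1) * n%:R))).
  apply: ler_pM; rewrite ?ln_ge0 ?ler1n //; last exact: HN.
  by apply: (le_trans mr); rewrite ler_wpM2r // lerDl.
rewrite [_ * _ * _](_ : _ = g * n%:R ^+ 2) //.
by field; rewrite gt_eqF.
Qed.

(** A multiple of [F] plus 1 is coprime to [F]. *)
Lemma coprime_between (F : nat) (t : R) : (0 < F)%N -> 4 * F%:R <= t ->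
  exists p : nat, [/\ coprime p F, t / 4 <= p%:R & p%:R <= t].
Proof.
move=> F0 tF; have F1 : 1 <= F%:R :> R by rewrite ler1n.
have t0 : 0 <= t / (2 * F%:R) by rewrite divr_ge0 ?mulr_ge0 //; lra.
exists (Num.truncn (t / (2 * F%:R)) * F + 1)%N.
have := truncn_itv t0; set u := Num.truncn _ => /andP[lo hi].
have F2 : 0 < 2 * F%:R :> R by lra.
rewrite ler_pdivlMr // in lo; rewrite ltr_pdivrMr // -addn1 natrD in hi.
split.
- by rewrite coprime_sym /coprime gcdnMDl gcdn1.
- rewrite natrD natrM; lra.
- rewrite natrD natrM; lra.
Qed.

Lemma dvdn_fact_fact (m n : nat) : (m <= n)%N -> (m`! %| n`!)%N.
Proof. by move=> mn; rewrite -(bin_fact mn) mulnCA dvdn_mulr. Qed.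

End Absorb.

Section CloseTemplate.
Variables (R : realType) (s : nat) (k : 'I_s -> nat) (c1 : 'I_s).
Hypotheses (k2 : forall c, (2 <= k c)%N) (hext : extension_property R k).
Local Notation Q := (Q R k).

(** An exceptional pair has a colour outside the template or lies in one of the two mismatch sets.
    If the template is nearly empty inside the parts, the same count for the sets [C'], which allow
    nothing there, bounds the edges inside. *)
Lemma exceptional_inside (V : finType) (G : {set {set V}}) (r : nat) (phi : pattern r s) (lam : V -> 'I_r)
  (tau : V -> V -> {set 'I_s}) (chi : colouring s G) (eta eps th : R) :
  simple_graph G ->
  #|[set p : V * V | (lam p.1 != lam p.2) && (tau p.1 p.2 != pcol phi (lam p.1) (lam p.2))]|%:R <= eps ->
  #|[set p : V * V | (lam p.1 == lam p.2) && (tau p.1 p.2 != set0)]|%:R <= eps \/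
  [/\ ~ strong_extension_property R k, forall i j, i != j -> c1 \in pcol phi i j &
    #|[set p : V * V | (lam p.1 == lam p.2) && ~~ (tau p.1 p.2 \subset [set c1])]|%:R <= eps] ->
  (forall c, #|[set p in colour_pairs chi c | c \notin tau p.1 p.2]|%:R <= eta) ->
  s%:R * eta + 2 * eps <= th ->
  #|exceptional (partition_set c1 phi lam) chi|%:R <= th /\
  (#|[set p : V * V | (lam p.1 == lam p.2) && ([set p.1; p.2] \in G)]|%:R <= th \/
   ~ strong_extension_property R k /\ forall i j, i != j -> c1 \in phi [set i; j]).
Proof.
move=> Gs cross alt tauE thE.
set B1 := [set p : V * V | (lam p.1 != lam p.2) && _] in cross.
have eps0 : 0 <= eps by apply: le_trans cross.
split.
  apply: le_trans thE; pose B2 := [set p : V * V | (lam p.1 == lam p.2) && ~~ (tau p.1 p.2 \subset [set c1])].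
  apply: (exceptional_template (B := B1 :|: B2) Gs tauE).
    move=> p c _; rewrite !inE negb_or partition_set_pair /pcol.
    case: eqVneq => /= [_ /negPn/fintype.subsetP|_]; first exact.
    by rewrite andbT negbK => /eqP ->.
  have B2le : #|B2|%:R <= eps.
    case: alt => [h|[_ _ //]]; apply: le_trans h; rewrite ler_nat; apply: subset_leq_card.
    apply/fintype.subsetP => p; rewrite !inE => /andP[-> /=]; apply: contraNneq => ->.
    exact: finset.sub0set.
  apply: (@le_trans _ _ (#|B1| + #|B2|)%:R); first by rewrite ler_nat leq_card_setU.
  by rewrite natrD (_ : 2 * eps = eps + eps) ?lerD // mulr_natl.
case: alt => [h|[nstr phi1 _]]; last first.
  by right; split=> // i j ij; have := phi1 i j ij; rewrite /pcol (negPf ij).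
left; apply: (@le_trans _ _ (s%:R * eta + eps)); last by apply: le_trans thE; rewrite lerD2l; lra.
pose C' (e : {set V}) : {set 'I_s} := if #|lam @: e| == 2 then [set: 'I_s] else set0.
have C'E x y : C' [set x; y] = if lam x == lam y then set0 else [set: 'I_s].
  by rewrite /C' imsetU1 imset_set1 cards2; case: (eqVneq (lam x) (lam y)).
apply: le_trans (exceptional_template (C := C') Gs tauE _ h).
  rewrite ler_nat; apply: subset_leq_card; apply/fintype.subsetP => p; rewrite !inE => /andP[lp pG].
  apply/existsP; exists (ext_col (fun=> c1) chi [set p.1; p.2]).
  by rewrite C'E lp inE (in_colour_class (fun=> c1)) pG eqxx in_set0.
move=> p c _; rewrite !inE C'E; case: eqVneq => /= [_ /negPn/eqP ->|_ _ _]; first by rewrite inE.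
exact: in_setT.
Qed.

Lemma close_template (delta : R) : 0 < delta -> exists eps eta g : R, exists N : nat,
  [/\ 0 < eps, 0 < eta, 0 < g &
  forall (V : finType) (G : {set {set V}}) (tau : V -> V -> {set 'I_s}) (r : nat) (phi : pattern r s)
    (al : 'rV[R]_r) (lam : V -> 'I_r) (X : {set colouring s G}),
  simple_graph G -> (N <= #|V|)%N -> opt_star k phi al ->
  (forall i, `|#|[set y | lam y == i]|%:R - al 0 i * #|V|%:R| < 1) ->
  #|[set p : V * V | (lam p.1 != lam p.2) && (tau p.1 p.2 != pcol phi (lam p.1) (lam p.2))]|%:R
      <= eps * #|V|%:R ^+ 2 ->
  #|[set p : V * V | (lam p.1 == lam p.2) && (tau p.1 p.2 != set0)]|%:R <= eps * #|V|%:R ^+ 2 \/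
  [/\ ~ strong_extension_property R k, forall i j, i != j -> c1 \in pcol phi i j &
    #|[set p : V * V | (lam p.1 == lam p.2) && ~~ (tau p.1 p.2 \subset [set c1])]|%:R <= eps * #|V|%:R ^+ 2] ->
  (forall chi, chi \in X -> valid_colouring k chi /\
     ~ stable_structure k c1 delta chi phi al (fun i => [set y | lam y == i])) ->
  (forall chi, chi \in X -> forall c,
     #|[set p in colour_pairs chi c | c \notin tau p.1 p.2]|%:R <= eta * #|V|%:R ^+ 2) ->
  #|X|%:R <= expR ((ln 2 / 2 * Q - g) * #|V|%:R ^+ 2)].
Proof.
move=> d0; pose dl := Num.min delta 1.
have dl0 : 0 < dl by rewrite lt_min d0 ltr01.
have dl1 : dl <= 1 by rewrite ge_min lexx orbT.
have dld : dl <= delta by rewrite ge_min lexx.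
have [r0 Hr0] := rank_bound k c1.
have [a0 a00 Ha0] := opt_constants k2 c1 hext (ltr01 : 0 < 1 :> R).
(* Every part will have at least [a * n] vertices; halving the least weight absorbs the rounding
   error of 1. *)
pose a := Num.min a0 1 / 2.
have a1 : 0 < Num.min a0 1 by rewrite lt_min a00 ltr01.
have a12 : Num.min a0 1 <= 1 by rewrite ge_min lexx orbT.
have apos : 0 < a by rewrite divr_gt0.
have ale : a <= 1 / 2 by rewrite /a ler_pM2r ?invr_gt0.
have aa0 : 2 * a <= a0 by rewrite /a mulrC divfK // ge_min lexx.
pose w := k c1; have w0 : (0 < w)%N := ltnW (k2 c1).
have wR : 0 < w%:R :> R by rewrite ltr0n.
(* The number [p] of cliques per part will lie between [kap * n / 4] and [kap * n]. They then occupy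
   at most [dl * a ^+ 2 / 4 * n] vertices, too few to use up the distance from being clique-free. *)
pose kap := dl * a ^+ 2 / (4 * w%:R).
have kap0 : 0 < kap by rewrite divr_gt0 ?mulr_gt0 // exprn_gt0.
have kapw : kap * w%:R = dl * a ^+ 2 / 4 by rewrite /kap; field; rewrite gt_eqF.
have s0 : (0 < s)%N by case: (s) c1 => [[]|].
(* A lower bound for the probability that one selection of cliques is joined up in colour 1. *)
pose sig : R := s%:R^-1 ^+ (2 ^ (r0 * w)).
have sig0 : 0 < sig by rewrite exprn_gt0 // invr_gt0 ltr0n.
have sinv : s%:R^-1 <= 1 :> R by rewrite invf_le1 ?ltr0n // ler1n.
pose g1 := dl ^+ 2 / 16 * (dl * a) ^+ 2; pose g2 := sig * (kap / 4) ^+ 2.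
have g10 : 0 < g1 by rewrite mulr_gt0 ?divr_gt0 ?exprn_gt0 // mulr_gt0.
have g20 : 0 < g2 by rewrite mulr_gt0 // exprn_gt0 // divr_gt0.
(* Of [4 * g], one [g] pays for the colours outside the template, one for the union bound, and one
   for adding the two cases. *)
pose g := Num.min g1 g2 / 4.
have g0 : 0 < g by rewrite divr_gt0 // lt_min g10.
have gg1 : 4 * g <= g1 by rewrite /g mulrC divfK // ge_min lexx.
have gg2 : 4 * g <= g2 by rewrite /g mulrC divfK // ge_min lexx orbT.
have [la [theta [la0 la1 theta0 las lat]]] := small_lambda s g0.
pose th := Num.min theta (dl * a ^+ 2 / 4).
have da0 : 0 < dl * a ^+ 2 / 4 by rewrite divr_gt0 ?mulr_gt0 // exprn_gt0.
have th0 : 0 < th by rewrite lt_min theta0.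
have tht : th <= theta by rewrite ge_min lexx.
have tha : th <= dl * a ^+ 2 / 4 by rewrite ge_min lexx orbT.
have a2 : a ^+ 2 <= a / 2 by rewrite expr2 ler_pM2l //; lra.
have daa : dl * a ^+ 2 <= a ^+ 2 by rewrite ler_piMl // exprn_ge0 // ltW.
have dad : dl * a ^+ 2 <= dl by rewrite ler_piMr ?(ltW dl0) //; lra.
have [N1 HN1] := eventually_ge (1 / a).
have [N2 HN2] := eventually_ge (4 * r0`!%N%:R / kap).
have [N3 HN3] := absorb_exponential (r0 * r0 * s * 2) g0.
have [N4 HN4] := absorb_power r0 g0.
have [N5 HN5] := absorb_exponential 2 g0.
exists (th / 4), (th / (2 * (s%:R + 1))), g, (maxn 1 (maxn (maxn N1 N2) (maxn (maxn N3 N4) N5))).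
split=> //; [by rewrite divr_gt0 | by rewrite divr_gt0 // mulr_gt0 // ltr_wpDl |].
move=> V G tau r phi al lam X Gs; rewrite !geq_max => /and3P[V0 /andP[/HN1 VN1 /HN2 VN2] /andP[/andP[VN3 VN4] VN5]].
have {}VN3 := HN3 _ VN3 V0; have {}VN5 := HN5 _ VN5 V0; have {}HN4 m := HN4 _ m VN4 V0.
clear HN1 HN2 HN3 HN5 VN4.
move=> opt clo cross alt Xbad Xtau; set n : R := #|V|%:R.
have n0 : 0 < n by rewrite ltr0n.
have n2 : 0 < n ^+ 2 by rewrite exprn_gt0.
have [[[cfree phi2] _] _ _] := opt.
have vphi : valid k (pcol phi) by apply/valid_pcol.
have rr0 : (r <= r0)%N.
  rewrite -[leqLHS]card_ord; apply: (Hr0 _ (pcol phi)) => //; first exact: pcol_pairing.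
  by move=> i j ij; rewrite /pcol (negPf ij) -card_gt0 (leq_trans _ (phi2 i j ij)).
have lo i : a * n <= #|[set y | lam y == i]|%:R.
  have [al0 _ _] := Ha0 r phi al opt.
  have : 2 * a * n <= al 0 i * n by rewrite ler_wpM2r // (le_trans aa0).
  move: VN1; rewrite -/n ler_pdivrMr // => VN1 h.
  have := clo i; rewrite -/n ltr_norml => /andP[h' _]; clear -h h' VN1; lra.
have thE : s%:R * (th / (2 * (s%:R + 1)) * n ^+ 2) + 2 * (th / 4 * n ^+ 2) <= th * n ^+ 2.
  have : s%:R * (th / (2 * (s%:R + 1))) <= th / 2.
    rewrite mulrA ler_pdivrMr ?mulr_gt0 ?ltr_wpDl //.
    have : 0 <= th by exact: ltW.
    clear; move=> ?; nra.
  move=> h; have := ler_wpM2r (ltW n2) h; clear; lra.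
have exc chi : chi \in X -> _ := fun chiX => exceptional_inside Gs cross alt (Xtau chi chiX) thE.
have thd : th <= delta by clear -tha dad dld dl0; lra.
have Xex chi : chi \in X -> #|exceptional (partition_set c1 phi lam) chi|%:R <= theta * n ^+ 2.
  by move=> /exc[h _]; apply: (le_trans h); rewrite ler_pM2r.
pose irr (chi : colouring s G) := exists i j c (A B : {set V}),
  [/\ i != j, c \in phi [set i; j], A \subset [set y | lam y == i], B \subset [set y | lam y == j] &
     [/\ dl * a * n <= #|A|%:R, dl * a * n <= #|B|%:R & deviates dl chi c #|phi [set i; j]| A B]].
pose far (chi : colouring s G) := (forall i j, i != j -> c1 \in phi [set i; j]) /\
   exists l : 'I_r -> nat, [/\ forall i, (0 < l i)%N,
     forall i, far_from_clique_free delta (l i) (induced_subgraph G [set y | lam y == i]) &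
     (k c1 <= \sum_i l i)%N].
pose X1 := [set chi in X | `[< irr chi >]]; pose X2 := [set chi in X | `[< far chi >]].
have cov : (#|X| <= #|X1| + #|X2|)%N.
  apply: leq_trans (leq_card_setU _ _); apply: subset_leq_card; apply/fintype.subsetP => chi chiX.
  have [vc nst] := Xbad chi chiX; have [h1 h2] := exc chi chiX.
  rewrite !inE chiX /=; apply/orP.
  by have [h|h] := unstable_cases Gs phi2 d0 apos V0 thd lo clo h1 h2 nst; [left|right]; apply/asboolP.
have B1 : #|X1|%:R <= expR ((ln 2 / 2 * Q - 2 * g) * n ^+ 2).
  have := @count_irregular R s k c1 V G Gs r phi lam vphi phi2 la g theta la0 la1 las lat dl (dl * a) X1 dl0 dl1.
  move=> /(_ (mulr_ge0 (ltW dl0) (ltW apos)) _ _)/le_trans -> //.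
  - by move=> chi /setIdP[/Xex].
  - by move=> chi /setIdP[_ /asboolP].
  apply: (@le_trans _ _ (expR (g * n ^+ 2) * (expR ((g + ln 2 / 2 * Q) * n ^+ 2) * expR (- g1 * n ^+ 2)))).
    apply: ler_pM => //.
      apply: le_trans VN3; rewrite ler_nat [leqLHS]mulnAC.
      by do 3![rewrite leq_mul2r; apply/orP; right]; exact: leq_mul.
    by rewrite ler_wpM2l ?expR_ge0 // ler_expR /g1 exprMn -/n; clear; lra.
  rewrite -!expRD ler_expR; have := ler_wpM2r (ltW n2) gg1; clear; lra.
have B2 : #|X2|%:R <= expR ((ln 2 / 2 * Q - 2 * g) * n ^+ 2).
  have [->|/set0Pn[chi0]] := eqVneq X2 set0; first by rewrite cards0 expR_ge0.
  move=> /setIdP[chi0X /asboolP[phi1 [l [l0 lf lk]]]].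
  have [||p [cp plo phi']] := @coprime_between R r0`!%N (kap * n); first exact: fact_gt0.
    by move: VN2; rewrite -/n ler_pdivrMr // [n * _]mulrC.
  have pw : (p * w)%:R <= dl * a ^+ 2 / 4 * n.
    by rewrite natrM -kapw mulrAC ler_wpM2r.
  have := @count_cliques R s k c1 V G Gs r phi lam vphi phi2 phi1 la g theta la0 la1 las lat p w X2
    (coprime_dvdr (dvdn_fact_fact rr0) cp).
  move=> /(_ _ _)/le_trans -> //.
  - by move=> chi /setIdP[/Xex].
  - move=> chi /setIdP[chiX _]; have [vc _] := Xbad chi chiX; split=> //.
    have [h1 _] := exc chi chiX.
    apply: (far_system Gs l0 w0 lf lk d0 apos lo h1).
      apply: (le_lt_trans pw); rewrite ltr_pM2r //.
      clear -a2 daa apos; lra.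
    have := ler_wpM2r (ltW n0) pw; rewrite -[_ * n * n]mulrA -expr2 => h.
    have h' := ler_wpM2r (ltW n2) tha.
    apply: (@le_lt_trans _ _ (dl * a ^+ 2 / 2 * n ^+ 2)); first by clear -h h'; lra.
    have -> : delta * (a * #|V|%:R) ^+ 2 = delta * a ^+ 2 * n ^+ 2 by rewrite exprMn mulrA.
    rewrite ltr_pM2r //; apply: (@lt_le_trans _ _ (dl * a ^+ 2)).
      by clear -da0; lra.
    by rewrite ler_wpM2r // exprn_ge0 // ltW.
  apply: (@le_trans _ _ (expR (g * n ^+ 2) * (expR ((g + ln 2 / 2 * Q) * n ^+ 2) * expR (- g2 * n ^+ 2)))).
    have sr : sig <= s%:R^-1 ^+ (2 ^ (r * w)).
      by rewrite ler_wiXn2l ?invr_ge0 // leq_exp2l // leq_mul2r rr0 orbT.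
    have s1 : 0 <= 1 - s%:R^-1 ^+ (2 ^ (r * w)) :> R by rewrite subr_ge0 exprn_ile1 // invr_ge0.
    apply: ler_pM => //; first by rewrite mulr_ge0 ?expR_ge0 // exprn_ge0.
      apply: HN4; rewrite -mulnA natrM -/n ler_pM ?ler_nat //.
      rewrite -(ler_nat R); apply: (le_trans pw); rewrite ler_piMl ?(ltW n0) //; clear -a2 daa ale; lra.
    rewrite ler_wpM2l ?expR_ge0 //.
    apply: (@le_trans _ _ (expR (- sig) ^+ (p * p))).
      rewrite lerXn2r ?nnegrE ?expR_ge0 //; apply: le_trans (expR_ge1Dx _).
      by rewrite lerD2l lerN2.
    rewrite -expRM_natl ler_expR mulrN mulNr lerN2 natrM [leRHS]mulrC.
    have -> : g2 * n ^+ 2 = sig * ((kap * n / 4) * (kap * n / 4)) by rewrite /g2; clear; field.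
    rewrite ler_wpM2l ?(ltW sig0) //.
    have h0 : 0 <= kap * n / 4 by rewrite divr_ge0 // mulr_ge0 // ltW.
    exact: ler_pM.
  rewrite -!expRD ler_expR; have := ler_wpM2r (ltW n2) gg2; clear; lra.
apply: (@le_trans _ _ (#|X1| + #|X2|)%:R); first by rewrite ler_nat.
rewrite natrD; apply: (@le_trans _ _ (expR (g * n ^+ 2) * expR ((ln 2 / 2 * Q - 2 * g) * n ^+ 2))).
  apply: (@le_trans _ _ (2 * expR ((ln 2 / 2 * Q - 2 * g) * n ^+ 2))).
    by rewrite mulr_natl mulr2n lerD.
  rewrite ler_wpM2r ?expR_ge0 //; apply: le_trans VN5.
  by rewrite natrM ler_peMr // ler1n expn_gt0.
by rewrite -expRD ler_expR; clear; lra.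
Qed.

End CloseTemplate.

Section BadCount.
Variables (R : realType) (s : nat) (k : 'I_s -> nat) (c1 : 'I_s).
Hypotheses (k2 : forall c, (2 <= k c)%N) (kmax : forall c, (k c <= k c1)%N).
Hypothesis hext : extension_property R k.
Local Notation Q := (Q R k).

Definition structured (delta : R) (V : finType) (G : {set {set V}}) (chi : colouring s G) : Prop :=
  exists (r : nat) (phi : pattern r s) (alpha : 'rV[R]_r) (Y : 'I_r -> {set V}),
    [/\ opt_star k phi alpha, vertex_partition Y & stable_structure k c1 delta chi phi alpha Y].

Lemma fibre_partition (V : finType) (r : nat) (lam : V -> 'I_r) :
  vertex_partition (fun i => [set y | lam y == i]).
Proof.
split=> [i j ij|].
  rewrite -setI_eq0; apply/eqP/setP => x; rewrite !inE; apply/negP => /andP[/eqP -> /eqP e].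
  by rewrite e eqxx in ij.
by apply/setP => x; rewrite [RHS]inE; apply/finset.bigcupP; exists (lam x); rewrite ?inE.
Qed.

Lemma absorb_codes (g : R) (c : nat) : 0 < g -> exists N : nat, forall n : nat, (N <= n)%N ->
  (2 ^ (c * n))%:R <= expR (g * n%:R ^+ 2) :> R.
Proof.
move=> g0; have [N HN] := eventually_ge (c%:R / g); exists N => n /HN.
rewrite ler_pdivrMr // => h; apply: (@le_trans _ _ (expR 1 ^+ (c * n))).
  rewrite natrX lerXn2r ?nnegrE ?expR_ge0 //.
  by apply: le_trans (expR_ge1Dx _).
rewrite -expRM_natl ler_expR mulr1 natrM expr2 mulrA ler_wpM2r //.
by rewrite mulrC.
Qed.

Lemma count_unstructured (delta : R) : 0 < delta -> exists g : R, exists N : nat, 0 < g /\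
  forall (V : finType) (G : {set {set V}}), simple_graph G -> (N <= #|V|)%N ->
  #|[set chi : colouring s G | valid_colouring k chi && ~~ `[< structured delta chi >]]|%:R
    <= expR ((ln 2 / 2 * Q - g) * #|V|%:R ^+ 2).
Proof.
move=> d0; have [eps [eta1 [g1 [N1 [eps0 eta10 g10 close]]]]] := @close_template R s k c1 k2 hext delta d0.
have [m [M [N2 [eta2 [x [eta20 x0 stab]]]]]] := stability k2 kmax hext eps0.
have [eta3 eta30 sparse] := @sparse_template R s c1 x Q x0.
pose eta := Num.min eta1 (Num.min eta2 eta3).
have eta0 : 0 < eta by rewrite !lt_min eta10 eta20.
have e1 : eta <= eta1 by rewrite ge_min lexx.
have e2 : eta <= eta2 by rewrite !ge_min lexx !orbT.
have e3 : eta <= eta3 by rewrite !ge_min lexx !orbT.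
(* One size for the sample with its two further vertices, the other for the averaging bound. *)
pose J (b : bool) : finType := if b then (option (option 'I_m) : finType) else ('I_M : finType).
have [K HK] := @container R s k bool J eta eta0.
pose g := Num.min g1 (ln 2 / 4 * x).
have g0 : 0 < g by rewrite lt_min g10 mulr_gt0 // divr_gt0 // ln2_gt0.
have g20 : 0 < g / 2 by rewrite divr_gt0.
have [N3 HN3] := absorb_codes (2 * K * s) g20.
exists (g / 2), (maxn (maxn 1 N1) (maxn N2 N3)); split=> // V G Gs.
rewrite !geq_max => /andP[/andP[V0 VN1] /andP[VN2 /HN3 VN3]]; set n : R := #|V|%:R.
have n2 : 0 <= n ^+ 2 by rewrite exprn_ge0.
set X := [set chi | _].
pose small (t : code s V K) (chi : colouring s G) : Prop :=
  forall c, #|[set p in colour_pairs chi c | c \notin template t p.1 p.2]|%:R <= eta * n ^+ 2.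
pose few (t : code s V K) : Prop :=
  forall b, #|[set F : {ffun J b -> V} | ~~ valid k (fun u v => template t (F u) (F v))]|%:R <= eta * n ^+ #|J b|.
pose Z t := [set chi in X | `[< few t /\ small t chi >]].
apply: (@le_trans _ _ (#|{: code s V K}|%:R * expR ((ln 2 / 2 * Q - g) * n ^+ 2))); last first.
  rewrite card_code; apply: (@le_trans _ _ (expR (g / 2 * n ^+ 2) * expR ((ln 2 / 2 * Q - g) * n ^+ 2))).
    by rewrite ler_wpM2r ?expR_ge0.
  by rewrite -expRD ler_expR; clear; lra.
apply: (@union_bound R _ _ X Z) => [chi chiX|t].
  have vc : valid_colouring k chi by move: chiX; rewrite inE => /andP[].
  have [t [t1 t2]] := HK V (colour_pairs chi) V0 (colour_pairs_sym chi) (colour_pairs_irr Gs (fun=> c1) chi)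
    (fun c h => colour_pairs_free Gs (fun=> c1) h vc).
  by exists t; rewrite inE chiX; apply/asboolP.
have [->|/set0Pn[chi0]] := eqVneq (Z t) set0; first by rewrite cards0 expR_ge0.
move=> /setIdP[_ /asboolP[ft _]]; set tau := template t.
have tp : pairing tau by exact: template_pairing.
have Zsmall (eta' : R) : eta <= eta' -> forall chi, chi \in Z t -> forall c,
    #|[set p in colour_pairs chi c | c \notin tau p.1 p.2]|%:R <= eta' * n ^+ 2.
  by move=> ee chi /setIdP[_ /asboolP[_ sm]] c; apply: (le_trans (sm c)); rewrite ler_wpM2r.
have fin (g' : R) : g <= g' -> expR ((ln 2 / 2 * Q - g') * n ^+ 2) <= expR ((ln 2 / 2 * Q - g) * n ^+ 2).
  by move=> gg; rewrite ler_expR ler_wpM2r // lerB.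
have [dense|sp] := leP ((Q - x) * n ^+ 2) (form tau (fun=> 1)); last first.
  apply: le_trans (sparse V G tau (Z t) Gs tp (ltW sp) (Zsmall _ e3)) (fin _ _).
  by rewrite ge_min lexx orbT.
have ee (j : nat) : eta * n ^+ j <= eta2 * n ^+ j by rewrite ler_wpM2r // exprn_ge0.
have fM : #|invalid k 'I_M tau|%:R <= eta2 * n ^+ M.
  by have := le_trans (ft false) (ee _); rewrite [#|J false|]card_ord.
have [r [phi [al [lam [opt clo cross alt]]]]] := stab V tau tp V0 VN2 dense (le_trans (ft true) (ee _)) fM.
apply: le_trans (close V G tau r phi al lam (Z t) Gs VN1 opt clo cross alt _ (Zsmall _ e1)) (fin _ _).
  move=> chi /setIdP[/[!inE] /andP[vc /asboolPn nst] _]; split=> // st; apply: nst.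
  by exists r, phi, al, (fun i => [set y | lam y == i]); split=> //; exact: fibre_partition.
by rewrite ge_min lexx.
Qed.

End BadCount.

(** The term linear in $n$ comes from $2\binom n2=n^2-n$. *)
Lemma num_valid_lower (R : realType) (s : nat) (k : 'I_s -> nat) (V : finType) (G : {set {set V}}) (Q eps : R) :
  (1 < #|V|)%N -> (0 < num_valid k G)%N -> 0 <= eps ->
  Q - eps <= log2 ((num_valid k G)%:R : R) / 'C(#|V|, 2)%:R ->
  expR (ln 2 / 2 * ((Q - eps) * #|V|%:R ^+ 2 - Q * #|V|%:R)) <= (num_valid k G)%:R.
Proof.
move=> V1 F0 eps0; have l2 := ln2_gt0 R; set n : R := #|V|%:R.
have C0 : 0 < 'C(#|V|, 2)%:R :> R by rewrite ltr0n bin_gt0.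
have CE : 2 * 'C(#|V|, 2)%:R = n * (n - 1) :> R.
  rewrite /n -natrM -(mul_bin_diag _ 1) bin1 natrM -subn1 natrB //; exact: ltnW.
rewrite ler_pdivlMr // /log2 ler_pdivlMr // => h.
have FE : (num_valid k G)%:R = expR (ln (num_valid k G)%:R) :> R by rewrite lnK // posrE ltr0n.
rewrite FE ler_expR; apply: le_trans h.
have -> : (Q - eps) * 'C(#|V|, 2)%:R * ln 2 = ln 2 / 2 * ((Q - eps) * (n * (n - 1))).
  by rewrite -CE; field.
rewrite ler_wpM2l ?divr_ge0 ?(ltW l2) //.
have : 0 <= eps * n by rewrite mulr_ge0.
clear; lra.
Qed.

Unset Implicit Arguments.

Theorem theorem1p4 (R : realType) (s : nat) (hs : (2 <= s)%N) (k : 'I_s -> nat)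
    (hk_mono : forall c d : 'I_s, (c <= d)%N -> (k d <= k c)%N)
    (hk3 : forall c : 'I_s, (3 <= k c)%N)
    (hext : extension_property R k) (delta : R) (hdelta : 0 < delta) :
  exists (n0 : nat) (eps : R), [/\ (0 < n0)%N, 0 < eps &
    forall (V : finType) (G : {set {set V}}), simple_graph G ->
      (n0 <= #|V|)%N ->
      Q R k - eps <= log2 ((num_valid k G)%:R : R) / 'C(#|V|, 2)%:R ->
      (1 - 2 `^ (- (eps * #|V|%:R ^+ 2))) * (num_valid k G)%:R
        <= #|[set chi : colouring s G | valid_colouring k chi &&
               `[< exists (r : nat) (phi : pattern r s) (alpha : 'rV[R]_r)
                     (Y : 'I_r -> {set V}),
                   [/\ opt_star k phi alpha, vertex_partition Y &
                       stable_structure k (Ordinal (ltnW hs)) delta chi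
                         phi alpha Y] >] ]|%:R].
Proof.
have k2 c : (2 <= k c)%N by exact: ltnW (hk3 c).
have kmax c : (k c <= k (Ordinal (ltnW hs)))%N by exact: hk_mono.
have [g [N1 [g0 count]]] := count_unstructured k2 kmax hext hdelta.
have l2 := ln2_gt0 R.
have [N2 HN2] := eventually_ge (ln 2 * Q R k / g).
(* The exponent [g] is spent completely: [g / 3] on the factor $2^{-\varepsilon n^2}$, [g / 6] on
   the $\varepsilon$ in the lower bound for [num_valid], and [g / 2] on its linear term, using
   $n\ge\ln2\cdot Q/g$. *)
exists (maxn 2 (maxn N1 N2)), (g / (3 * ln 2)).
have eps0 : 0 < g / (3 * ln 2) by rewrite divr_gt0 // mulr_gt0.
split=> //; first by rewrite leq_max.
move=> V G Gs; rewrite !geq_max => /and3P[V1 VN1 /HN2 VN2] lower.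
set good := [set chi | _].
have split_good : (num_valid k G = #|good| +
    #|[set chi : colouring s G | valid_colouring k chi && ~~ `[< structured k (Ordinal (ltnW hs)) delta chi >]]|)%N.
  rewrite /num_valid -(cardsID [set chi : colouring s G | `[< structured k (Ordinal (ltnW hs)) delta chi >]]).
  by congr (_ + _)%N; apply: eq_card => chi; rewrite !inE // andbC.
(* This case is separate because [log2] of 0 is 0 here, so the hypothesis on the logarithm does not
   ensure that there are valid colourings. *)
have [F0|F0] := posnP (num_valid k G); first by rewrite F0 mulr0.
have := num_valid_lower V1 F0 (ltW eps0) lower; have := count V G Gs VN1.
move=> bad low; rewrite mulrBl mul1r lerBlDr {1}split_good natrD lerD2l.
apply: (le_trans bad); apply: (@le_trans _ _ (2 `^ (- (g / (3 * ln 2) * #|V|%:R ^+ 2)) *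
   expR (ln 2 / 2 * ((Q R k - g / (3 * ln 2)) * #|V|%:R ^+ 2 - Q R k * #|V|%:R)))); last first.
  by rewrite ler_wpM2l // powR_ge0.
rewrite /powR pnatr_eq0 /= -expRD ler_expR; set n : R := #|V|%:R in VN2 *.
move: VN2; rewrite ler_pdivrMr // => VN2.
have n0 : 0 <= n by [].
have := ler_wpM2r n0 VN2; rewrite [n * g * n]mulrAC -expr2.
have -> : g / (3 * ln 2) = g / 3 / ln 2 by rewrite invfM mulrA.
have -> : - (g / 3 / ln 2 * n ^+ 2) * ln 2 = - (g / 3 * n ^+ 2).
  by rewrite mulNr mulrAC divfK // gt_eqF.
have -> : ln 2 / 2 * ((Q R k - g / 3 / ln 2) * n ^+ 2 - Q R k * n) =
   ln 2 / 2 * Q R k * n ^+ 2 - g / 6 * n ^+ 2 - ln 2 / 2 * Q R k * n.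
  by field; rewrite gt_eqF.
clear; lra.
Qed.
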